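(* Let $1<p<\infty$, $0<s<1$, $i\in\{1,\dots,N\}$ and let $u\in L^p(\mathbb{R}^N)$. Then $$\lim_{\delta\to 0^+}\frac{1}{\delta^{p(1-s)}}[u]^i_{s,p,\delta}=\frac{2}{p(1-s)}\|\partial_i u\|_p^p ,$$ where the right-hand side is understood as $+\infty$ if the distributional derivative $\partial_i u$ does not belong to $L^p(\mathbb{R}^N)$.
   Context: For $\delta>0$, $0<s<1$, $1<p<\infty$, a measurable $u:\mathbb{R}^N\to\mathbb{R}$ and the $i$-th canonical vector $e_i$, $$[u]^i_{s,p,\delta}=\int_{\mathbb{R}^N}\int_{|h|\le\delta}\frac{|u(x+he_i)-u(x)|^p}{|h|^{1+sp}}\,dh\,dx\in[0,\infty] ,$$ where $h\in\mathbb{R}$ (no $p$-th root is taken). $\|\cdot\|_p$ is the norm of $L^p(\mathbb{R}^N)$. *)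

(* Defs.v *)
From HB Require Import structures.
From mathcomp Require Import all_boot all_order all_algebra.
From mathcomp Require Import all_classical all_reals all_analysis.

Set Implicit Arguments.
Unset Strict Implicit.
Unset Printing Implicit Defensive.

Import Order.TTheory GRing.Theory Num.Theory.
Import numFieldNormedType.Exports.

Local Open Scope classical_set_scope.
Local Open Scope ring_scope.

(* R^n is 'rV[R]_n, with the product sigma-algebra generated by the n
   coordinates (as n.-tuple in the library); R being second countable, this is
   the Borel sigma-algebra of the topology of 'rV[R]_n. *)
Definition measure_rV_display (d : measure_display) : measure_display.
Proof. exact: d. Qed.

Section measurable_rV.
Context {R : realType}.
Variable n : nat.

Let coors : 'I_n -> 'rV[R]_n -> R := fun i x => x ord0 i.

Let rV_set0 : g_sigma_preimage coors set0.
Proof. exact: sigma_algebra0. Qed.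

Let rV_setC A : g_sigma_preimage coors A -> g_sigma_preimage coors (~` A).
Proof. exact: sigma_algebraC. Qed.

Let rV_bigcup (F : _^nat) : (forall i, g_sigma_preimage coors (F i)) ->
  g_sigma_preimage coors (\bigcup_i (F i)).
Proof. exact: sigma_algebra_bigcup. Qed.

HB.instance Definition _ := @isMeasurable.Build
  (measure_rV_display default_measure_display)
  'rV[R]_n (g_sigma_preimage coors) rV_set0 rV_setC rV_bigcup.

End measurable_rV.

Lemma measurable_fun_rVP d (T : measurableType d) (R : realType) (n : nat)
    (f : T -> 'rV[R]_n) :
  (forall i, measurable_fun [set: T] (fun x => f x ord0 i)) ->
  measurable_fun [set: T] f.
Proof.
move=> mf _ A mA; rewrite setTI.
pose G := [set B : set 'rV[R]_n | measurable (f @^-1` B)].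
suff : (measurable : set (set 'rV[R]_n)) `<=` G by exact.
apply: smallest_sub => [|B].
  split => [|B|F]; rewrite /G /=.
  - by rewrite preimage_set0.
  - by rewrite setTD preimage_setC => ?; exact: measurableC.
  - rewrite preimage_bigcup => mF; exact: bigcupT_measurable.
rewrite -bigcup_seq => -[i _ [C mC <-]]; rewrite /G /= setTI.
by rewrite -[X in measurable X]setTI; exact: mf.
Qed.

Definition coord_rV {R : realType} {n : nat} (i : 'I_n) (x : 'rV[R]_n) : R :=
  x ord0 i.

Lemma measurable_coord_rV (R : realType) (n : nat) (i : 'I_n) :
  measurable_fun [set: 'rV[R]_n] (coord_rV i).
Proof.
move=> _ A mA; apply: sub_sigma_algebra; rewrite -bigcup_seq /=.
by exists i; [exact: mem_index_enum | exists A].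
Qed.

Definition snoc_rV {R : realType} {n : nat} (z : 'rV[R]_n * R) :
  'rV[R]_n.+1 := \row_j oapp (z.1 ord0) z.2 (unlift ord_max j).

Lemma measurable_snoc_rV (R : realType) (n : nat) :
  measurable_fun [set: 'rV[R]_n * R] (@snoc_rV R n).
Proof.
apply: measurable_fun_rVP => i; rewrite /snoc_rV.
under eq_fun do rewrite mxE.
case: unliftP => [j|] _ /=; last exact: measurable_snd.
exact: (measurableT_comp (measurable_coord_rV j) measurable_fst).
Qed.

Definition snoc_measure {R : realType} {n : nat}
    (m : {measure set 'rV[R]_n -> \bar R}) : set 'rV[R]_n.+1 -> \bar R :=
  pushforward (m \x lebesgue_measure)%E snoc_rV.

HB.instance Definition _ (R : realType) (n : nat)
    (m : {measure set 'rV[R]_n -> \bar R}) :=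
  Measure.copy (snoc_measure m)
    (measure_function_pushforward__canonical__measure_function_Measure
      (m \x lebesgue_measure)%E (@measurable_snoc_rV R n)).

(* Lebesgue measure on R^n: R^0 is a point, and R^(n+1) = R^n x R *)
Fixpoint lebesgue_rV (R : realType) (n : nat) :
    {measure set 'rV[R]_n -> \bar R} :=
  match n return {measure set 'rV[R]_n -> \bar R} with
  | 0 => \d_(0 : 'rV[R]_0)
  | m.+1 => snoc_measure (lebesgue_rV R m)
  end.

Section test_functions.
Context {R : realType} {n : nat}.
Implicit Types phi : 'rV[R]_n -> R.

Definition canonical_vector (i : 'I_n) : 'rV[R]_n := delta_mx 0 i.

Definition partial (i : 'I_n) phi : 'rV[R]_n -> R :=
  fun x => 'D_(canonical_vector i) phi x.

Definition iter_partial (s : seq 'I_n) phi : 'rV[R]_n -> R :=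
  foldr partial phi s.

(* C^infinity: all iterated partial derivatives exist and are continuous *)
Definition smooth phi : Prop :=
  forall s : seq 'I_n, continuous (iter_partial s phi) /\
    forall (i : 'I_n) (x : 'rV[R]_n),
      derivable (iter_partial s phi) x (canonical_vector i).

Definition compactly_supported phi : Prop :=
  compact (closure [set x | phi x != 0]).

Definition test_function phi : Prop := smooth phi /\ compactly_supported phi.

End test_functions.

Section sobolev.
Local Open Scope ereal_scope.
Context {R : realType} {n : nat}.
Implicit Types u g : 'rV[R]_n -> R.

(* the distributional derivative of u in direction e_i is (represented by) g *)
Definition distributional_partial (i : 'I_n) u g : Prop :=
  forall phi : 'rV[R]_n -> R, test_function phi ->
    \int[lebesgue_rV R n]_x (u x * partial i phi x)%:E =
    - \int[lebesgue_rV R n]_x (g x * phi x)%:E.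

Definition directional_energy (s p delta : R) (i : 'I_n) u : \bar R :=
  \int[lebesgue_rV R n]_x
    \int[lebesgue_measure]_(h in [set h : R | (`|h| <= delta)%R])
      (`|u (x + h *: canonical_vector i)%R - u x| `^ p
        / `|h| `^ (1 + s * p))%:E.

End sobolev.

(* Main.v *)
Require Import Defs.
From HB Require Import structures.
From mathcomp Require Import all_boot all_order all_algebra.
From mathcomp Require Import all_classical all_reals all_analysis measurable_realfun.
From mathcomp Require Import ring lra.

Set Implicit Arguments.
Unset Strict Implicit.
Unset Printing Implicit Defensive.

Import Order.TTheory GRing.Theory Num.Theory.
Import numFieldNormedType.Exports.

Local Open Scope classical_set_scope.
Local Open Scope ring_scope.

(* Translation along e_i is a one-parameter group tau of measure preserving
   maps of R^N. By Fubini and this invariance,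
     [u]_delta = 2 int_0^delta ||D_h u||_p^p h^(p(1-s)-1) dh,
   with D_h u = (u o tau_h - u) / h, so both limits are decided by the behaviour
   of ||D_h u||_p as h tends to 0.
   If g = d_i u is in L^p, testing against bump functions gives
   u o tau_h - u = int_0^h g o tau_t dt almost everywhere; by Jensen's inequality
   and the continuity of translations in L^p, D_h u tends to g in L^p.
   If ||D_h u||_p does not tend to infinity, it is bounded along some sequence
   h -> 0, hence by subadditivity of h |-> ||u o tau_h - u||_p bounded for all
   h > 0. Its dyadic values then increase to a finite limit, and uniform
   convexity of L^p makes (D_(2^-n) u)_n a Cauchy sequence; its limit is the
   distributional derivative of u. *)

(** * Convexity inequalities for powers *)

Section powR_facts.
Variable R : realType.
Implicit Types p x y : R.

(** The constant splits into 2, from the evenness in h, and 1/(p(1-s)), from the integral of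
    h^(p(1-s)-1) over ]0, delta]. After normalization the energy is thus a weighted average of ||D_h
    u||_p^p over small h, which is why the behaviour of the norms decides both limits. The obstacle
    is the second half: a derivative must be built from norm bounds along a mere sequence. Weak
    compactness is replaced by the group law. A coarse quotient is a mean of translates of finer
    ones, and means do not increase the norm; hence the dyadic norms are monotone, and two fine
    quotients have means close to one and the same coarse quotient of nearly maximal norm. Uniform
    convexity then forces the two together, with strong convergence as a result. All of this needs
    only a jointly measurable, measure preserving action of R; even continuity of translations
    reduces to functions of one real variable along the orbits. Test functions appear only when
    quotients are compared with the distributional derivative, and products of one-dimensional bumps
    tending to indicators of boxes take the place of mollification. *)

Lemma normr_powR_continuous p : 0 < p -> continuous (fun x : R => `|x| `^ p).
Proof.
(* The derivative of [powR] is available at positive points only, so continuity at 0 is checked by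
   hand, with radius e^(1/p). *)
move=> p0 x; have [x0|x0] := eqVneq x 0.
  apply/cvgrPdist_lt => /= e e0; rewrite x0 normr0 powR0 ?gt_eqF//.
  near=> y.
  rewrite sub0r normrN ger0_norm ?powR_ge0//.
  have -> : e = (e `^ p^-1) `^ p by rewrite -powRrM mulVf ?gt_eqF// powRr1 ?ltW.
  apply: gt0_ltr_powR; rewrite ?nnegrE ?powR_ge0//.
  near: y; exists (e `^ p^-1); first by rewrite /= powR_gt0.
  by move=> z /=; rewrite sub0r normrN.
apply: (@continuous_comp _ _ _ (@Num.norm _ R) (@powR R ^~ p)).
  exact: norm_continuous.
apply/differentiable_continuous/derivable1_diffP/derivable_powR.
by rewrite in_itv/= andbT normr_gt0.
Unshelve. all: by end_near. Qed.

(** Mean value theorem on the two halves of [x, 1]: they have equal length and z^(p-1) is strictly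
    increasing, so the increment over the right half is larger. The case x = 0, where the derivative
    is not at hand, reduces to 2^(-p) < 1/2. *)
Lemma powR_midpoint_lt p x : 1 < p -> 0 <= x -> x < 1 ->
  ((1 + x) / 2) `^ p < (1 + x `^ p) / 2.
Proof.
move=> p1; rewrite le_eqVlt => /predU1P[<- _|x0 x1].
  rewrite addr0 powR0 ?gt_eqF ?(lt_trans _ p1)// addr0 !mul1r.
  have -> : 2^-1 `^ p = 2^-1 * 2^-1 `^ (p - 1) :> R.
    by rewrite mulr_powRB1 ?(lt_trans _ p1).
  rewrite gtr_pMr// -[ltRHS](_ : 1 `^ (p - 1) = 1); last by rewrite powR1.
  rewrite gt0_ltr_powR ?subr_gt0 ?nnegrE ?invf_lt1 ?ltr1n//.
set c := (1 + x) / 2.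
have xc : x < c by rewrite /c; lra.
have c1 : c < 1 by rewrite /c; lra.
have dpow a b : 0 < a -> a < b -> exists2 z, z \in `]a, b[%R &
    b `^ p - a `^ p = p * z `^ (p - 1) * (b - a).
  move=> a0 ab; apply: (@MVT _ (@powR R ^~ p) (fun z => p * z `^ (p - 1))) => //.
    move=> z; rewrite in_itv/= => /andP[az _].
    by apply: is_derive1_powR; exact: lt_trans az.
  apply: continuous_in_subspaceT => z; rewrite inE/= in_itv/= => /andP[az _].
  apply/differentiable_continuous/derivable1_diffP/derivable_powR.
  by rewrite in_itv/= andbT (lt_le_trans a0).
have [z1 /[!in_itv]/= /andP[z1x z1c] E1] := dpow _ _ x0 xc.
have [z2 /[!in_itv]/= /andP[z2c z21] E2] := dpow _ _ (lt_trans x0 xc) c1.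
have z12 : z1 `^ (p - 1) < z2 `^ (p - 1).
  apply: gt0_ltr_powR; rewrite ?subr_gt0 ?nnegrE//; last exact: lt_trans z2c.
    by rewrite ltW// (lt_trans x0).
  by rewrite ltW// (lt_trans _ z2c)// (lt_trans x0).
have : p * z1 `^ (p - 1) * (c - x) < p * z2 `^ (p - 1) * (1 - c).
  have -> : 1 - c = c - x by rewrite /c; lra.
  by rewrite ltr_pM2r ?subr_gt0// ltr_pM2l// (lt_trans _ p1).
rewrite -E1 -E2 powR1; lra.
Qed.

(** The range is that of the ratio b/a when |b| <= |a|, with the equality case x = 1 removed. A
    negative x is compared with |x|; x = -1 stands apart because there |x| is no longer below 1. *)
Lemma powR_norm_midpoint_lt p x : 1 < p -> -1 <= x -> x < 1 ->
  `|(1 + x) / 2| `^ p < (1 + `|x| `^ p) / 2.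
Proof.
move=> p1 x1 xlt1.
have p0 : 0 < p by rewrite (lt_trans _ p1).
have [x0|x0] := leP 0 x.
  rewrite !ger0_norm ?powR_midpoint_lt//.
  by rewrite divr_ge0// addr_ge0.
have [->|xN1] := eqVneq x (-1).
  by rewrite subrr mul0r normr0 powR0 ?gt_eqF// divr_gt0 ?ltr_pwDl ?powR_ge0.
apply: (@lt_le_trans _ _ (((1 + `|x|) / 2) `^ p)).
  rewrite gt0_ltr_powR// ?nnegrE ?divr_ge0 ?addr_ge0//.
  rewrite ger0_norm ?divr_ge0//; last lra.
  rewrite ltr0_norm//; lra.
apply/ltW/powR_midpoint_lt => //.
rewrite ltr0_norm//; suff : -1 < x by lra.
by rewrite lt_neqAle eq_sym xN1.
Qed.

(* Uniform convexity of L^p in pointwise form, so that it can be integrated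
   directly. *)
Lemma powR_uniform_convexity p (e : R) : 1 < p -> 0 < e ->
  exists2 C : R, 0 <= C & forall a b : R, `|a - b| `^ p <=
    e * (`|a| `^ p + `|b| `^ p) +
    C * ((`|a| `^ p + `|b| `^ p) / 2 - `|(a + b) / 2| `^ p).
Proof.
move=> p1 e0.
have p0 : 0 < p by rewrite (lt_trans _ p1).
(* By homogeneity, dividing by the larger of |a| and |b| leaves an inequality in a ratio t in
   [-1, 1]. There [th], the convexity defect, vanishes only at t = 1. *)
pose th (t : R) := (1 + `|t| `^ p) / 2 - `|(1 + t) / 2| `^ p.
have th_cont : continuous th.
  move=> t; apply: cvgB.
    apply: cvgM; last exact: cvg_cst.
    by apply: cvgD; [exact: cvg_cst|exact: normr_powR_continuous].
  apply: (@continuous_comp _ _ _ (fun t : R => (1 + t) / 2) (fun x => `|x| `^ p)).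
    apply: cvgM; last exact: cvg_cst.
    by apply: cvgD; [exact: cvg_cst|exact: cvg_id].
  exact: normr_powR_continuous.
have th_ge0 (t : R) : -1 <= t -> t <= 1 -> 0 <= th t.
  move=> t1; rewrite le_eqVlt => /predU1P[->|tlt1]; rewrite /th.
    by rewrite normr1 divff// normr1 powR1 divff ?subrr.
  by rewrite subr_ge0 ltW// powR_norm_midpoint_lt.
(* For t within [d] of 1, |1 - t|^p is at most e and the first term absorbs it. On the compact rest
   the defect has a positive minimum [th c], and |1 - t|^p <= 2^p gives the constant [C]. *)
pose d := Num.min (e `^ p^-1) 1.
have d0 : 0 < d by rewrite lt_min powR_gt0//=.
have d1 : d <= 1 by rewrite ge_min lexx orbT.
have de : d `^ p <= e.
  rewrite -[leRHS](_ : (e `^ p^-1) `^ p = e); last first.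
    by rewrite -powRrM mulVf ?gt_eqF// powRr1 ?ltW.
  rewrite ge0_ler_powR ?nnegrE ?powR_ge0 ?(ltW d0)//; first exact: ltW.
  by rewrite ge_min lexx.
have [] := @EVT_min _ th (-1) (1 - d).
- by lra.
- exact: continuous_subspaceT.
move=> c /[!in_itv]/= /andP[c1 cd] minc.
have thc : 0 < th c.
  rewrite subr_gt0 powR_norm_midpoint_lt//; lra.
pose C := 2 `^ p / th c.
have C0 : 0 <= C by rewrite divr_ge0 ?powR_ge0 ?ltW.
have main (t : R) : -1 <= t -> t <= 1 ->
    `|1 - t| `^ p <= e * (1 + `|t| `^ p) + C * th t.
  move=> t1 tle1; have [td|td] := leP t (1 - d).
    apply: (@le_trans _ _ (C * th t)); last first.
      by rewrite lerDr mulr_ge0 ?(ltW e0)// addr_ge0 ?powR_ge0.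
    apply: (@le_trans _ _ (2 `^ p)).
      rewrite ge0_ler_powR ?nnegrE//; first exact: ltW.
      rewrite ger0_norm; lra.
    rewrite /C mulrAC ler_pdivlMr// ler_wpM2l ?powR_ge0//; apply: minc.
    by rewrite in_itv/= t1.
  apply: (@le_trans _ _ e); last first.
    apply: (@le_trans _ _ (e * (1 + `|t| `^ p))); last first.
      by rewrite lerDl mulr_ge0// th_ge0.
    by rewrite ler_peMr ?(ltW e0)// lerDl powR_ge0.
  apply: le_trans de; rewrite ge0_ler_powR ?nnegrE ?(ltW d0)//; first exact: ltW.
  rewrite ger0_norm; lra.
have scaled (a b : R) : `|b| <= `|a| -> `|a - b| `^ p <=
    e * (`|a| `^ p + `|b| `^ p) +
    C * ((`|a| `^ p + `|b| `^ p) / 2 - `|(a + b) / 2| `^ p).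
  move=> ba; have [a0|a0] := eqVneq a 0.
    move: ba; rewrite a0 normr0 normr_le0 => /eqP ->.
    by rewrite subrr addr0 mul0r normr0 powR0 ?gt_eqF// addr0 mulr0 mul0r subrr mulr0 addr0.
  have a0' : 0 < `|a| by rewrite normr_gt0.
  have := main (b / a).
  have : `|b / a| <= 1 by rewrite normrM normfV ler_pdivrMr// mul1r.
  rewrite ler_norml => /andP[h1 h2] /(_ h1 h2).
  rewrite -(@ler_pM2l _ (`|a| `^ p)) ?powR_gt0//.
  have E (u : R) : `|a| `^ p * `|u| `^ p = `|a * u| `^ p.
    by rewrite normrM powRM.
  rewrite E mulrBr mulr1 mulrCA divff// mulr1 => /le_trans; apply.
  rewrite le_eqVlt; apply/orP; left; apply/eqP; rewrite /th.
  have -> : `|b| `^ p = `|a| `^ p * `|b / a| `^ p.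
    by rewrite E mulrCA divff// mulr1.
  have -> : `|(a + b) / 2| `^ p = `|a| `^ p * `|(1 + b / a) / 2| `^ p.
    rewrite E; congr (`|_| `^ p); field.
    by [].
  by ring.
exists C => // a b; have [ba|/ltW ab] := leP `|b| `|a|; first exact: scaled.
by rewrite distrC (addrC (`|a| `^ p)) (addrC a); exact: scaled.
Qed.

Lemma powR_normD_le p x y : 1 <= p ->
  `|x + y| `^ p <= 2 `^ p * (`|x| `^ p + `|y| `^ p).
Proof.
move=> p1; have p0 : 0 <= p by rewrite (le_trans _ p1).
apply: (@le_trans _ _ ((2 * Num.max `|x| `|y|) `^ p)).
  rewrite ge0_ler_powR ?nnegrE ?mulr_ge0 ?le_max ?normr_ge0//.
  apply: (le_trans (ler_normD _ _)); rewrite mulr2n mulrDl !mul1r.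
  by rewrite lerD// le_max lexx ?orbT.
rewrite powRM ?le_max ?normr_ge0//; apply: ler_wpM2l; first exact: powR_ge0.
by have [_|_] := leP `|x| `|y|; rewrite ?lerDl ?lerDr powR_ge0.
Qed.

(** An elementary way to integrability on sets of finite measure for functions in L^p: 1 is
    integrable there and the power is integrable everywhere. *)
Lemma norm_le1_powR p x : 1 <= p -> `|x| <= 1 + `|x| `^ p.
Proof.
move=> p1; have [x1|x1] := leP `|x| 1.
  by rewrite (le_trans x1)// lerDl powR_ge0.
by rewrite (@le_trans _ _ (`|x| `^ p)) ?le1r_powR ?(ltW x1)// lerDr.
Qed.

End powR_facts.

(** * The space L^p *)

Section Lp.
Context d (T : measurableType d) (R : realType).
Variables (mu : {measure set T -> \bar R}) (p : R).
Hypothesis p1 : 1 <= p.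
Implicit Types f g : T -> R.

Let p0 : 0 < p. Proof. exact: lt_le_trans p1. Qed.

Lemma measurable_normr_powR f (D : set T) : measurable_fun D f ->
  measurable_fun D (fun x => (`|f x| `^ p)%:E).
Proof.
move=> mf; apply/measurable_EFinP.
apply: (@measurableT_comp _ _ _ _ _ _ (@powR R ^~ p)) => //.
exact: measurableT_comp.
Qed.

Lemma LfunEP f : f \in Lfun mu p%:E <->
  measurable_fun [set: T] f /\ (\int[mu]_x (`|f x| `^ p)%:E < +oo)%E.
Proof.
have E : (\int[mu]_x (`|f x| `^ p)%:E = 'N[mu]_p%:E[EFin \o f] `^ p)%E.
  by rewrite poweR_Lnorm ?gt_eqF.
split=> [/andP[/[!inE]/= mf ff]|[mf ff]].
  by split=> //; rewrite E poweR_lty.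
apply/andP; rewrite !inE/=; split => //.
by apply: (@lty_poweRy _ _ p); rewrite ?gt_eqF// -E.
Qed.

Lemma Lfun_measurable f : f \in Lfun mu p%:E -> measurable_fun [set: T] f.
Proof. by case/LfunEP. Qed.

(** Real valued, for ordinary arithmetic. Since [fine] sends an infinite norm to 0, the value is
    meaningful only together with membership in [Lfun]. *)
Definition pnorm f : R := fine 'N[mu]_p%:E[EFin \o f].

Lemma pnorm_ge0 f : 0 <= pnorm f.
Proof. by rewrite fine_ge0// Lnorm_ge0. Qed.

Lemma pnormE f : f \in Lfun mu p%:E -> (pnorm f)%:E = 'N[mu]_p%:E[EFin \o f]%E.
Proof.
case/andP=> _; rewrite inE/= => ff.
by rewrite fineK// ge0_fin_numE// Lnorm_ge0.
Qed.

Lemma integral_pnorm f : f \in Lfun mu p%:E ->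
  (\int[mu]_x (`|f x| `^ p)%:E = (pnorm f `^ p)%:E)%E.
Proof.
by move=> fL; rewrite -poweR_EFin pnormE// poweR_Lnorm ?gt_eqF.
Qed.

Lemma Lfun_le_pnorm f (c : R) : measurable_fun [set: T] f -> 0 <= c ->
  (\int[mu]_x (`|f x| `^ p)%:E <= (c `^ p)%:E)%E ->
  f \in Lfun mu p%:E /\ pnorm f <= c.
Proof.
move=> mf c0 fc.
have fL : f \in Lfun mu p%:E.
  by apply/LfunEP; split=> //; rewrite (le_lt_trans fc)// ltry.
split=> //; move: fc; rewrite integral_pnorm// lee_fin.
by rewrite leNgt => h; rewrite leNgt; apply: contra h => h; rewrite gt0_ltr_powR// nnegrE ?pnorm_ge0.
Qed.

Lemma LfunZ f (c : R) : f \in Lfun mu p%:E -> (fun x => c * f x) \in Lfun mu p%:E.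
Proof.
case/LfunEP=> mf ff; apply/LfunEP; split; first exact: measurable_funM.
under eq_integral do rewrite normrM powRM// EFinM.
rewrite ge0_integralZl ?lee_fin ?powR_ge0//; last first.
  exact: measurable_normr_powR.
by rewrite lte_mul_pinfty// lee_fin powR_ge0.
Qed.

Lemma LfunD f g : f \in Lfun mu p%:E -> g \in Lfun mu p%:E ->
  (fun x => f x + g x) \in Lfun mu p%:E.
Proof. by apply: (Lfun_addr_closed _ _).2. Qed.

Lemma LfunN f : f \in Lfun mu p%:E -> (fun x => - f x) \in Lfun mu p%:E.
Proof.
move=> fL; rewrite (_ : (fun x => - f x) = (fun x => -1 * f x)); first exact: LfunZ.
by apply/funext => x; rewrite mulN1r.
Qed.

Lemma LfunB f g : f \in Lfun mu p%:E -> g \in Lfun mu p%:E ->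
  (fun x => f x - g x) \in Lfun mu p%:E.
Proof.
by move=> fL gL; apply: LfunD => //; exact: LfunN.
Qed.

Lemma pnormD f g : f \in Lfun mu p%:E -> g \in Lfun mu p%:E ->
  pnorm (fun x => f x + g x) <= pnorm f + pnorm g.
Proof.
move=> fL gL; rewrite -lee_fin EFinD !pnormE ?LfunD//.
apply: (@minkowski_EFin _ _ _ mu f g p) => //; exact: Lfun_measurable.
Qed.

Lemma pnormZ f (c : R) : f \in Lfun mu p%:E ->
  pnorm (fun x => c * f x) = `|c| * pnorm f.
Proof.
move=> fL; have p0' : p != 0 by rewrite gt_eqF.
apply: (powR_injective p0); rewrite ?nnegrE ?mulr_ge0 ?pnorm_ge0//.
apply/EFin_inj; rewrite -integral_pnorm ?LfunZ// powRM ?pnorm_ge0// EFinM.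
rewrite -integral_pnorm//.
under eq_integral do rewrite normrM powRM// EFinM.
rewrite ge0_integralZl ?lee_fin ?powR_ge0//.
by apply: measurable_normr_powR; exact: Lfun_measurable fL.
Qed.

Lemma pnorm_distC f g : pnorm (fun x => f x - g x) = pnorm (fun x => g x - f x).
Proof.
rewrite /pnorm -[in LHS]oppe_Lnorm; congr fine; apply: eq_Lnorm => x.
by congr EFin; rewrite /= opprB.
Qed.

Lemma pnorm_triangle f g h : f \in Lfun mu p%:E -> g \in Lfun mu p%:E ->
  h \in Lfun mu p%:E ->
  pnorm (fun x => f x - h x) <=
  pnorm (fun x => f x - g x) + pnorm (fun x => g x - h x).
Proof.
move=> fL gL hL; rewrite [leLHS](_ : _ =
    pnorm (fun x => (f x - g x) + (g x - h x))).
  by apply: pnormD; exact: LfunB.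
by congr pnorm; apply/funext => x; rewrite addrA subrK.
Qed.

Lemma pnorm_lerB f g : f \in Lfun mu p%:E -> g \in Lfun mu p%:E ->
  `|pnorm f - pnorm g| <= pnorm (fun x => f x - g x).
Proof.
move=> fL gL.
have main u v : u \in Lfun mu p%:E -> v \in Lfun mu p%:E ->
    pnorm u - pnorm v <= pnorm (fun x => u x - v x).
  move=> uL vL; rewrite lerBlDr [leLHS](_ : _ = pnorm (fun x => (u x - v x) + v x)).
    by apply: pnormD => //; exact: LfunB.
  by congr pnorm; apply/funext => x; rewrite subrK.
by rewrite ler_norml lerNl opprB main// andbT pnorm_distC main.
Qed.

(** Fatou's lemma for the p-th powers, applied from the index [N] at which the bound starts.
    Completeness needs both conclusions: membership of the limit and the estimate of its norm. *)
Lemma pnorm_fatou (f_ : nat -> T -> R) f (c : R) :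
  (forall n, f_ n \in Lfun mu p%:E) -> measurable_fun [set: T] f ->
  {ae mu, forall x, f_ n x @[n --> \oo] --> f x} ->
  0 <= c -> (\forall n \near \oo, pnorm (f_ n) <= c) ->
  f \in Lfun mu p%:E /\ pnorm f <= c.
Proof.
move=> fL mf f_f c0 [N _ fc]; apply: Lfun_le_pnorm => //.
pose h n x := (`|f_ (n + N)%N x| `^ p)%:E.
have mh n : measurable_fun [set: T] (h n).
  by apply: measurable_normr_powR; exact: Lfun_measurable.
have h0 n x : [set: T] x -> (0 <= h n x)%E by rewrite lee_fin powR_ge0.
have := fatou mu measurableT mh h0.
rewrite (_ : (\int[mu]_x _)%E = \int[mu]_x (`|f x| `^ p)%:E)%E; last first.
  apply: ae_eq_integral => //.
  - apply: measurableT_comp => //; apply: measurable_fun_limn_esup => n.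
    exact: measurableT_comp.
  - exact: measurable_normr_powR.
  - apply: filterS f_f => x f_fx _; apply: (cvg_limn_einf_sup _).1.
    apply/cvg_EFin; first exact: nearW.
    have f_fxN : f_ (n + N)%N x @[n --> \oo] --> f x.
      by rewrite (cvg_shiftn N (fun n => f_ n x)).
    exact: (@cvg_comp _ _ _ _ _ _ _ _ f_fxN (@normr_powR_continuous R p p0 (f x))).
move=> /le_trans; apply; rewrite limn_einf_lim.
apply: lime_le; first exact: is_cvg_einfs.
apply: nearW => n.
apply: (@le_trans _ _ (\int[mu]_x h n x)%E).
  by apply: ereal_inf_lbound; exists n => /=.
rewrite integral_pnorm// lee_fin ge0_ler_powR ?nnegrE ?pnorm_ge0 ?(ltW p0)//.
by apply: fc => /=; rewrite leq_addl.
Qed.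

Lemma pnorm_sum (I : Type) (r : seq I) (F : I -> T -> R) :
  (forall i, F i \in Lfun mu p%:E) ->
  (fun x => \sum_(i <- r) F i x) \in Lfun mu p%:E /\
  pnorm (fun x => \sum_(i <- r) F i x) <= \sum_(i <- r) pnorm (F i).
Proof.
move=> FL; elim: r => [|i r [IH1 IH2]].
  have c0 : (fun=> 0 : R) \in Lfun mu p%:E.
    apply/LfunEP; split => //.
    under eq_integral do rewrite normr0 powR0 ?gt_eqF//.
    by rewrite integral0.
  rewrite big_nil.
  rewrite (_ : (fun _ => _) = fun=> 0); last by apply/funext => x; rewrite big_nil.
  by split=> //; have := pnormZ 0 c0; rewrite normr0 !mul0r => ->.
rewrite (_ : (fun _ => _) = fun x => F i x + \sum_(i <- r) F i x); last first.
  by apply/funext => x; rewrite big_cons.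
split; first exact: LfunD.
by rewrite big_cons (le_trans (pnormD _ _))// lerD2l.
Qed.

Lemma Lfun_norm_pnorm f : f \in Lfun mu p%:E ->
  (fun x => `|f x|) \in Lfun mu p%:E /\ pnorm (fun x => `|f x|) = pnorm f.
Proof.
move=> fL; have E : ('N[mu]_p%:E[EFin \o (fun x => `|f x|%R)] = 'N[mu]_p%:E[EFin \o f])%E.
  rewrite -[RHS]Lnorm_abse; exact: eq_Lnorm.
split; last by rewrite /pnorm E.
apply/LfunEP; split.
  by apply: measurableT_comp => //; exact: Lfun_measurable.
by under eq_integral do rewrite normr_id; case/LfunEP : fL.
Qed.

(** Integrating the pointwise inequality bounds the p-th power of ||f - g|| by a small multiple of
    K^p plus C (K^p - ||(f+g)/2||^p). The last difference is small by continuity of the power at K,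
    which is where [c] comes from. *)
Lemma pnorm_uniform_convexity (K e : R) : 1 < p -> 0 <= K -> 0 < e ->
  exists2 c, 0 < c & forall f g, f \in Lfun mu p%:E -> g \in Lfun mu p%:E ->
    pnorm f <= K -> pnorm g <= K ->
    2 * (K - c) <= pnorm (fun x => f x + g x) ->
    pnorm (fun x => f x - g x) <= e.
Proof.
move=> p1' K0 e0.
have Kp0 : 0 < 1 + K `^ p by rewrite ltr_pwDl// powR_ge0.
(* Half of e^p is reserved for each term: the first is at most 2 e1 K^p <= e^p / 2, the second C
   (K^p - y^p) <= e^p / 2. The summands 1 in the denominators only keep them positive. *)
pose e1 := e `^ p / 4 / (1 + K `^ p).
have e10 : 0 < e1 by rewrite !divr_gt0// powR_gt0.
have [C C0 HC] := powR_uniform_convexity p1' e10.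
have e20 : 0 < e `^ p / 2 / (1 + C) by rewrite !divr_gt0 ?powR_gt0// ltr_pwDl.
have /cvgrPdist_le /(_ _ e20) := @normr_powR_continuous R p p0 K.
move=> /nbhs_ballP[c /= c0 cP]; exists (c / 2); first exact: divr_gt0.
move=> f g fL gL fK gK fgK.
pose y := pnorm (fun x => 2^-1 * (f x + g x)).
have yE : y = 2^-1 * pnorm (fun x => f x + g x).
  by rewrite /y pnormZ ?LfunD// ger0_norm.
have y0 : 0 <= y by exact: pnorm_ge0.
have yK : y <= K by rewrite yE; have := pnormD fL gL; lra.
have yc : K - c / 2 <= y by rewrite yE; lra.
have : K `^ p - y `^ p <= e `^ p / 2 / (1 + C).
  have := cP y; rewrite /ball/= ger0_norm ?subr_ge0// => /(_ _).
  rewrite !ger0_norm//; last by rewrite subr_ge0 ge0_ler_powR ?nnegrE ?(ltW p0).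
  apply; lra.
rewrite ler_pdivlMr ?ltr_pwDl// => Ky.
apply: (Lfun_le_pnorm (measurable_funB (Lfun_measurable fL) (Lfun_measurable gL))
  (ltW e0) _).2.
have fgL : (fun x => 2^-1 * (f x + g x)) \in Lfun mu p%:E.
  by apply: LfunZ; exact: LfunD.
have pw (u : R) : 0 <= u -> u <= K -> u `^ p <= K `^ p.
  by move=> u0 uK; rewrite ge0_ler_powR ?nnegrE ?(ltW p0).
have e1C0 : 0 <= e1 + C / 2 by rewrite addr_ge0 ?(ltW e10)// divr_ge0.
(* The negative term of the pointwise inequality is moved to the left, so that every integrand is
   nonnegative and the integrals add without integrability conditions. *)
have main : (\int[mu]_x (`|f x - g x| `^ p)%:E + \int[mu]_x (C * `|2^-1 * (f x + g x)| `^ p)%:E <=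
  \int[mu]_x ((e1 + C / 2) * `|f x| `^ p + (e1 + C / 2) * `|g x| `^ p)%:E)%E.
  rewrite -ge0_integralD//; last 3 first.
  - by apply/measurable_normr_powR/measurable_funB; exact: Lfun_measurable.
  - by move=> x _; rewrite lee_fin mulr_ge0// powR_ge0.
  - under eq_fun do rewrite EFinM.
    by apply: measurable_funeM; exact/measurable_normr_powR/Lfun_measurable.
  apply: ge0_le_integral => //.
  - by move=> x _; rewrite lee_fin addr_ge0 ?mulr_ge0// powR_ge0.
  - apply: emeasurable_funD.
      by apply/measurable_normr_powR/measurable_funB; exact: Lfun_measurable.
    under eq_fun do rewrite EFinM.
    by apply: measurable_funeM; exact/measurable_normr_powR/Lfun_measurable.
  - apply/measurable_EFinP; apply: measurable_funD; apply: measurable_funM => //;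
    exact/measurable_EFinP/measurable_normr_powR/Lfun_measurable.
  - move=> x _; rewrite -EFinD lee_fin.
    have := HC (f x) (g x); rewrite [(f x + g x) / 2]mulrC; lra.
move: main; under [X in (_ + X <= _)%E]eq_integral do rewrite EFinM.
under [X in (_ <= X)%E]eq_integral do rewrite EFinD !EFinM.
rewrite ge0_integralD//; last 4 first.
- by move=> x _; rewrite -EFinM lee_fin mulr_ge0 ?powR_ge0.
- by apply: measurable_funeM; exact/measurable_normr_powR/Lfun_measurable.
- by move=> x _; rewrite -EFinM lee_fin mulr_ge0 ?powR_ge0.
- by apply: measurable_funeM; exact/measurable_normr_powR/Lfun_measurable.
rewrite !ge0_integralZl//; last first.
all: try by move=> x _; rewrite lee_fin powR_ge0.
all: try by rewrite lee_fin.
all: try exact/measurable_normr_powR/Lfun_measurable.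
rewrite !integral_pnorm ?LfunB// -!EFinM -!EFinD !lee_fin -/y => main.
have := pw _ (pnorm_ge0 f) fK; have := pw _ (pnorm_ge0 g) gK => gp fp.
have e1K : e1 * (1 + K `^ p) = e `^ p / 4 by rewrite /e1 divfK// gt_eqF.
have h1 : e1 * (pnorm f `^ p) <= e1 * K `^ p by rewrite ler_wpM2l// ltW.
have h2 : e1 * (pnorm g `^ p) <= e1 * K `^ p by rewrite ler_wpM2l// ltW.
have h3 : C * (pnorm f `^ p) <= C * K `^ p by rewrite ler_wpM2l.
have h4 : C * (pnorm g `^ p) <= C * K `^ p by rewrite ler_wpM2l.
have h5 : y `^ p <= K `^ p by rewrite pw.
lra.
Qed.

(** Riesz-Fischer. Along a subsequence with consecutive distances at most 2^-k, the sums of |g (k+1)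
    - g k| increase and have norm at most 2; hence they are finite almost everywhere, and the
    subsequence converges there. *)
Lemma Lfun_complete (f_ : nat -> T -> R) :
  (forall n, f_ n \in Lfun mu p%:E) ->
  (forall e, 0 < e -> exists N, forall m n, (N <= m)%N -> (N <= n)%N ->
    pnorm (fun x => f_ m x - f_ n x) <= e) ->
  exists2 f, f \in Lfun mu p%:E &
    pnorm (fun x => f_ n x - f x) @[n --> \oo] --> 0.
Proof.
move=> fL fC.
have /choice[N_ NP] : forall k, exists N, forall m n, (N <= m)%N -> (N <= n)%N ->
    pnorm (fun x => f_ m x - f_ n x) <= 2^-1 ^+ k.
  by move=> k; apply: fC; rewrite exprn_gt0.
(* Summing the thresholds makes [phi j] exceed every [N_ k] with k <= j, although [N_] itself need
   not be monotone. *)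
pose phi k := (\sum_(i < k.+1) N_ i)%N.
have phiN k j : (k <= j)%N -> (N_ k <= phi j)%N.
  move=> kj; rewrite /phi (bigD1 (inord k))//= inordK// leq_addr//.
pose g k := f_ (phi k).
have gL k : g k \in Lfun mu p%:E by exact: fL.
pose S n x : R := \sum_(0 <= k < n) `|g k.+1 x - g k x|.
have SL n : S n \in Lfun mu p%:E /\ pnorm (S n) <= 2.
  have FL k : (fun x => `|g k.+1 x - g k x|) \in Lfun mu p%:E.
    by apply: (@Lfun_norm_pnorm (fun x => g k.+1 x - g k x) _).1; apply: LfunB; exact: fL.
  have [SnL Sn] := pnorm_sum (index_iota 0 n) FL; split => //.
  apply: (le_trans Sn).
  apply: (@le_trans _ _ (\sum_(0 <= k < n) 2^-1 ^+ k)).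
    apply: ler_sum => k _; rewrite (Lfun_norm_pnorm _).2; last by apply: LfunB; exact: fL.
    by apply: NP; exact: phiN.
  have := @geometric_le_lim R n 1 2^-1; rewrite seriesEnat/=.
  under eq_bigr do rewrite mul1r.
  move=> /(_ ler01); rewrite mul1r (_ : 1 - 2^-1 = 2^-1) ?invrK; last by field.
  by apply => //; rewrite ger0_norm// invf_lt1// ltr1n.
pose h n x := (`|S n x| `^ p)%:E.
have S0 n x : 0 <= S n x by exact: sumr_ge0.
have Snd x : nondecreasing_seq (S ^~ x).
  apply/nondecreasing_seqP => n.
  by rewrite /S big_nat_recr//= lerDl.
have hnd x : [set: T] x -> nondecreasing_seq (h ^~ x).
  move=> _ m n mn; rewrite lee_fin ge0_ler_powR ?nnegrE ?(ltW p0)//.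
  by rewrite !ger0_norm// Snd.
have mh n : measurable_fun [set: T] (h n).
  by apply: measurable_normr_powR; exact: Lfun_measurable (SL n).1.
have h0 n x : [set: T] x -> (0 <= h n x)%E by rewrite lee_fin powR_ge0.
have hlim : mu.-integrable [set: T] (fun x => limn (h ^~ x)).
  apply/integrableP; split.
    have -> : (fun x => limn (h ^~ x)) = (fun x => limn_esup (h ^~ x)).
      apply/funext => x; rewrite is_cvg_limn_esupE//.
      by apply/cvg_ex; eexists; exact/ereal_nondecreasing_cvgn/hnd.
    exact: measurable_fun_limn_esup.
  under eq_integral => x _.
    rewrite gee0_abs; last first.
      apply: lime_ge; last by apply: nearW => n; exact: h0.
      by apply/cvg_ex; eexists; exact/ereal_nondecreasing_cvgn/hnd.
    over.
  rewrite monotone_convergence//.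
  apply: (@le_lt_trans _ _ (2 `^ p)%:E); last exact: ltry.
  apply: lime_le.
    apply/cvg_ex; eexists; apply: ereal_nondecreasing_cvgn => m n mn.
    by apply: ge0_le_integral => // x _; [exact: h0|exact: hnd].
  apply: nearW => n; rewrite integral_pnorm; last exact: (SL n).1.
  rewrite lee_fin ge0_ler_powR ?nnegrE ?pnorm_ge0 ?(ltW p0)//.
  exact: (SL n).2.
(* The upper limit makes sense at every point, so [f] is measurable even though the subsequence
   converges only almost everywhere. *)
pose f x := fine (limn_esup (fun k => (g k x)%:E)).
have mf : measurable_fun [set: T] f.
  apply: (@measurableT_comp _ _ _ _ _ _ fine) => //.
  apply: measurable_fun_limn_esup => n; apply/measurable_EFinP.
  exact: Lfun_measurable (gL n).
have g_f : {ae mu, forall x, g k x @[k --> \oo] --> f x}.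
  have := integrable_ae measurableT hlim; apply: filterS => x /(_ I) hx.
  have cS : cvgn (S ^~ x).
    apply: nondecreasing_is_cvgn; first exact: Snd.
    exists (1 + fine (limn (h ^~ x))) => _ [n _ <-].
    rewrite (le_trans (ler_norm _))// (le_trans (norm_le1_powR _ p1))// lerD2l.
    rewrite -lee_fin fineK//.
    have := @ereal_nondecreasing_cvgn _ _ (hnd x I) => /cvg_lim ->//.
    by apply: ereal_sup_ubound; exists n.
  have cg : cvgn (g ^~ x).
    have E : g ^~ x = fun n => g 0%N x + series (fun k => g k.+1 x - g k x) n.
      apply/funext => n; rewrite seriesEnat/= telescope_sumr//.
      by rewrite addrC subrK.
    rewrite E; apply: is_cvgD; first exact: is_cvg_cst.
    exact: normed_cvg cS.
  have [l gl] := (cvg_ex _).1 cg.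
  suff -> : f x = l by [].
  have gle : (g k x)%:E @[k --> \oo] --> (l : R)%:E.
    by apply/cvg_EFin; [exact: nearW|exact: gl].
  by rewrite /f (cvg_limn_einf_sup gle).2.
(* With n fixed, Fatou in the index of the subsequence carries the Cauchy estimate over to the
   limit. *)
have fn k n : (N_ k <= n)%N -> (fun x => f_ n x - f x) \in Lfun mu p%:E /\
    pnorm (fun x => f_ n x - f x) <= 2^-1 ^+ k.
  move=> kn; apply: (@pnorm_fatou (fun j x => f_ n x - g j x)).
  - by move=> j; exact: LfunB.
  - by apply: measurable_funB => //; exact: Lfun_measurable.
  - by apply: filterS g_f => x gx; apply: cvgB => //; exact: cvg_cst.
  - by rewrite exprn_ge0.
  - by exists k => // j /= kj; apply: NP => //; exact: phiN.
have fLp : f \in Lfun mu p%:E.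
  rewrite (_ : f = fun x => f_ (N_ 0%N) x - (f_ (N_ 0%N) x - f x)).
    by apply: LfunB => //; apply: (fn 0%N _ _).1.
  by apply/funext => x; rewrite opprB addrC subrK.
exists f => //; apply/cvgrPdist_le => /= e e0.
have : 2^-1 ^+ n @[n --> \oo] --> (0 : R).
  by apply: cvg_expr; rewrite ger0_norm// invf_lt1// ltr1n.
move=> /cvgrPdist_le /(_ _ e0) [k _ kP].
exists (N_ k) => // n /= kn; rewrite sub0r normrN ger0_norm ?pnorm_ge0//.
apply: (le_trans (fn _ _ kn).2); have := kP k (leqnn _).
by rewrite sub0r normrN ger0_norm ?exprn_ge0.
Qed.

End Lp.

(** * Measure preserving maps and flows *)

Section measure_preserving_integrals.
Local Open Scope ereal_scope.

Lemma ge0_integral_invariant d (T : measurableType d) (R : realType)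
    (mu : {measure set T -> \bar R}) (phi : T -> T) (f : T -> \bar R) :
  measurable_fun [set: T] phi ->
  (forall A, measurable A -> mu (phi @^-1` A) = mu A) ->
  measurable_fun [set: T] f -> (forall x, 0 <= f x) ->
  \int[mu]_x f (phi x) = \int[mu]_x f x.
Proof.
move=> mphi muphi mf f0.
rewrite -[LHS](@ge0_integral_pushforward _ _ _ _ _ phi mphi mu setT f)//.
by apply: eq_measure_integral => A mA _; exact: muphi.
Qed.

Lemma integral_invariant d (T : measurableType d) (R : realType)
    (mu : {measure set T -> \bar R}) (phi : T -> T) (f : T -> \bar R) :
  measurable_fun [set: T] phi ->
  (forall A, measurable A -> mu (phi @^-1` A) = mu A) ->
  mu.-integrable [set: T] f ->
  mu.-integrable [set: T] (f \o phi) /\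
  \int[mu]_x f (phi x) = \int[mu]_x f x.
Proof.
move=> mphi muphi intf.
have mf : measurable_fun [set: T] f by case/integrableP : intf.
have intfphi : mu.-integrable [set: T] (f \o phi).
  apply/integrableP; split; first exact: measurableT_comp.
  rewrite (@ge0_integral_invariant _ _ _ _ phi (fun x => `|f x|))//.
    by case/integrableP : intf.
  exact: measurableT_comp.
split => //; rewrite -[LHS](@integral_pushforward _ _ _ _ _ phi mphi mu setT f)//.
by apply: eq_measure_integral => A mA _; exact: muphi.
Qed.

Section fubini_restrict.
Context d1 d2 (T1 : measurableType d1) (T2 : measurableType d2) (R : realType).
Variables (m1 : {sigma_finite_measure set T1 -> \bar R}).
Variables (m2 : {sigma_finite_measure set T2 -> \bar R}).
Variables (D : set T2) (mD : measurable D) (f : T1 * T2 -> \bar R).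
Hypotheses (mf : measurable_fun [set: T1 * T2] f) (f0 : forall z, 0 <= f z).

Let f' := f \_ (snd @^-1` D).

Let mf' : measurable_fun [set: T1 * T2] f'.
Proof.
apply/(measurable_restrictT f).
  by rewrite -[X in measurable X]setTI; exact: measurable_snd.
exact: measurable_funTS.
Qed.

Let f'0 z : 0 <= f' z. Proof. by rewrite /f' /patch; case: ifP. Qed.

Let f'E x : (fun y => f (x, y)) \_ D = fun y => f' (x, y).
Proof.
apply/funext => y; rewrite /f' /patch; congr (if _ then _ else _).
Qed.

Lemma ge0_fubini_restrict :
  \int[m1]_x \int[m2]_(y in D) f (x, y) = \int[m2]_(y in D) \int[m1]_x f (x, y).
Proof.
under eq_integral do rewrite integral_mkcond f'E.
rewrite (fubini_tonelli f')// [RHS]integral_mkcond.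
apply: eq_integral => y _; rewrite /patch; case: ifPn => yD.
  by apply: eq_integral => x _; rewrite /f' /patch ifT// inE/=; rewrite inE in yD.
under eq_integral => x _.
  rewrite /f' /patch ifF; last first.
    by apply/negbTE; rewrite notin_setE/=; rewrite notin_setE in yD.
  over.
by rewrite integral0.
Qed.

Lemma measurable_ge0_fubini_restrict :
  measurable_fun [set: T1] (fun x => \int[m2]_(y in D) f (x, y)).
Proof.
under eq_fun do rewrite integral_mkcond f'E.
exact: measurable_fun_fubini_tonelli_F.
Qed.

End fubini_restrict.

Lemma cvge0P (R : realType) (u : nat -> \bar R) : (forall n, 0 <= u n) ->
  (forall e, (0 < e)%R -> \forall n \near \oo, u n <= e%:E) ->
  u @ \oo --> 0.
Proof.
move=> u0 ue; apply/fine_cvgP; split.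
  have := ue 1%R ltr01; apply: filterS => n un.
  by rewrite ge0_fin_numE// (le_lt_trans un)// ltry.
apply/cvgrPdist_le => /= e e0; have := ue e e0; apply: filterS => n un.
rewrite sub0r normrN ger0_norm ?fine_ge0// -lee_fin fineK//.
by rewrite ge0_fin_numE// (le_lt_trans un)// ltry.
Qed.

Lemma cvge0_near_le (R : realType) (I : Type) (F : set_system I) (FF : Filter F)
    (u : I -> \bar R) (e : R) : u @ F --> 0 -> (0 < e)%R ->
  \forall n \near F, u n <= e%:E.
Proof.
move=> /fine_cvgP[ufin /cvgrPdist_le /= uc] e0.
apply: filterS2 ufin (uc e e0) => n un.
rewrite sub0r normrN => ue; rewrite -(fineK un) lee_fin.
exact: le_trans (ler_norm _) ue.
Qed.

(** * Continuity of translations on the real line *)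

Section translation.
Context {R : realType}.
Local Notation leb := (@lebesgue_measure R).

(** The image of Lebesgue measure under the translation gives half-open intervals their length, and
    this determines Lebesgue measure. *)
Lemma lebesgue_measure_shift (a : R) (A : set R) : measurable A ->
  leb ((fun x => (x + a)%R) @^-1` A) = leb A.
Proof.
move=> mA.
have mphi : measurable_fun [set: measurableTypeR R]
    (fun x : measurableTypeR R => (x + a)%R : measurableTypeR R).
  exact: measurable_funD.
pose m : {measure set (measurableTypeR R) -> \bar R} :=
  measure_function_pushforward__canonical__measure_function_Measure leb mphi.
apply/esym/(@lebesgue_measure_unique R m) => // _ [[b c]] _ <-.
rewrite /= /pushforward.
rewrite (_ : (fun x => (x + a)%R) @^-1` _ = [set` `](b - a)%R, (c - a)%R]]); last first.
  by apply/seteqP; split => x /=; rewrite !in_itv/= ltrBlDr lerBrDr.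
rewrite !lebesgue_measure_itv/= !lte_fin ltrD2r.
by case: ifP => // _; rewrite -!EFinB opprD opprK addrACA addNr addr0.
Qed.

Lemma ge0_integral_shift (a : R) (f : R -> \bar R) :
  measurable_fun [set: R] f -> (forall t, 0 <= f t) ->
  \int[leb]_t f (t + a)%R = \int[leb]_t f t.
Proof.
move=> mf f0.
apply: (@ge0_integral_invariant _ _ _ leb (fun t => (t + a)%R) f) => //.
  exact: measurable_funD.
exact: lebesgue_measure_shift.
Qed.

(** To be applied to v t = f (tau t x), one orbit at a time. The proof approximates v in L^1 by a
    continuous function, for which dominated convergence applies. *)
Lemma cvg_translation_bounded (v : R -> R) (M p : R) (h : R^nat) :
  measurable_fun [set: R] v -> (1 <= p)%R -> (forall t, `|v t| <= M)%R ->
  (forall n, `|h n| <= 1)%R -> h @ \oo --> (0 : R)%R ->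
  \int[leb]_(t in `[0%R, 1%R]) (`|v (t + h n) - v t| `^ p)%:E @[n --> \oo] --> 0.
Proof.
move=> mv p1 vM h1 hcvg.
have M0 : (0 <= M)%R by rewrite (le_trans _ (vM 0%R)).
have p0 : (0 < p)%R by rewrite (lt_le_trans _ p1).
have mshift d' (Y : measurableType d') (w : R -> Y) a : measurable_fun [set: R] w ->
    measurable_fun [set: R] (fun t => w (t + a)%R).
  move=> mw; apply: (measurableT_comp mw); exact: measurable_funD.
have mI (a b : R) : measurable (`[a, b] : set R) by [].
suff L1 : \int[leb]_(t in `[0%R, 1%R]) `|v (t + h n) - v t|%:E @[n --> \oo] --> 0.
  (* Boundedness trades the exponent p for 1: of the p factors of the increment, p - 1 are bounded
     by 2M. *)
  pose K := ((2 * M) `^ (p - 1))%R.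
  apply: (@squeeze_cvge _ _ _ _ (cst 0) _
    (fun n => K%:E * \int[leb]_(t in `[0%R, 1%R]) `|v (t + h n) - v t|%:E)).
  - apply: nearW => n; rewrite integral_ge0//=.
    rewrite -ge0_integralZl ?lee_fin ?powR_ge0//; last first.
      apply/measurable_EFinP; apply: measurableT_comp => //.
      by apply: measurable_funTS; apply: measurable_funB => //; exact: mshift.
    apply: ge0_le_integral => //.
    + apply: measurable_normr_powR; apply: measurable_funTS.
      by apply: measurable_funB => //; exact: mshift.
    + apply: measurable_funeM; apply/measurable_EFinP; apply: measurableT_comp => //.
      by apply: measurable_funTS; apply: measurable_funB => //; exact: mshift.
    + move=> t _; rewrite -EFinM lee_fin -(mulr_powRB1 (normr_ge0 _) p0) mulrC.
      rewrite ler_wpM2r// ge0_ler_powR ?nnegrE ?subr_ge0 ?mulr_ge0//.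
      by rewrite (le_trans (ler_normB _ _))// mulr_natl mulr2n lerD.
  - exact: cvg_cst.
  - by rewrite -[X in _ --> X](mule0 K%:E); apply: cvgeZl.
apply: cvge0P => [n|e e0]; first exact: integral_ge0.
(* The window [-1, 2] contains every t + h n with t in [0, 1], because |h n| <= 1. *)
have intv : leb.-integrable `[(-1)%R, 2%R] (EFin \o v).
  apply: measurable_bounded_integrable => //.
  - by rewrite /= lebesgue_measure_itv/= lte_fin ifT ?ltry//; lra.
  - exact: measurable_funTS.
  - exists M; split; first exact: num_real.
    by move=> x Mx t _ /=; rewrite (le_trans (vM t))// ltW.
have [|g_ [cg _ g_v]] := approximation_continuous_integrable (mI _ _) _ intv.
  by rewrite /= lebesgue_measure_itv/= lte_fin ifT ?ltry//; lra.
have e3 : (0 < e / 3)%R by rewrite divr_gt0.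
have [g cgg gv] : exists2 g : R -> R, continuous g &
    \int[leb]_(t in `[(-1)%R, 2%R]) `|v t - g t|%:E <= (e / 3)%:E.
  have : \forall n \near \oo,
      \int[leb]_(t in `[(-1)%R, 2%R]) `|v t - g_ n t|%:E <= (e / 3)%:E.
    exact: cvge0_near_le g_v e3.
  by move=> [n _ /(_ _ (leqnn n)) nP]; exists (g_ n); [exact: cg|exact: nP].
have mg : measurable_fun [set: R] g by exact: continuous_measurable_fun.
pose w t : R := `|v t - g t|%R.
have mw : measurable_fun [set: R] w.
  by apply: measurableT_comp => //; exact: measurable_funB.
have w0 t : (0 <= w t)%R by exact: normr_ge0.
have wshift n : \int[leb]_(t in `[0%R, 1%R]) (w (t + h n))%:E <= (e / 3)%:E.
  apply: le_trans gv.
  rewrite integral_mkcond [leRHS]integral_mkcond.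
  have mpatchw (k : R -> R) a b : measurable_fun [set: R] k ->
      measurable_fun [set: R] ((fun t : R => (k t)%:E) \_ `[a, b]).
    move=> mk; apply/(measurable_restrictT (fun t => (k t)%:E) (mI a b)).
    by apply/measurable_EFinP; exact: measurable_funTS.
  have mpatch a b := mpatchw w a b mw.
  have mpatch1 := mpatchw (fun t => w (t + h n)%R) 0%R 1%R (mshift _ _ _ _ mw).
  have wp0 a b t : 0 <= ((fun t => (w t)%:E) \_ `[a, b]) t.
    by rewrite /patch; case: ifP => // _; rewrite lee_fin.
  rewrite -(ge0_integral_shift (h n) (mpatch (-1)%R 2%R) (wp0 _ _)).
  apply: ge0_le_integral => //.
  - by move=> t _; rewrite /patch; case: ifP => // _; rewrite lee_fin.
  - exact: mshift (mpatch (-1)%R 2%R).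
  - move=> t _; rewrite /patch; case: ifPn => [|_]; last first.
      by case: ifP => // _; rewrite lee_fin.
    rewrite inE/= in_itv/= => /andP[t0 t1].
    have := h1 n; rewrite ler_norml => /andP[h1a h1b].
    by rewrite ifT// inE/= in_itv/=; apply/andP; split; lra.
have w01 : \int[leb]_(t in `[0%R, 1%R]) (w t)%:E <= (e / 3)%:E.
  apply: le_trans gv; apply: ge0_subset_integral => //.
    by apply/measurable_EFinP; exact: measurable_funTS.
    by move=> t _; rewrite lee_fin.
  by move=> t /=; rewrite !in_itv/= => /andP[? ?]; apply/andP; split; lra.
have gcvg : \int[leb]_(t in `[0%R, 1%R]) `|g (t + h n) - g t|%:E @[n --> \oo] --> 0.
  have [||c _ cmax] := @EVT_max R (fun t => `|g t|%R) (-1)%R 2%R.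
  - by lra.
  - apply: continuous_subspaceT => t; apply: continuous_comp; first exact: cgg.
    exact: norm_continuous.
  pose B := `|g c|%R.
  have gB1 t : (-1 <= t <= 2)%R -> (`|g t| <= `|B| + 1)%R.
    move=> t12; rewrite normr_id (@le_trans _ _ B) ?lerDl//.
    by apply: cmax; rewrite in_itv.
  have := @dominated_cvg _ _ _ leb `[0%R, 1%R] _
    (fun n t => `|g (t + h n) - g t|%:E) (cst 0) (cst (2 * (`|B| + 1))%:E).
  rewrite integral0; apply => //.
  - move=> n; apply/measurable_EFinP; apply: measurableT_comp => //.
    by apply: measurable_funTS; apply: measurable_funB => //; exact: mshift.
  - move=> t _; apply/cvg_EFin; first exact: nearW.
    apply: (@cvg_trans _ (`|g (t + h n) - g t|%R @[n --> \oo])) => //.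
    rewrite -(normr0 R) -(subrr (g t)); apply: cvg_norm; apply: cvgB; last exact: cvg_cst.
    rewrite -{2}(addr0 t).
    apply: (@cvg_comp _ _ _ (fun n => t + h n)%R g _ _ _ _ (cgg (t + 0)%R)).
    by apply: cvgD => //; exact: cvg_cst.
  - apply: measurable_bounded_integrable => //.
      by rewrite /= lebesgue_measure_itv/= lte_fin ltr01 ltry.
    exists (2 * (`|B| + 1))%R; split; first exact: num_real.
    by move=> x Bx t _; rewrite /= ger0_norm ?mulr_ge0// ltW.
  - move=> n t /=; rewrite in_itv/= => /andP[t0 t1].
    have := h1 n; rewrite ler_norml => /andP[h1a h1b].
    rewrite lee_fin normr_id (le_trans (ler_normB _ _))// mulr_natl mulr2n.
    by rewrite lerD// gB1//; apply/andP; split; lra.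
have : \forall n \near \oo,
    \int[leb]_(t in `[0%R, 1%R]) `|g (t + h n) - g t|%:E <= (e / 3)%:E.
  exact: cvge0_near_le gcvg e3.
apply: filterS => n gn.
apply: (@le_trans _ _ (\int[leb]_(t in `[0%R, 1%R])
    ((w (t + h n))%:E + (`|g (t + h n) - g t|%:E + (w t)%:E)))).
  apply: ge0_le_integral => //.
  - apply/measurable_EFinP; apply: measurableT_comp => //.
    by apply: measurable_funTS; apply: measurable_funB => //; exact: mshift.
  - apply: measurable_funTS; apply/measurable_EFinP; apply: measurable_funD.
      exact: mshift.
    apply: measurable_funD => //; apply: measurableT_comp => //.
    by apply: measurable_funB => //; exact: mshift.
  - move=> t _; rewrite -!EFinD lee_fin /w.
    rewrite (_ : v (t + h n) - v t = (v (t + h n) - g (t + h n)) +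
      ((g (t + h n) - g t) - (v t - g t)))%R; last by ring.
    by rewrite (le_trans (ler_normD _ _))// lerD// ler_normB.
rewrite ge0_integralD//; last 4 first.
- by move=> t _; rewrite lee_fin.
- by apply/measurable_EFinP; apply: measurable_funTS; exact: mshift.
- by move=> t _; rewrite -EFinD lee_fin addr_ge0.
- apply: measurable_funTS; apply/measurable_EFinP; apply: measurable_funD => //.
  apply: measurableT_comp => //.
  by apply: measurable_funB => //; exact: mshift.
rewrite ge0_integralD//; last 3 first.
- apply: measurable_funTS; apply/measurable_EFinP; apply: measurableT_comp => //.
  by apply: measurable_funB => //; exact: mshift.
- by move=> t _; rewrite lee_fin.
- by apply/measurable_EFinP; apply: measurable_funTS.
rewrite (_ : e%:E = (e / 3)%:E + ((e / 3)%:E + (e / 3)%:E)).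
  by apply: leeD => //; apply: leeD.
by rewrite -!EFinD; congr EFin; field.
Qed.

End translation.

End measure_preserving_integrals.

Lemma powR_cvg0_inv (R : realType) (I : Type) (F : set_system I) (FF : Filter F)
    (a : I -> R) (p : R) : 0 < p -> (forall n, 0 <= a n) ->
  a n `^ p @[n --> F] --> 0 -> a n @[n --> F] --> 0.
Proof.
move=> p0 a0 ac.
have -> : a = fun n => `|a n `^ p| `^ p^-1.
  apply/funext => n; rewrite ger0_norm ?powR_ge0// -powRrM mulfV ?gt_eqF//.
  by rewrite powRr1.
have -> : 0 = `|0 : R| `^ p^-1 by rewrite normr0 powR0// invr_eq0 gt_eqF.
have pV0 : 0 < p^-1 by rewrite invr_gt0.
exact: (@cvg_comp _ _ _ _ _ _ _ _ ac (@normr_powR_continuous R p^-1 pV0 0)).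
Qed.

(** What the convexity arguments need of translations along e_i. Measurability is joint in the point
    and the time so that Fubini applies to integrals along orbits. *)
Record measure_flow d (T : measurableType d) (R : realType)
    (mu : set T -> \bar R) (tau : R -> T -> T) : Prop := MeasureFlow {
  flow0 : forall x, tau 0 x = x ;
  flowD : forall s t x, tau (s + t) x = tau s (tau t x) ;
  measurable_flow2 : measurable_fun [set: T * R] (fun z : T * R => tau z.2 z.1) ;
  flow_measure : forall t (A : set T), measurable A -> mu (tau t @^-1` A) = mu A }.

(** * Strong continuity of a flow on L^p *)

Section flow.
Context d (T : measurableType d) (R : realType).
Variables (mu : {sigma_finite_measure set T -> \bar R}) (tau : R -> T -> T).
Hypothesis flow_tau : measure_flow mu tau.
Variable p : R.
Hypothesis p1 : 1 < p.
Local Notation leb := (@lebesgue_measure R).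
Local Notation Lp := (Lfun mu p%:E).

Let p1' : 1 <= p. Proof. exact: ltW. Qed.
Let p0 : 0 < p. Proof. exact: lt_trans p1. Qed.
Let tauD := flowD flow_tau.
Let mtau := measurable_flow2 flow_tau.
Let mu_tau := flow_measure flow_tau.

Lemma measurable_flow t : measurable_fun [set: T] (tau t).
Proof. exact: (measurableT_comp mtau (pair2_measurable t)). Qed.

Lemma measurable_flow_comp d' (Y : measurableType d') (f : T -> Y) :
  measurable_fun [set: T] f ->
  measurable_fun [set: T * R] (fun z : T * R => f (tau z.2 z.1)).
Proof. by move=> mf; apply: measurableT_comp mf mtau. Qed.

Lemma ge0_integral_flow t (f : T -> \bar R) : measurable_fun [set: T] f ->
  (forall x, 0 <= f x)%E -> (\int[mu]_x f (tau t x) = \int[mu]_x f x)%E.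
Proof.
move=> mf f0; apply: (@ge0_integral_invariant _ _ _ mu (tau t) f) => //.
  exact: measurable_flow.
exact: mu_tau.
Qed.

Lemma Lfun_flow t f : f \in Lp ->
  (fun x => f (tau t x)) \in Lp /\ pnorm mu p (fun x => f (tau t x)) = pnorm mu p f.
Proof.
move=> fL; have mf := Lfun_measurable p1' fL.
have E : (\int[mu]_x (`|f (tau t x)| `^ p)%:E = \int[mu]_x (`|f x| `^ p)%:E)%E.
  apply: (@ge0_integral_flow t (fun x => (`|f x| `^ p)%:E)).
    exact: measurable_normr_powR.
  by move=> x; rewrite lee_fin powR_ge0.
have ftL : (fun x => f (tau t x)) \in Lp.
  apply/(LfunEP _ p1'); split.
    by apply: measurableT_comp => //; exact: measurable_flow.
  by rewrite E; case/(LfunEP _ p1') : fL.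
split=> //; apply: (powR_injective p0); rewrite ?nnegrE ?pnorm_ge0//.
by apply/EFin_inj; rewrite -!integral_pnorm.
Qed.

Lemma measurable_flow_dist (f : T -> R) (s : R) : measurable_fun [set: T] f ->
  measurable_fun [set: T * R]
    (fun z : T * R => (`|f (tau (z.2 + s) z.1) - f (tau z.2 z.1)| `^ p)%:E).
Proof.
move=> mf; apply: measurable_normr_powR => //; apply: measurable_funB.
  under eq_fun do rewrite addrC tauD.
  apply: (@measurableT_comp _ _ _ _ _ _ (fun x => f (tau s x))).
    by apply: measurableT_comp => //; exact: measurable_flow.
  exact: mtau.
exact: measurable_flow_comp.
Qed.

(** Transference: by invariance ||f o tau_h - f||^p equals its average over t in [0, 1] of ||f o
    tau_(t+h) - f o tau_t||^p. Fubini turns this into the integral over x of a one-dimensional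
    quantity on the orbit of x, which tends to 0 for every x. No topology on the space is
    involved. *)
Lemma cvg_pnorm_flow_bounded f (M : R) (h : R^nat) : f \in Lp ->
  (forall x, `|f x| <= M) -> (forall n, `|h n| <= 1) -> h @ \oo --> (0 : R) ->
  pnorm mu p (fun x => f (tau (h n) x) - f x) @[n --> \oo] --> 0.
Proof.
move=> fL fM h1 hcvg; have mf := Lfun_measurable p1' fL.
have fhL n : (fun x => f (tau (h n) x) - f x) \in Lp.
  by apply: LfunB => //; exact: (Lfun_flow _ _).1.
pose k n (z : T * R) := (`|f (tau (z.2 + h n) z.1) - f (tau z.2 z.1)| `^ p)%:E.
have mk n : measurable_fun [set: T * R] (k n) by exact: measurable_flow_dist.
have k0 n z : (0 <= k n z)%E by rewrite lee_fin powR_ge0.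
have mI (a b : R) : measurable (`[a, b] : set R) by [].
pose J n x := (\int[leb]_(t in `[0%R, 1%R]) k n (x, t))%E.
have intJ n : (\int[mu]_x J n x = (pnorm mu p (fun x => f (tau (h n) x) - f x) `^ p)%:E)%E.
  rewrite (ge0_fubini_restrict mu leb (mI 0 1) (mk n) (k0 n)).
  under eq_integral => t _.
    rewrite /k/= (_ : (\int[mu]_x _)%E =
        (pnorm mu p (fun x => f (tau (h n) x) - f x) `^ p)%:E); last first.
      rewrite -integral_pnorm//.
      rewrite -[RHS](@ge0_integral_flow t); last 2 first.
      - exact: measurable_normr_powR (Lfun_measurable p1' (fhL n)).
      - by move=> x; rewrite lee_fin powR_ge0.
      by apply: eq_integral => x _; rewrite [t + h n]addrC tauD.
    over.
  rewrite integral_cst//= lebesgue_measure_itv/= lte_fin ltr01.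
  by rewrite oppr0 adde0 mule1.
pose g (z : T * R) := (`|f (tau z.2 z.1)| `^ p)%:E.
have mg : measurable_fun [set: T * R] g.
  by apply: measurable_normr_powR => //; exact: measurable_flow_comp.
have g0 z : (0 <= g z)%E by rewrite lee_fin powR_ge0.
(* Dominating function: 2^p comes from |a - b|^p <= 2^p (|a|^p + |b|^p), and 2 from these two
   summands, each of which is integrated over a subset of [-1, 2]. *)
pose G x := ((2 `^ p * 2)%:E * \int[leb]_(t in `[(-1)%R, 2%R]) g (x, t))%E.
have mG0 : measurable_fun [set: T] (fun x => \int[leb]_(t in `[(-1)%R, 2%R]) g (x, t))%E.
  exact: (measurable_ge0_fubini_restrict leb (mI (-1) 2) mg g0).
have intG0 : (\int[mu]_x \int[leb]_(t in `[(-1)%R, 2%R]) g (x, t) < +oo)%E.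
  rewrite (ge0_fubini_restrict mu leb (mI _ _) mg g0).
  under eq_integral => t _.
    rewrite /g/= (@ge0_integral_flow t (fun x => (`|f x| `^ p)%:E)); last 2 first.
    - exact: measurable_normr_powR.
    - by move=> x; rewrite lee_fin powR_ge0.
    rewrite integral_pnorm//; over.
  rewrite integral_cst//= lebesgue_measure_itv/= lte_fin ifT; last by lra.
  by rewrite -EFinD -EFinM ltry.
have intG : mu.-integrable [set: T] G.
  apply: integrableZl => //; apply/integrableP; split => //.
  by under eq_integral do rewrite gee0_abs ?integral_ge0//.
have JG n x : (`|J n x| <= G x)%E.
  rewrite gee0_abs ?integral_ge0// /J.
  have mgx a : measurable_fun [set: R] (fun t => g (x, t + a)).
    apply: (measurableT_comp mg); apply: measurable_fun_pair => //.
    exact: measurable_funD.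
  have mgx0 : measurable_fun [set: R] (fun t => g (x, t)).
    exact: (measurableT_comp mg).
  have mgD : measurable_fun [set: R] (fun t => g (x, (t + h n)%R) + g (x, t))%E.
    exact: emeasurable_funD (mgx _) mgx0.
  apply: (@le_trans _ _ (\int[leb]_(t in `[0%R, 1%R])
      ((2 `^ p)%:E * (g (x, (t + h n)%R) + g (x, t))))%E).
    apply: ge0_le_integral => //.
    - by apply: measurable_funTS; exact: (measurableT_comp (mk n)).
    - apply: measurable_funTS; exact: measurable_funeM.
    - move=> t _; rewrite -EFinD -EFinM lee_fin.
      have := powR_normD_le (f (tau (t + h n) x)) (- f (tau t x)) p1'.
      by rewrite normrN.
  rewrite ge0_integralZl ?lee_fin ?powR_ge0//; last 2 first.
  - exact: measurable_funTS mgD.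
  - by move=> t _; exact: adde_ge0.
  rewrite /G EFinM -muleA lee_pmul2l ?lte_fin ?powR_gt0//.
  rewrite ge0_integralD//; last 2 first.
  - exact: measurable_funTS (mgx (h n)).
  - exact: measurable_funTS mgx0.
  rewrite (_ : 2%:E = 1 + 1)%E// ge0_muleDl// mul1e.
  apply: leeD.
    rewrite integral_mkcond [leRHS]integral_mkcond.
    have mpatch (w : R -> \bar R) a b : measurable_fun [set: R] w ->
        measurable_fun [set: R] (w \_ (`[a, b] : set R)).
      move=> mw; apply/(measurable_restrictT w (mI a b)).
      exact: measurable_funTS.
    have gp0 (w : R -> \bar R) a b t : (forall t, 0 <= w t)%E ->
        (0 <= (w \_ (`[a, b] : set R)) t)%E.
      by move=> w0; rewrite /patch; case: ifP.
    rewrite -(ge0_integral_shift (h n) (mpatch (fun t => g (x, t)) (-1) 2 mgx0)); last first.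
      by move=> t; exact: gp0.
    apply: ge0_le_integral => //.
    - by move=> t _; exact: gp0.
    - exact: mpatch.
    - apply: (measurableT_comp (mpatch (fun t => g (x, t)) (-1) 2 mgx0)).
      exact: measurable_funD.
    - move=> t _; rewrite /patch; case: ifPn => [|_]; last by case: ifP.
      rewrite inE/= in_itv/= => /andP[t0 t1].
      have := h1 n; rewrite ler_norml => /andP[h1a h1b].
      by rewrite ifT// inE/= in_itv/=; apply/andP; split; lra.
  apply: ge0_subset_integral => //; first exact: measurable_funTS mgx0.
  by move=> t /=; rewrite !in_itv/= => /andP[? ?]; apply/andP; split; lra.
have J0 x : J n x @[n --> \oo] --> 0%E.
  apply: (@cvg_translation_bounded R (fun t => f (tau t x)) M p h) => //.
  apply: (measurableT_comp mf); exact: (measurableT_comp mtau (pair1_measurable x)).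
have [_ _] := @dominated_convergence _ _ _ mu setT measurableT J (cst 0)%E G
  (fun n => measurable_ge0_fubini_restrict leb (mI 0 1) (mk n) (k0 n))
  (measurable_cst _) (aeW _ (fun x _ => J0 x)) intG (aeW _ (fun x n _ => JG n x)).
rewrite integral0 (_ : [sequence _]_n = fun n =>
  (pnorm mu p (fun x => f (tau (h n) x) - f x) `^ p)%:E); last exact/funext.
move=> /fine_cvgP[_ Jc].
by apply: (@powR_cvg0_inv R nat \oo _ _ p p0) => [n|]; [exact: pnorm_ge0|exact: Jc].
Qed.

(** Truncation removes boundedness: [f] is close in L^p to its cut-off [c M], and stays equally
    close after composition with the flow, which is an isometry. *)
Lemma cvg_pnorm_flow_seq f (h : R^nat) : f \in Lp ->
  (forall n, `|h n| <= 1) -> h @ \oo --> (0 : R) ->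
  pnorm mu p (fun x => f (tau (h n) x) - f x) @[n --> \oo] --> 0.
Proof.
move=> fL h1 hcvg; have mf := Lfun_measurable p1' fL.
pose A M := [set x | `|f x| <= M%:R].
have mA M : measurable (A M).
  rewrite (_ : A M = (fun x => `|f x|) @^-1` `]-oo, M%:R]).
    rewrite -[X in measurable X]setTI.
    have mnf : measurable_fun [set: T] (fun x => `|f x|) by exact: measurableT_comp.
    exact: mnf.
  by apply/seteqP; split=> x /=; rewrite in_itv.
pose c M x := f x * \1_(A M) x.
have cE M x : c M x = if `|f x| <= M%:R then f x else 0.
  rewrite /c indicE; case: ifPn => fx.
    by rewrite mem_set ?mulr1.
  by rewrite memNset ?mulr0//; exact/negP.
have cL M : c M \in Lp.
  have mc : measurable_fun [set: T] (c M) by apply: measurable_funM.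
  apply/(LfunEP _ p1'); split => //.
  have [_ +] := (LfunEP mu p1' f).1 fL; apply: le_lt_trans.
  apply: ge0_le_integral => //; try exact: measurable_normr_powR.
  move=> x _; rewrite lee_fin ge0_ler_powR ?nnegrE ?(ltW p0)// cE.
  by case: ifP => //; rewrite normr0.
have cM M x : `|c M x| <= M%:R by rewrite cE; case: ifP => //; rewrite normr0.
have fcL M : (fun x => f x - c M x) \in Lp by exact: LfunB.
have cf : pnorm mu p (fun x => f x - c M x) @[M --> \oo] --> 0.
  have := @dominated_cvg _ _ _ mu setT measurableT
    (fun M x => (`|f x - c M x| `^ p)%:E) (cst 0)%E (fun x => (`|f x| `^ p)%:E).
  rewrite integral0 (_ : (fun M => _) = fun M =>
    (pnorm mu p (fun x => f x - c M x) `^ p)%:E); last first.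
    by apply/funext => M; rewrite integral_pnorm.
  move=> /(_ _ _ _ _ _)/fine_cvgP[].
  - move=> M; apply: measurable_normr_powR => //; exact: Lfun_measurable (fcL M).
  - move=> x _; have [K Kx] : exists K : nat, `|f x| <= K%:R.
      exists (Num.truncn `|f x|).+1; rewrite ltW//.
      by have /andP[] := truncn_itv (normr_ge0 (f x)).
    apply: cvg_near_cst; exists K => // M /= KM.
    rewrite cE ifT ?subrr ?normr0 ?powR0 ?gt_eqF//.
    by rewrite (le_trans Kx)// ler_nat.
  - by [].
  - exact: Lfun_integrable.
  - move=> M x _; rewrite gee0_abs ?lee_fin ?powR_ge0//.
    rewrite ge0_ler_powR ?nnegrE ?(ltW p0)// cE.
    by case: ifP => _; rewrite ?subrr ?normr0 ?subr0.
  move=> _ Jc.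
  by apply: (@powR_cvg0_inv R nat \oo _ _ p p0) => [n|]; [exact: pnorm_ge0|exact: Jc].
apply/cvgrPdist_le => /= e e0.
have e3 : 0 < e / 3 by rewrite divr_gt0.
have /cvgrPdist_le/(_ _ e3)[M _ /(_ M (leqnn M))] := cf.
rewrite /= sub0r normrN ger0_norm ?pnorm_ge0// => fcM.
have /cvgrPdist_le/(_ _ e3) := cvg_pnorm_flow_bounded (cL M) (cM M) h1 hcvg.
apply: filterS => n; rewrite !sub0r !normrN !ger0_norm ?pnorm_ge0// => cn.
have ftL t u : u \in Lp -> (fun x => u (tau t x)) \in Lp.
  by move=> uL; exact: (Lfun_flow t uL).1.
have := pnorm_triangle p1' (ftL (h n) _ fL) (ftL (h n) _ (cL M)) fL.
have := pnorm_triangle p1' (ftL (h n) _ (cL M)) (cL M) fL.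
have := (Lfun_flow (h n) (fcL M)).2.
rewrite (pnorm_distC _ _ (c M) f) => /= -> ; lra.
Qed.

Lemma cvg_pnorm_flow f : f \in Lp ->
  pnorm mu p (fun x => f (tau h x) - f x) @[h --> 0^'+] --> 0.
Proof.
move=> fL; apply/cvg_at_rightP => h [_ hcvg].
have [N _ hN] : \forall n \near \oo, `|h n| <= 1.
  have /cvgrPdist_le/(_ _ ltr01) := hcvg.
  by apply: filterS => n; rewrite sub0r normrN.
rewrite -(cvg_shiftn N).
apply: (@cvg_pnorm_flow_seq f (fun n => h (n + N)%N)) => //.
  by move=> n; apply: hN; rewrite /= leq_addl.
by rewrite (cvg_shiftn N h).
Qed.

End flow.

(** * Jensen's inequality on an interval *)

Section jensen.
Variable R : realType.
Local Notation leb := (@lebesgue_measure R).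

(** Holder against the indicator of [0, h], whose q-norm is h^(1/q), with p/q = p - 1. Integrability
    of [k] is not assumed: an infinite right side is trivial. *)
Lemma powR_Rintegral_le (k : R -> R) (h p : R) : measurable_fun [set: R] k ->
  0 < h -> 1 < p ->
  ((`|\int[leb]_(t in `[0, h]) k t| `^ p)%:E <=
   (h `^ (p - 1))%:E * \int[leb]_(t in `[0%R, h]) (`|k t| `^ p)%:E)%E.
Proof.
move=> mk h0 p1.
have p0 : 0 < p by rewrite (lt_trans _ p1).
have pB0 : 0 < p - 1 by rewrite subr_gt0.
pose q := p / (p - 1).
have q0 : 0 < q by rewrite divr_gt0.
have pq : p^-1 + q^-1 = 1.
  by rewrite /q invf_div -{1}(div1r p) -mulrDl subrKC mulfV// gt_eqF.
have mI : measurable (`[0, h] : set R) by [].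
have mi : measurable_fun [set: R] (\1_(`[0, h] : set R) : R -> R) by [].
have mf : measurable_fun [set: R] (fun t => k t * \1_(`[0, h] : set R) t).
  exact: measurable_funM.
have patchE (w : R -> R) (r : R) : 0 < r ->
    (\int[leb]_t (`|w t * \1_(`[0, h] : set R) t| `^ r)%:E =
     \int[leb]_(t in `[0%R, h]) (`|w t| `^ r)%:E)%E.
  move=> r0; rewrite [RHS]integral_mkcond; apply: eq_integral => t _.
  rewrite /patch indicE; case: ifPn => _; first by rewrite mulr1.
  by rewrite mulr0 normr0 powR0 ?gt_eqF.
have := @hoelder _ _ _ leb _ _ p q mf mi p0 q0 pq.
rewrite Lnorm1 (_ : (\int[leb]_x _)%E = \int[leb]_(t in `[0%R, h]) `|k t|%:E)%E; last first.
  rewrite [RHS]integral_mkcond; apply: eq_integral => t _ /=.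
  rewrite /patch indicE; case: ifPn => _; first by rewrite !mulr1.
  by rewrite !mulr0 normr0.
rewrite unlock/= patchE//.
rewrite (_ : (\int[leb]_x (`|\1_(`[0, h] : set R) x| `^ q)%:E)%E = h%:E); last first.
  under eq_integral do rewrite -[\1__ _]mul1r.
  rewrite (patchE (fun=> 1) q q0) normr1 powR1 integral_cst//=.
  by rewrite lebesgue_measure_itv/= lte_fin h0 oppr0 adde0 mul1e.
set B := (\int[leb]_(t in _) (`|k t| `^ p)%:E)%E => hA.
have B0 : (0 <= B)%E by apply: integral_ge0 => t _; rewrite lee_fin powR_ge0.
have : (`|\int[leb]_(t in `[0%R, h]) (k t)%:E| <= B `^ p^-1 * h%:E `^ q^-1)%E.
  apply: le_trans hA; apply: (le_trans (le_abse_integral _ _ _)) => //.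
  by apply/measurable_EFinP; exact: measurable_funTS.
move: B0; case: B hA => [b| |] // hA B0; last first.
  by rewrite gt0_muley ?leey// lte_fin powR_gt0.
rewrite lee_fin in B0.
rewrite !poweR_EFin -!EFinM => hk; rewrite lee_fin.
have : `|\int[leb]_(t in `[0, h]) k t| <= b `^ p^-1 * h `^ q^-1.
  rewrite -lee_fin (le_trans _ hk)// /Rintegral.
  by case: (\int[leb]_(t in `[0%R, h]) (k t)%:E)%E => [r| |] //=; rewrite normr0 leey.
move=> hR.
apply: (@le_trans _ _ ((b `^ p^-1 * h `^ q^-1) `^ p)).
  rewrite ge0_ler_powR ?nnegrE ?(ltW p0)// mulr_ge0 ?powR_ge0//.
rewrite powRM ?powR_ge0// -!powRrM mulVf ?gt_eqF// powRr1// mulrC.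
by rewrite /q invf_div divfK// gt_eqF.
Qed.

End jensen.

(** * Difference quotients along a flow *)

Section flow_quotient.
Context d (T : measurableType d) (R : realType).
Variables (mu : {sigma_finite_measure set T -> \bar R}) (tau : R -> T -> T).
Hypothesis flow_tau : measure_flow mu tau.
Variable p : R.
Hypothesis p1 : 1 < p.
Local Notation leb := (@lebesgue_measure R).
Local Notation Lp := (Lfun mu p%:E).
Local Notation nrm := (pnorm mu p).

Let p1' : 1 <= p. Proof. exact: ltW. Qed.
Let p0 : 0 < p. Proof. exact: lt_trans p1. Qed.

Definition quotient (h : R) (u : T -> R) (x : T) : R := h^-1 * (u (tau h x) - u x).

Let flowL t f : f \in Lp -> (fun x => f (tau t x)) \in Lp.
Proof. by move=> fL; exact: (Lfun_flow flow_tau p1 t fL).1. Qed.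

Let nrm_flow t f : f \in Lp -> nrm (fun x => f (tau t x)) = nrm f.
Proof. by move=> fL; exact: (Lfun_flow flow_tau p1 t fL).2. Qed.

Lemma Lfun_quotient h u : u \in Lp -> quotient h u \in Lp.
Proof.
move=> uL; apply: (LfunZ p1'); apply: LfunB => //; exact: flowL.
Qed.

Lemma pnorm_quotient h u : u \in Lp ->
  nrm (quotient h u) = `|h^-1| * nrm (fun x => u (tau h x) - u x).
Proof.
by move=> uL; rewrite (pnormZ p1')//; apply: LfunB => //; exact: flowL.
Qed.

(** The difference is the mean over t in [0, h] of g o tau_t - g, so Jensen and Fubini bound its
    norm by the largest norm under the mean. *)
Lemma pnorm_quotient_sub (u g : T -> R) (h c : R) : u \in Lp -> g \in Lp ->
  0 < h -> 0 <= c ->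
  {ae mu, forall x, u (tau h x) - u x = \int[leb]_(t in `[0, h]) g (tau t x)} ->
  (forall t, 0 <= t <= h -> nrm (fun x => g (tau t x) - g x) <= c) ->
  nrm (fun x => quotient h u x - g x) <= c.
Proof.
move=> uL gL h0 c0 ug gc.
have mg := Lfun_measurable p1' gL.
have mI : measurable (`[0, h] : set R) by [].
have mgtau : measurable_fun [set: T * R] (fun z : T * R => g (tau z.2 z.1)).
  exact: (measurable_flow_comp flow_tau).
pose k (z : T * R) := (`|g (tau z.2 z.1) - g z.1| `^ p)%:E.
have mk : measurable_fun [set: T * R] k.
  apply: measurable_normr_powR => //; apply: measurable_funB => //.
  by apply: (measurableT_comp mg).
have k0 z : (0 <= k z)%E by rewrite lee_fin powR_ge0.
pose k' (z : T * R) := (`|g (tau z.2 z.1)| `^ p)%:E.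
have mk' : measurable_fun [set: T * R] k' by exact: measurable_normr_powR.
have k'0 z : (0 <= k' z)%E by rewrite lee_fin powR_ge0.
have intk' : mu.-integrable [set: T] (fun x => \int[leb]_(t in `[0%R, h]) k' (x, t))%E.
  apply/integrableP; split.
    exact: (measurable_ge0_fubini_restrict leb mI mk' k'0).
  under eq_integral do rewrite gee0_abs ?integral_ge0//.
  rewrite (ge0_fubini_restrict mu leb mI mk' k'0).
  under eq_integral => t _.
    rewrite /k'/= (ge0_integral_flow flow_tau t (f := fun x => (`|g x| `^ p)%:E)); last 2 first.
    - exact: measurable_normr_powR.
    - by move=> x; rewrite lee_fin powR_ge0.
    rewrite integral_pnorm//; over.
  rewrite integral_cst//= lebesgue_measure_itv/= lte_fin h0.
  by rewrite -EFinD -EFinM ltry.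
(* [Rintegral] of a nonintegrable function is only a default value, so subtracting g x under the
   integral requires integrability along almost every orbit. *)
have fin : {ae mu, forall x, leb.-integrable `[0%R, h] (fun t => (g (tau t x))%:E)}.
  have := integrable_ae measurableT intk'; apply: filterS => x /(_ I) kx.
  have mgx : measurable_fun [set: R] (fun t => g (tau t x)).
    exact: (measurableT_comp mgtau (pair1_measurable x)).
  apply/integrableP; split; first by apply/measurable_EFinP; exact: measurable_funTS.
  apply: (@le_lt_trans _ _ (\int[leb]_(t in `[0%R, h]) (1%:E + k' (x, t)))%E).
    apply: ge0_le_integral => //.
    - by apply/measurable_EFinP; apply: measurableT_comp => //; exact: measurable_funTS.
    - apply: emeasurable_funD => //; apply: measurable_funTS.
      exact: (measurableT_comp mk' (pair1_measurable x)).
    - by move=> t _; rewrite -EFinD lee_fin; exact: norm_le1_powR.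
  rewrite ge0_integralD//; last first.
    by apply: measurable_funTS; exact: (measurableT_comp mk' (pair1_measurable x)).
  rewrite integral_cst//= lebesgue_measure_itv/= lte_fin h0 mul1e lte_add_pinfty//.
    by rewrite -EFinD ltry.
  by rewrite ltey_eq kx.
have mq : measurable_fun [set: T] (fun x => quotient h u x - g x).
  by apply: measurable_funB => //; exact: Lfun_measurable (Lfun_quotient h uL).
apply: (Lfun_le_pnorm p1' mq c0 _).2.
(* The factor is h^(-p) from the quotient times h^(p-1) from Jensen. *)
apply: (@le_trans _ _ (\int[mu]_x ((h^-1)%:E * \int[leb]_(t in `[0%R, h]) k (x, t)))%E).
  apply: ae_ge0_le_integral => //.
  - exact: measurable_normr_powR.
  - by move=> x _; rewrite mule_ge0 ?integral_ge0// lee_fin invr_ge0 ltW.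
  - apply: measurable_funeM.
    exact: (measurable_ge0_fubini_restrict leb mI mk k0).
  - apply: filterS2 ug fin => x ux gx _.
    have mgx : measurable_fun [set: R] (fun t => g (tau t x)).
      exact: (measurableT_comp mgtau (pair1_measurable x)).
    have intc : leb.-integrable `[0%R, h] (fun=> (g x)%:E).
      apply/integrableP; split => //.
      rewrite integral_cst//= lebesgue_measure_itv/= lte_fin h0.
      by rewrite -EFinD -EFinM ltry.
    have E : quotient h u x - g x = h^-1 * \int[leb]_(t in `[0, h]) (g (tau t x) - g x).
      rewrite RintegralB// /quotient ux mulrBr; congr (_ - _).
      rewrite /Rintegral integral_cst//= lebesgue_measure_itv/= lte_fin h0 /=.
      by rewrite oppr0 addr0 mulrCA mulVf ?mulr1// gt_eqF.
    rewrite E normrM powRM// EFinM.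
    have mgB : measurable_fun [set: R] (fun t => g (tau t x) - g x).
      exact: measurable_funB.
    have J := powR_Rintegral_le mgB h0 p1.
    apply: (@le_trans _ _ ((`|h^-1| `^ p)%:E * ((h `^ (p - 1))%:E *
        \int[leb]_(t in `[0%R, h]) k (x, t)))%E).
      by rewrite lee_pmul// lee_fin powR_ge0.
    rewrite muleA -EFinM; apply: lee_pmul => //.
    + by rewrite lee_fin mulr_ge0 ?powR_ge0.
    + exact: integral_ge0.
    + rewrite lee_fin ger0_norm ?invr_ge0 ?(ltW h0)//.
      rewrite -powR_inv1 ?(ltW h0)// -powRrM mulN1r -powRD; last by rewrite (gt_eqF h0) implybT.
      by rewrite addrA addNr add0r powR_inv1 ?(ltW h0).
rewrite ge0_integralZl//; last 3 first.
- exact: (measurable_ge0_fubini_restrict leb mI mk k0).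
- by move=> x _; exact: integral_ge0.
- by rewrite lee_fin invr_ge0 ltW.
rewrite (ge0_fubini_restrict mu leb mI mk k0) -lee_pdivlMl ?invr_gt0// invrK.
rewrite muleC.
apply: (@le_trans _ _ (\int[leb]_(t in `[0%R, h]) (cst (c `^ p)%:E t))%E); last first.
  rewrite integral_cst//= lebesgue_measure_itv/= lte_fin h0.
  by rewrite oppr0 adde0.
apply: ge0_le_integral => //.
- by move=> t _; apply: integral_ge0.
- apply: measurable_funTS.
  exact: (measurable_fun_fubini_tonelli_G k mk k0).
- move=> t; rewrite /= in_itv/= => th.
  rewrite /k/= integral_pnorm//; last by apply: LfunB => //; exact: flowL.
  by rewrite lee_fin ge0_ler_powR ?nnegrE ?pnorm_ge0 ?(ltW p0)// gc.
Qed.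

(** The increment over s + t is the increment over s, transported by tau_t, plus the increment over
    t; transport is isometric. *)
Lemma pnorm_flow_diffD (u : T -> R) (s t : R) : u \in Lp ->
  nrm (fun x => u (tau (s + t) x) - u x) <=
  nrm (fun x => u (tau s x) - u x) + nrm (fun x => u (tau t x) - u x).
Proof.
move=> uL.
have dL : (fun x => u (tau s x) - u x) \in Lp by apply: LfunB => //; exact: flowL.
rewrite -(nrm_flow t dL).
rewrite [leLHS](_ : _ = nrm (fun x => (u (tau s (tau t x)) - u (tau t x)) + (u (tau t x) - u x))).
  apply: pnormD => //; first exact: (flowL t dL).
  by apply: LfunB => //; exact: flowL.
by congr pnorm; apply/funext => x; rewrite addrA subrK (flowD flow_tau).
Qed.

Lemma pnorm_flow_diff0 (u : T -> R) : u \in Lp ->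
  nrm (fun x => u (tau 0 x) - u x) = 0.
Proof.
move=> uL; rewrite (_ : (fun x => _) = fun x => 0 * u x).
  by rewrite pnormZ// normr0 mul0r.
by apply/funext => x; rewrite (flow0 flow_tau) subrr mul0r.
Qed.

Lemma pnorm_flow_diff_mulrn (u : T -> R) (h : R) n : u \in Lp ->
  nrm (fun x => u (tau (h *+ n) x) - u x) <= nrm (fun x => u (tau h x) - u x) *+ n.
Proof.
move=> uL; elim: n => [|n IH]; first by rewrite mulr0n pnorm_flow_diff0.
by rewrite mulrS (le_trans (pnorm_flow_diffD _ _ uL))// mulrS lerD2l.
Qed.

(* [h |-> nrm (u o tau h - u)] is subadditive and continuous at 0, so linear
   control along a sequence tending to 0 propagates to all h. *)
Lemma pnorm_flow_diff_linear (u : T -> R) (C : R) : u \in Lp ->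
  (forall e, 0 < e -> exists2 h, 0 < h < e &
    nrm (fun x => u (tau h x) - u x) <= C * h) ->
  forall t, 0 < t -> nrm (fun x => u (tau t x) - u x) <= C * t.
Proof.
move=> uL uC t t0; apply/ler_addgt0Pr => e e0.
have /cvgrPdist_le/(_ _ e0)[/= a a0 aP] := cvg_pnorm_flow flow_tau p1 uL.
have [h /andP[h0 ha] hC] := uC _ a0.
(* Division with remainder: t = n h + r with 0 <= r < h < a. The n full steps cost at most C n h <=
   C t, and the remainder at most e by continuity at 0. *)
pose n := Num.truncn (t / h).
have /andP[nt tn] : (n%:R <= t / h < n.+1%:R).
  by apply: truncn_itv; rewrite divr_ge0 ?(ltW t0)// ltW.
have C0 : 0 <= C.
  by rewrite -(@pmulr_lge0 _ h)// (le_trans _ hC)// pnorm_ge0.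
rewrite ler_pdivlMr// mulr_natl in nt.
rewrite ltr_pdivrMr// mulr_natl mulrS in tn.
have -> : t = h *+ n + (t - h *+ n) by rewrite addrC subrK.
apply: (le_trans (pnorm_flow_diffD _ _ uL)); apply: lerD.
  apply: (le_trans (pnorm_flow_diff_mulrn _ _ uL)).
  rewrite addrC subrK (@le_trans _ _ (C * (h *+ n)))//.
    by rewrite mulrnAr lerMn2r hC orbT.
  by rewrite ler_wpM2l.
have [->|r0] := eqVneq (t - h *+ n) 0; first by rewrite pnorm_flow_diff0// ltW.
have r0' : 0 < t - h *+ n by rewrite lt_neqAle eq_sym r0 subr_ge0.
have := aP (t - h *+ n); rewrite /= !sub0r !normrN !ger0_norm ?pnorm_ge0//; last exact: ltW.
apply => //; apply: lt_trans ha; rewrite ltrBlDr addrC; lra.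
Qed.

Definition flow_mean (b : nat) (h : R) (f : T -> R) (x : T) : R :=
  b%:R^-1 * \sum_(0 <= j < b) f (tau (h *+ j) x).

(** Telescoping along the orbit; this is how a coarse quotient is recovered from a finer one. *)
Lemma flow_mean_quotient b h u x : (0 < b)%N -> h != 0 ->
  flow_mean b h (quotient h u) x = quotient (h *+ b) u x.
Proof.
move=> b0 h0; rewrite /flow_mean /quotient -mulr_sumr.
under eq_bigr => j _ do rewrite -(flowD flow_tau) -mulrS.
rewrite (telescope_sumr (fun j => u (tau (h *+ j) x)))// mulr0n (flow0 flow_tau).
by rewrite mulrA -[h *+ b]mulr_natr invfM (mulrC b%:R^-1).
Qed.

Lemma flow_mean_exchange a b h f x :
  flow_mean a h (flow_mean b h f) x = flow_mean b h (flow_mean a h f) x.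
Proof.
rewrite /flow_mean -!mulr_sumr !mulrA (mulrC a%:R^-1); congr (_ * _).
rewrite exchange_big/=; apply: eq_bigr => j _; apply: eq_bigr => i _.
by rewrite -!(flowD flow_tau) addrC.
Qed.

Lemma flow_meanD b h f g x :
  flow_mean b h (fun x => f x + g x) x = flow_mean b h f x + flow_mean b h g x.
Proof. by rewrite /flow_mean big_split mulrDr. Qed.

Lemma Lfun_flow_mean b h f : f \in Lp -> flow_mean b h f \in Lp.
Proof.
move=> fL; apply: (LfunZ p1').
have FL j : (fun x => f (tau (h *+ j) x)) \in Lp by exact: flowL.
exact: (pnorm_sum p1' (index_iota 0 b) FL).1.
Qed.

Lemma pnorm_flow_mean b h f : (0 < b)%N -> f \in Lp ->
  nrm (flow_mean b h f) <= nrm f.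
Proof.
move=> b0 fL; have FL j : (fun x => f (tau (h *+ j) x)) \in Lp by exact: flowL.
have [SL Sn] := pnorm_sum p1' (index_iota 0 b) FL.
rewrite /flow_mean pnormZ// ger0_norm ?invr_ge0// ler_pdivrMl ?ltr0n//.
apply: (le_trans Sn); under eq_bigr do rewrite nrm_flow//.
by rewrite sumr_const_nat subn0 mulr_natl.
Qed.

Lemma pnorm_flow_mean_sub b h f c : (0 < b)%N -> f \in Lp ->
  (forall j, (j < b)%N -> nrm (fun x => f (tau (h *+ j) x) - f x) <= c) ->
  nrm (fun x => flow_mean b h f x - f x) <= c.
Proof.
move=> b0 fL fc.
have FL j : (fun x => f (tau (h *+ j) x) - f x) \in Lp.
  by apply: LfunB => //; exact: flowL.
have [SL Sn] := pnorm_sum p1' (index_iota 0 b) FL.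
rewrite (_ : (fun x => _) = fun x => b%:R^-1 *
    \sum_(0 <= j < b) (f (tau (h *+ j) x) - f x)); last first.
  apply/funext => x; rewrite sumrB mulrBr sumr_const_nat subn0 -(mulr_natl (f x)).
  by rewrite mulrA mulVf ?mul1r// pnatr_eq0 -lt0n.
rewrite pnormZ// ger0_norm ?invr_ge0// ler_pdivrMl ?ltr0n//.
apply: (le_trans Sn); rewrite mulr_natl -[b in leRHS]subn0 -sumr_const_nat.
by rewrite !big_mkord; apply: ler_sum => j _; exact: fc.
Qed.

(* The means of the finer quotients recover the coarser ones, so the norms are
   nondecreasing and the norm of a sum of two fine quotients is nearly twice
   the supremum; uniform convexity then yields a Cauchy sequence. *)
Lemma cvg_dyadic_quotient (u : T -> R) (C : R) : u \in Lp ->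
  (forall t, 0 < t -> nrm (fun x => u (tau t x) - u x) <= C * t) ->
  exists2 g, g \in Lp &
    nrm (fun x => quotient (2^-1 ^+ n) u x - g x) @[n --> \oo] --> 0.
Proof.
move=> uL uC.
pose e_ n : R := 2^-1 ^+ n.
have e_gt0 n : 0 < e_ n by rewrite exprn_gt0.
pose D n := quotient (e_ n) u.
have DL n : D n \in Lp by exact: Lfun_quotient.
have e_mul m n : (m <= n)%N -> e_ n *+ (2 ^ (n - m)) = e_ m.
  move=> mn; have -> : e_ n = 2^-1 ^+ (n - m) * e_ m.
    by rewrite /e_ -exprD subnK.
  by rewrite -[X in X = _]mulr_natl natrX mulrA -exprMn divff// expr1n mul1r.
have pow2_gt0 n : (0 < 2 ^ n)%N by rewrite expn_gt0.
have D_mean m n : (m <= n)%N -> D m = flow_mean (2 ^ (n - m)) (e_ n) (D n).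
  move=> mn; apply/funext => x; rewrite flow_mean_quotient ?gt_eqF//.
  by rewrite e_mul.
have D_nd : nondecreasing_seq (fun n => nrm (D n)).
  move=> m n mn; rewrite (D_mean _ _ mn); exact: pnorm_flow_mean.
have D_C n : nrm (D n) <= C.
  rewrite pnorm_quotient// ger0_norm ?invr_ge0 ?(ltW (e_gt0 n))//.
  by rewrite ler_pdivrMl// mulrC uC.
have D_cvg : cvgn (fun n => nrm (D n)).
  by apply: nondecreasing_is_cvgn => //; exists C => _ [n _ <-].
pose K := limn (fun n => nrm (D n)).
have D_K n : nrm (D n) <= K by exact: nondecreasing_cvgn_le.
have K0 : 0 <= K by rewrite (le_trans _ (D_K 0%N))// pnorm_ge0.
apply: (Lfun_complete p1') => // e e0.
have [c c0 cP] := @pnorm_uniform_convexity _ _ _ mu p p1' K e p1 K0 e0.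
have c2 : 0 < c / 2 by rewrite divr_gt0.
have /cvgrPdist_le/(_ _ c2)[k _ /(_ k (leqnn k))] := D_cvg.
rewrite /= -/K ger0_norm ?subr_ge0// => kK.
have /cvgrPdist_le/(_ _ c0)[/= a a0 aP] := cvg_pnorm_flow flow_tau p1 (DL k).
have [N0 _ N0P] : \forall n \near \oo, e_ n < a.
  have : 2^-1 ^+ n @[n --> \oo] --> (0 : R).
    by apply: cvg_expr; rewrite ger0_norm// invf_lt1// ltr1n.
  move=> /cvgrPdist_lt/(_ _ a0); apply: filterS => n.
  by rewrite sub0r normrN ger0_norm ?exprn_ge0.
have main m n : (maxn N0 k <= m)%N -> (m <= n)%N ->
    nrm (fun x => D m x - D n x) <= e.
  rewrite geq_max => /andP[N0m km] mn.
  have kn : (k <= n)%N by exact: leq_trans mn.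
  apply: cP => //.
  set A := (2 ^ (n - k))%N; set B := (2 ^ (n - m))%N.
  (* The same mean acts on both quotients. It takes [D n] exactly to [D k]; and since [D m] is
     itself a mean of [D n] and means commute, it takes [D m] to a mean of [D k]. *)
  have E : flow_mean A (e_ n) (fun x => D m x + D n x) =
      fun x => flow_mean B (e_ n) (D k) x + D k x.
    apply/funext => x; rewrite flow_meanD -/A [in RHS](D_mean _ _ kn) -/A.
    by rewrite (D_mean _ _ mn) -/B flow_mean_exchange.
  have DmnL : (fun x => D m x + D n x) \in Lp by exact: LfunD.
  apply: le_trans (pnorm_flow_mean (e_ n) (pow2_gt0 (n - k)%N) DmnL).
  rewrite -/A E.
  have BL := Lfun_flow_mean B (e_ n) (DL k).
  (* The shifts in this mean are j e_n with j < B, hence smaller than B e_n = e_m < a, the range in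
     which [D k] moves by at most c. The shift j = 0 is separate because right neighbourhoods of 0
     exclude 0. *)
  have B_sub : nrm (fun x => flow_mean B (e_ n) (D k) x - D k x) <= c.
    apply: pnorm_flow_mean_sub => // [|[|j] jB]; first exact: pow2_gt0.
      by rewrite mulr0n pnorm_flow_diff0// ltW.
    have := aP (e_ n *+ j.+1); rewrite /= !sub0r !normrN !ger0_norm ?pnorm_ge0//; last first.
      by rewrite mulrn_wge0// ltW.
    apply; last by rewrite pmulrn_rgt0.
    apply: le_lt_trans (N0P m N0m); rewrite -(e_mul _ _ mn).
    by rewrite -!(mulr_natr (e_ n)) ler_wpM2l ?(ltW (e_gt0 n))// ler_nat ltnW.
  have D2L : (fun x => D k x + D k x) \in Lp by exact: LfunD.
  have DB2 : (fun x => flow_mean B (e_ n) (D k) x + D k x) \in Lp by exact: LfunD.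
  (* Accounting: 2 ||D k|| >= 2 (K - c/2), and replacing one copy of [D k] by its mean loses at most
     c, which leaves 2 (K - c). *)
  have := pnorm_lerB p1' D2L DB2.
  rewrite (_ : (fun x => D k x + D k x - _) = fun x => D k x - flow_mean B (e_ n) (D k) x); last first.
    by apply/funext => x; rewrite opprD addrACA subrr addr0.
  rewrite (_ : (fun x => D k x + D k x) = fun x => 2 * D k x); last first.
    by apply/funext => x; rewrite mulr_natl mulr2n.
  rewrite (pnormZ p1' 2 (DL k)) (ger0_norm (ler0n _ 2)) (pnorm_distC _ _ (D k)) => h1.
  have := le_trans (ler_norm _) h1; lra.
exists (maxn N0 k) => m n Nm Nn; have [mn|/ltnW nm] := leqP m n; first exact: main.
by rewrite pnorm_distC; exact: main.
Qed.

End flow_quotient.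

(** * The fractional energy of a flow *)

Section energy.
Variable R : realType.
Local Notation leb := (@lebesgue_measure R).

(** Reflection exchanges the two half-intervals; the point 0, which belongs to neither, is the
    exceptional null set. *)
Lemma ge0_integral_even (w : R -> \bar R) (delta : R) : 0 <= delta ->
  measurable_fun [set: R] w -> (forall h, 0 <= w h)%E ->
  (forall h, w (- h) = w h) ->
  (\int[leb]_(h in [set h : R | (`|h| <= delta)%R]) w h =
   2%:E * \int[leb]_(h in `]0%R, delta]) w h)%E.
Proof.
move=> d0 mw w0 weven.
pose v := w \_ (`]0, delta] : set R).
have mv : measurable_fun [set: R] v.
  apply/(measurable_restrictT w) => //; exact: measurable_funTS.
have v0 h : (0 <= v h)%E by rewrite /v /patch; case: ifP.
have mvN : measurable_fun [set: R] (fun h => v (- h)).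
  by apply: (measurableT_comp mv).
have mD : measurable [set h : R | `|h| <= delta].
  rewrite (_ : [set h | _] = `[- delta, delta]%classic)//.
  by apply/seteqP; split => h /=; rewrite in_itv/= ler_norml.
rewrite integral_mkcond [in RHS]integral_mkcond -/v.
have -> : (\int[leb]_h (w \_ [set h : R | (`|h| <= delta)%R]) h =
    \int[leb]_h (v h + v (- h)%R))%E.
  apply: ae_eq_integral => //.
  - by apply/(measurable_restrictT w) => //; exact: measurable_funTS.
  - exact: emeasurable_funD.
  exists [set 0]; split => //; first exact: lebesgue_measure_set1.
  move=> h /=; apply: contra_notP => /eqP h0 _.
  have memD : (h \in [set h : R | `|h| <= delta]) = (`|h| <= delta).
    by apply/idP/idP; rewrite inE.
  rewrite /v /patch memD !mem_setE !in_itv (_ : point = 0%E)//=.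
  case: (ltgtP h 0) h0 => // hlt _; rewrite ?oppr_gt0 ?oppr_lt0.
    by rewrite ltr0_norm// hlt/= weven add0e.
  by rewrite gtr0_norm// [in X in (_ + X)%E]ltNge (ltW hlt)/= adde0.
rewrite ge0_integralD//.
rewrite [X in (_ + X)%E](@ge0_integral_invariant _ _ _ leb -%R v)//; last first.
  exact: lebesgue_measureN.
by rewrite (_ : 2%:E = 1 + 1)%E// ge0_muleDl ?mul1e// integral_ge0.
Qed.

(** The integrand may blow up at 0, so the fundamental theorem is applied on compact intervals
    exhausting ]0, delta], followed by monotone convergence. The offset [n.+2] keeps the left
    endpoint strictly below delta. *)
Lemma integral_powR (a delta : R) : 0 < a -> 0 < delta ->
  (\int[leb]_(h in `]0%R, delta]) (h `^ (a - 1))%:E = (delta `^ a / a)%:E)%E.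
Proof.
move=> a0 d0.
pose F n : set R := `[delta / n.+2%:R, delta]%classic.
have dn n : 0 < delta / n.+2%:R by rewrite divr_gt0.
have dn1 n : delta / n.+2%:R < delta by rewrite ltr_pdivrMr// ltr_pMr// ltr1n.
have FU : \bigcup_n F n = `]0, delta]%classic.
  apply/seteqP; split => [h [n _]|h]; rewrite /F /= !in_itv/=.
    by move=> /andP[nh ->]; rewrite (lt_le_trans _ nh).
  move=> /andP[h0 hd]; exists (Num.truncn (delta / h)) => //=.
  rewrite in_itv/= hd andbT ler_pdivrMr// mulrC -ler_pdivrMr//.
  have /andP[_ /ltW h1] := truncn_itv (divr_ge0 (ltW d0) (ltW h0)).
  by rewrite (le_trans h1)// ler_nat.
have mpow : measurable_fun [set: R] (fun h : R => (h `^ (a - 1))%:E).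
  by apply/measurable_EFinP; exact: measurable_powR.
have Fnd : nondecreasing_seq F.
  move=> m n mn; apply/subsetPset => h; rewrite /F /= !in_itv/= => /andP[mh ->].
  by rewrite andbT (le_trans _ mh)// ler_pM2l// lef_pV2 ?posrE// ler_nat.
have := @ge0_nondecreasing_set_cvg_integral _ (measurableTypeR R) R F
  (fun h : R => (h `^ (a - 1))%:E) leb
  Fnd (fun=> measurable_itv _) (fun i => measurable_funTS mpow).
rewrite FU => /(_ (fun _ _ _ => powR_ge0 _ _)).
under eq_cvg => n.
  rewrite (@continuous_FTC2 _ (fun h => h `^ (a - 1)) (fun h => h `^ a / a))//; last 3 first.
  - apply: continuous_in_subspaceT => h; rewrite inE/= in_itv/= => /andP[nh _].
    apply/differentiable_continuous/derivable1_diffP/derivable_powR.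
    by rewrite in_itv/= andbT (lt_le_trans _ nh).
  - have der h : 0 < h -> derivable (fun h => h `^ a / a) h 1.
      move=> h0; apply: derivableM => //; apply: derivable_powR.
      by rewrite in_itv/= andbT.
    split.
    + move=> h; rewrite in_itv/= => /andP[nh _]; apply: der; exact: lt_trans nh.
    + have /derivable1_diffP/differentiable_continuous := der _ (dn n).
      exact: cvg_at_right_filter.
    + have /derivable1_diffP/differentiable_continuous := der _ d0.
      exact: cvg_at_left_filter.
  - move=> h; rewrite in_itv/= => /andP[nh _].
    have h0 : 0 < h by exact: lt_trans nh.
    rewrite derive1E deriveM//=; last first.
      by apply: derivable_powR; rewrite in_itv/= andbT.
    rewrite derive_cst scaler0 add0r -derive1E powR_derive1 ?in_itv/= ?andbT//.
    by rewrite /GRing.scale/= mulrA mulVf ?mul1r// gt_eqF.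
  over.
move=> /(@cvg_unique _ (@ereal_hausdorff R)); apply.
suff H : (delta `^ a / a - (delta / n.+2%:R) `^ a / a) @[n --> \oo] --> delta `^ a / a - 0.
  by rewrite subr0 in H; apply/cvg_EFin; [exact: nearW|exact: H].
apply: cvgB; first exact: cvg_cst.
rewrite -[X in _ --> X](_ : `|0 : R| `^ a / a = 0); last first.
  by rewrite normr0 powR0 ?gt_eqF// mul0r.
have : (fun n : nat => delta / n.+2%:R) n @[n --> \oo] --> (0 : R).
  rewrite -[X in _ --> X](mulr0 delta); apply: cvgM; first exact: cvg_cst.
  by have := @cvg_harmonic R; rewrite -cvg_shiftS.
move=> dcvg; apply: cvgM; last exact: cvg_cst.
have := @cvg_comp _ _ _ _ _ _ _ _ dcvg (@normr_powR_continuous R a a0 0).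
apply: cvg_trans; apply: near_eq_cvg; apply: nearW => n /=.
by rewrite ger0_norm// ltW.
Qed.

End energy.

Section flow_energy.
Context d (T : measurableType d) (R : realType).
Variables (mu : {sigma_finite_measure set T -> \bar R}) (tau : R -> T -> T).
Hypothesis flow_tau : measure_flow mu tau.
Variables p s : R.
Hypotheses (p1 : 1 < p) (s1 : s < 1).
Local Notation leb := (@lebesgue_measure R).
Local Notation Lp := (Lfun mu p%:E).
Local Notation nrm := (pnorm mu p).
Local Notation a := (p * (1 - s)).

Let p1' : 1 <= p. Proof. exact: ltW. Qed.
Let p0 : 0 < p. Proof. exact: lt_trans p1. Qed.
Let a0 : 0 < a. Proof. by rewrite mulr_gt0// subr_gt0. Qed.

Definition flow_energy (delta : R) (u : T -> R) : \bar R :=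
  (\int[mu]_x \int[leb]_(h in [set h : R | (`|h| <= delta)%R])
     (`|u (tau h x) - u x| `^ p / `|h| `^ (1 + s * p))%:E)%E.

(** Fubini puts the integral over h outside. The inner integral is even in h, since u o tau_(-h) - u
    composed with tau_h is u - u o tau_h. Passing to quotients contributes h^p, and p - (1 + s p) =
    p (1 - s) - 1. *)
Lemma flow_energyE delta u : 0 < delta -> u \in Lp ->
  (flow_energy delta u = 2%:E * \int[leb]_(h in `]0%R, delta])
    (nrm (quotient tau h u) `^ p * h `^ (a - 1))%:E)%E.
Proof.
move=> d0 uL; have mu_ := Lfun_measurable p1' uL.
have dL h : (fun x => u (tau h x) - u x) \in Lp.
  by apply: LfunB => //; exact: (Lfun_flow flow_tau p1 h uL).1.
pose k (z : T * R) := (`|u (tau z.2 z.1) - u z.1| `^ p / `|z.2| `^ (1 + s * p))%:E.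
have mk : measurable_fun [set: T * R] k.
  apply/measurable_EFinP; apply: measurable_funM.
    apply/measurable_EFinP; apply: measurable_normr_powR => //.
    apply: measurable_funB; first exact: (measurable_flow_comp flow_tau).
    exact: (measurableT_comp mu_).
  under eq_fun do rewrite -powRN.
  apply: (@measurableT_comp _ _ _ _ _ _ (@powR R ^~ (- (1 + s * p)))) => //.
  exact: measurableT_comp.
have k0 z : (0 <= k z)%E by rewrite lee_fin divr_ge0// powR_ge0.
have mD : measurable [set h : R | `|h| <= delta].
  rewrite (_ : [set h | _] = `[- delta, delta]%classic)//.
  by apply/seteqP; split => h /=; rewrite in_itv/= ler_norml.
rewrite /flow_energy (ge0_fubini_restrict mu leb mD mk k0).
pose w h := (\int[mu]_x k (x, h))%E.
have wE h : w h = (nrm (fun x => u (tau h x) - u x) `^ p / `|h| `^ (1 + s * p))%:E.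
  rewrite /w /k/=; under eq_integral do rewrite mulrC EFinM.
  rewrite ge0_integralZl ?lee_fin ?invr_ge0 ?powR_ge0//; last first.
    exact: measurable_normr_powR (Lfun_measurable p1' (dL h)).
  by rewrite integral_pnorm// -EFinM mulrC.
have weven h : w (- h) = w h.
  rewrite !wE normrN; congr (_ `^ _ / _)%:E.
  rewrite -(Lfun_flow flow_tau p1 h (dL (- h))).2 pnorm_distC; congr pnorm.
  by apply/funext => x; rewrite -(flowD flow_tau) addNr (flow0 flow_tau).
rewrite (ge0_integral_even (w := w) (ltW d0))//; last 2 first.
- exact: (measurable_fun_fubini_tonelli_G k mk k0).
- by move=> h; exact: integral_ge0.
congr (_ * _)%E; apply: eq_integral => h; rewrite inE/= in_itv/= => /andP[h0 _].
rewrite wE (pnorm_quotient flow_tau p1)// (ger0_norm (ltW h0)).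
rewrite ger0_norm ?invr_ge0 ?(ltW h0)// powRM ?pnorm_ge0 ?invr_ge0 ?(ltW h0)//.
have hV : h^-1 `^ p = h `^ (- p) by rewrite -powR_inv1 ?(ltW h0)// -powRrM mulN1r.
rewrite hV mulrAC -powRN -powRD ?(gt_eqF h0) ?implybT//.
congr (_ %:E); rewrite mulrC; congr (_ `^ _ * _); ring.
Qed.

Lemma measurable_pnorm_quotient (u : T -> R) (D : set R) : u \in Lp ->
  D `<=` [set h | 0 < h] -> measurable D ->
  measurable_fun D (fun h => (nrm (quotient tau h u) `^ p * h `^ (a - 1))%:E).
Proof.
move=> uL D0 mD; have mu_ := Lfun_measurable p1' uL.
have dL h : (fun x => u (tau h x) - u x) \in Lp.
  by apply: LfunB => //; exact: (Lfun_flow flow_tau p1 h uL).1.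
pose k (z : T * R) := (`|u (tau z.2 z.1) - u z.1| `^ p)%:E.
have mk : measurable_fun [set: T * R] k.
  apply: measurable_normr_powR => //.
  apply: measurable_funB; first exact: (measurable_flow_comp flow_tau).
  exact: (measurableT_comp mu_).
have k0 z : (0 <= k z)%E by rewrite lee_fin powR_ge0.
apply: (@eq_measurable_fun _ _ _ _ D (fun h =>
    (\int[mu]_x k (x, h))%E * (h `^ (- p) * h `^ (a - 1))%:E)%E).
  move=> h /set_mem /D0 /= h0.
  rewrite /k/= integral_pnorm// -EFinM mulrCA mulrA; congr (_ * _)%:E.
  rewrite (pnorm_quotient flow_tau p1)// ger0_norm ?invr_ge0 ?(ltW h0)//.
  rewrite powRM ?pnorm_ge0 ?invr_ge0 ?(ltW h0)//; congr (_ * _).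
  by rewrite -powR_inv1 ?(ltW h0)// -powRrM mulN1r.
apply: emeasurable_funM.
  apply: measurable_funTS.
  exact: (measurable_fun_fubini_tonelli_G k mk k0).
apply/measurable_EFinP; apply: measurable_funTS; apply: measurable_funM;
  exact: measurable_powR.
Qed.

Lemma flow_energy_ge delta u c : 0 < delta -> u \in Lp ->
  (forall h, 0 < h <= delta -> c <= nrm (quotient tau h u) `^ p) ->
  ((2 / a * c)%:E <= (delta `^ a)^-1%:E * flow_energy delta u)%E.
Proof.
move=> d0 uL cP.
have [c0|/ltW c0] := leP 0 c; last first.
  apply: (@le_trans _ _ 0%E).
    by rewrite lee_fin mulr_ge0_le0// divr_ge0// ltW.
  rewrite mule_ge0 ?lee_fin ?invr_ge0 ?powR_ge0//.
  apply: integral_ge0 => x _; apply: integral_ge0 => h _.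
  by rewrite lee_fin divr_ge0 ?powR_ge0.
have -> : (2 / a * c)%:E = ((delta `^ a)^-1%:E * (2%:E * (c%:E * (delta `^ a / a)%:E)))%E.
  rewrite -!EFinM; congr EFin; field.
  by rewrite !gt_eqF// ?powR_gt0// subr_gt0.
rewrite flow_energyE//.
apply: lee_wpmul2l; rewrite ?lee_fin ?invr_ge0 ?powR_ge0//.
apply: lee_wpmul2l; rewrite ?lee_fin//.
rewrite -(integral_powR a0 d0) -ge0_integralZl//; last 2 first.
- by apply/measurable_EFinP; apply: measurable_funTS; exact: measurable_powR.
- by move=> h _; rewrite lee_fin powR_ge0.
apply: ge0_le_integral => //.
- by move=> h _; rewrite -EFinM lee_fin mulr_ge0 ?powR_ge0.
- apply: measurable_funeM; apply/measurable_EFinP; apply: measurable_funTS.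
  exact: measurable_powR.
- apply: measurable_pnorm_quotient => // h /=; rewrite in_itv/=.
  by case/andP.
- move=> h /=; rewrite in_itv/= => hd.
  by rewrite -EFinM lee_fin ler_wpM2r ?powR_ge0 ?cP.
Qed.

Lemma flow_energy_le delta u c : 0 < delta -> u \in Lp ->
  (forall h, 0 < h <= delta -> nrm (quotient tau h u) `^ p <= c) ->
  ((delta `^ a)^-1%:E * flow_energy delta u <= (2 / a * c)%:E)%E.
Proof.
move=> d0 uL cP.
have c0 : 0 <= c by apply: (le_trans _ (cP delta _)); rewrite ?powR_ge0 ?d0 ?lexx.
have -> : (2 / a * c)%:E = ((delta `^ a)^-1%:E * (2%:E * (c%:E * (delta `^ a / a)%:E)))%E.
  rewrite -!EFinM; congr EFin; field.
  by rewrite !gt_eqF// ?powR_gt0// subr_gt0.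
rewrite flow_energyE//.
apply: lee_wpmul2l; rewrite ?lee_fin ?invr_ge0 ?powR_ge0//.
apply: lee_wpmul2l; rewrite ?lee_fin//.
rewrite -(integral_powR a0 d0) -ge0_integralZl//; last 2 first.
- by apply/measurable_EFinP; apply: measurable_funTS; exact: measurable_powR.
- by move=> h _; rewrite lee_fin powR_ge0.
apply: ge0_le_integral => //.
- by move=> h _; rewrite lee_fin mulr_ge0 ?powR_ge0.
- apply: measurable_pnorm_quotient => // h /=; rewrite in_itv/=.
  by case/andP.
- apply: measurable_funeM; apply/measurable_EFinP; apply: measurable_funTS.
  exact: measurable_powR.
- move=> h /=; rewrite in_itv/= => hd.
  by rewrite -EFinM lee_fin ler_wpM2r ?powR_ge0 ?cP.
Qed.

(** The normalized energy is 2/a times an average of the p-th powers of the norms over ]0, delta],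
    hence squeezed between 2/a times l^p - e and l^p + e. *)
Lemma cvg_flow_energy u l : u \in Lp ->
  nrm (quotient tau h u) @[h --> 0^'+] --> (l : R) -> 0 <= l ->
  ((delta `^ a)^-1%:E * flow_energy delta u)%E @[delta --> 0^'+] -->
  (2 / a * l `^ p)%:E.
Proof.
move=> uL ul l0.
have ulp : nrm (quotient tau h u) `^ p @[h --> 0^'+] --> l `^ p.
  have cl : `|x| `^ p @[x --> l] --> `|l| `^ p := @normr_powR_continuous R p p0 l.
  rewrite (ger0_norm l0) in cl.
  have := @cvg_comp _ _ _ _ _ _ _ _ ul cl; apply: cvg_trans.
  apply: near_eq_cvg; apply: nearW => h /=.
  by rewrite ger0_norm// pnorm_ge0.
have bounds e : 0 < e -> \forall delta \near 0^'+,
    ((2 / a * (l `^ p - e))%:E <= (delta `^ a)^-1%:E * flow_energy delta u)%E /\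
    ((delta `^ a)^-1%:E * flow_energy delta u <= (2 / a * (l `^ p + e))%:E)%E.
  move=> e0; have /cvgrPdist_le/(_ _ e0)[b /= b0 bP] := ulp.
  exists b => // delta /=; rewrite sub0r normrN => db d0.
  rewrite ger0_norm ?(ltW d0)// in db.
  have hP h : 0 < h <= delta -> `|l `^ p - nrm (quotient tau h u) `^ p| <= e.
    move=> /andP[h0 hd]; apply: bP => //=.
    by rewrite sub0r normrN ger0_norm ?(ltW h0)// (le_lt_trans hd).
  split; [apply: flow_energy_ge => //|apply: flow_energy_le => //] => h hd;
    have := hP h hd; rewrite ler_norml => /andP[? ?]; lra.
have E0 delta : (0 <= (delta `^ a)^-1%:E * flow_energy delta u)%E.
  rewrite mule_ge0 ?lee_fin ?invr_ge0 ?powR_ge0//.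
  apply: integral_ge0 => x _; apply: integral_ge0 => h _.
  by rewrite lee_fin divr_ge0 ?powR_ge0.
apply/fine_cvgP; split.
  have := bounds 1 ltr01; apply: filterS => delta [_ le].
  by rewrite ge0_fin_numE// (le_lt_trans le)// ltry.
apply/cvgrPdist_le => e e0 /=.
have e1 : 0 < e * a / 2 by rewrite !divr_gt0 ?mulr_gt0// subr_gt0.
have a2 : 2 / a * (e * a / 2) = e.
  by field; rewrite !gt_eqF// subr_gt0.
apply: filterS (bounds _ e1) => delta [ge le].
have fin : ((delta `^ a)^-1%:E * flow_energy delta u)%E \is a fin_num.
  by rewrite ge0_fin_numE// (le_lt_trans le)// ltry.
move: ge le; rewrite -(fineK fin) !lee_fin (mulrBr (2 / a)) (mulrDr (2 / a)) a2 /= => ge le.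
by rewrite ler_norml; apply/andP; split; lra.
Qed.

Lemma cvgy_flow_energy u : u \in Lp ->
  (forall M, exists2 b, 0 < b & forall h, 0 < h < b -> M <= nrm (quotient tau h u)) ->
  ((delta `^ a)^-1%:E * flow_energy delta u)%E @[delta --> 0^'+] --> +oo%E.
Proof.
move=> uL uM; apply/cvgeyPge => A.
pose M := (`|A| * a / 2) `^ p^-1.
have [b b0 bP] := uM M.
exists b => // delta /=; rewrite sub0r normrN => db d0.
rewrite ger0_norm ?(ltW d0)// in db.
have AA : A <= 2 / a * (`|A| * a / 2).
  have -> : 2 / a * (`|A| * a / 2) = `|A|.
    by field; rewrite !gt_eqF// subr_gt0.
  exact: ler_norm.
apply: (@le_trans _ _ (2 / a * (`|A| * a / 2))%:E); first by rewrite lee_fin.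
apply: flow_energy_ge => // h /andP[h0 hd].
have -> : `|A| * a / 2 = M `^ p.
  rewrite /M -powRrM mulVf ?gt_eqF// powRr1//.
  by rewrite divr_ge0// mulr_ge0// ltW.
by rewrite ge0_ler_powR ?nnegrE ?powR_ge0 ?pnorm_ge0 ?(ltW p0)// bP// h0 (le_lt_trans hd).
Qed.

End flow_energy.

(** * Lebesgue measure on R^N *)

Section lebesgue_rV_theory.
Variable R : realType.
Local Notation leb := (@lebesgue_measure R).

Lemma measurable_rV_box n (A : 'I_n -> set R) : (forall i, measurable (A i)) ->
  measurable [set x : 'rV[R]_n | forall i, A i (x ord0 i)].
Proof.
move=> mA.
rewrite (_ : [set x | _] = \bigcap_(i in [set: 'I_n]) (coord_rV i @^-1` A i)).
  apply: fin_bigcap_measurable => // i _.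
  rewrite -[X in measurable X]setTI.
  exact: measurable_coord_rV.
by apply/seteqP; split => x Ax i; [move=> _|]; exact: Ax.
Qed.

Definition rV_cube n (k : nat) : set 'rV[R]_n :=
  [set x | forall i, `[- k%:R, k%:R]%classic (x ord0 i)].

Lemma rV_cubeP n k (x : 'rV[R]_n) :
  rV_cube k x <-> forall i, `|x ord0 i| <= k%:R.
Proof. by split => kx i; have := kx i; rewrite /= in_itv/= ler_norml. Qed.

Lemma measurable_rV_cube n k : measurable (@rV_cube n k).
Proof.
by apply: (@measurable_rV_box n (fun _ => `[- k%:R, k%:R]%classic)) => i.
Qed.

Lemma rV_cube_cover n : \bigcup_k (@rV_cube n k) = setT.
Proof.
apply/seteqP; split => // x _.
have [k xk] : exists k : nat, forall i, `|x ord0 i| <= k%:R.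
  exists (\sum_i (Num.truncn `|x ord0 i|).+1)%N => i.
  have /andP[_ /ltW xi] := truncn_itv (normr_ge0 (x ord0 i)).
  by rewrite (le_trans xi)// ler_nat (bigD1 i)//= leq_addr.
by exists k => //; exact/rV_cubeP.
Qed.

Lemma lebesgue_rV_cube_lty n k : (lebesgue_rV R n (rV_cube k) < +oo)%E.
Proof.
elim: n => [|n IH]; first by rewrite /= diracE; case: (_ \in _); rewrite ltry.
rewrite /= /snoc_measure /pushforward.
rewrite (_ : snoc_rV @^-1` _ = rV_cube k `*` `[- k%:R, k%:R]%classic); last first.
  apply/seteqP; split => [[y t]|[y t] [/= yk tk]] /=.
    move=> kz; split => /=.
      move=> i; have := kz (lift ord_max i).
      by rewrite /snoc_rV mxE liftK.
    by have := kz ord_max; rewrite /snoc_rV mxE unlift_none.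
  move=> i; rewrite /snoc_rV mxE; case: unliftP => [j _|_] //=.
  exact: yk.
have := @product_measure1E _ _ _ _ R (lebesgue_rV R n) leb _ _
  (@measurable_rV_cube n k) (measurable_itv `[(- k%:R)%R, k%:R]).
move=> ->; rewrite [X in (_ * X)%E]lebesgue_measure_itv/=.
case: ifP => _; last by rewrite mule0 ltry.
by rewrite -EFinD muleC lte_mul_pinfty// lee_fin opprK addr_ge0.
Qed.

Lemma sigma_finite_lebesgue_rV n : sigma_finite setT (lebesgue_rV R n).
Proof.
exists (@rV_cube n) => [|k]; first by rewrite rV_cube_cover.
by split; [exact: measurable_rV_cube|exact: lebesgue_rV_cube_lty].
Qed.

End lebesgue_rV_theory.

(** An alias convertible with [lebesgue_rV], serving as a head constant on which the sigma-finite
    structure is declared. *)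
Definition sigma_finite_rV (R : realType) n : set 'rV[R]_n -> \bar R :=
  lebesgue_rV R n.
Arguments sigma_finite_rV : clear implicits.

HB.instance Definition _ R n := Measure.copy (sigma_finite_rV R n)
  (lebesgue_rV R n : set 'rV[R]_n -> \bar R).

HB.instance Definition _ R n := @Measure_isSigmaFinite.Build _ _ _
  (sigma_finite_rV R n) (@sigma_finite_lebesgue_rV R n).

Section translation_rV.
Variable R : realType.
Local Notation leb := (@lebesgue_measure R).

Lemma measurable_shift_rV n (v : 'rV[R]_n) :
  measurable_fun [set: 'rV[R]_n] (fun x => x + v).
Proof.
apply: measurable_fun_rVP => i; under eq_fun do rewrite mxE.
by apply: measurable_funD => //; exact: measurable_coord_rV.
Qed.

(** Induction on the dimension by slicing: the last coordinate is handled by invariance on the line,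
    the others by the induction hypothesis applied to the measure of the slices. *)
Lemma lebesgue_rV_shift n (v : 'rV[R]_n) (A : set 'rV[R]_n) : measurable A ->
  lebesgue_rV R n ((fun x => x + v) @^-1` A) = lebesgue_rV R n A.
Proof.
elim: n => [|n IH] in v A * => mA.
  rewrite (_ : (fun x => x + v) = id)//.
  by apply/funext => x; rewrite (thinmx0 v) addr0.
pose C := @snoc_rV R n @^-1` A.
have mC : measurable C.
  by rewrite -[X in measurable X]setTI; exact: measurable_snoc_rV.
pose v' : 'rV[R]_n := \row_j v ord0 (lift ord_max j).
pose a := v ord0 ord_max.
have E y t : snoc_rV (y, t) + v = snoc_rV (y + v', t + a).
  apply/rowP => j; rewrite !mxE /=; case: unliftP => [k ->|->] /=.
    by rewrite !mxE.
  by [].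
rewrite /= /snoc_measure /pushforward /= /product_measure1.
transitivity (\int[lebesgue_rV R n]_y leb (xsection C (y + v')%R))%E.
  apply: eq_integral => y _.
  rewrite /= (_ : xsection (snoc_rV @^-1` _) y = (fun t => t + a) @^-1` (xsection C (y + v'))).
    by apply: lebesgue_measure_shift; exact: measurable_xsection.
  apply/seteqP; split => t; rewrite /xsection/= !inE /C /=; by rewrite E.
rewrite (@ge0_integral_invariant _ _ _ (lebesgue_rV R n) (fun y => y + v')
  (fun y => leb (xsection C y)))//.
- exact: measurable_shift_rV.
- by move=> B mB; exact: IH.
- exact: measurable_fun_xsection.
Qed.

Definition rV_flow n (i : 'I_n) (t : R) (x : 'rV[R]_n) : 'rV[R]_n :=
  x + t *: canonical_vector i.

Lemma measure_flow_rV n (i : 'I_n) : measure_flow (sigma_finite_rV R n) (rV_flow i).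
Proof.
split.
- by move=> x; rewrite /rV_flow scale0r addr0.
- by move=> s t x; rewrite /rV_flow scalerDl addrA addrAC.
- apply: measurable_fun_rVP => j; rewrite /rV_flow.
  under eq_fun do rewrite !mxE.
  apply: measurable_funD; last exact: measurable_funM.
  exact: (measurableT_comp (measurable_coord_rV j)).
- by move=> t A mA; exact: lebesgue_rV_shift.
Qed.

(** The sigma-algebra is generated by coordinates, so an open set has to be written as a countable
    union of cubes with rational centres. *)
Lemma open_measurable_rV n (A : set 'rV[R]_n) : open A -> measurable A.
Proof.
move=> oA.
pose B (z : 'rV[rat]_n * nat) : set 'rV[R]_n := [set x | forall i,
   `](ratr (z.1 ord0 i) - z.2.+1%:R^-1), (ratr (z.1 ord0 i) + z.2.+1%:R^-1)[%classic (x ord0 i)].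
have mB z : measurable (B z).
  apply: (@measurable_rV_box R n (fun i => `](ratr (z.1 ord0 i) - z.2.+1%:R^-1),
    (ratr (z.1 ord0 i) + z.2.+1%:R^-1)[%classic)) => i; exact: measurable_itv.
rewrite (_ : A = \bigcup_(z in [set z | B z `<=` A]) B z).
  rewrite bigcup_mkcond; apply: countable_bigcupT_measurable => [|z].
    exact: countableP.
  by case: ifP.
apply/seteqP; split => [x Ax|x [z zA]]; last exact: zA.
have /nbhs_ballP[e /= e0 eA] : nbhs x A by exact: open_nbhs_nbhs.
(* The factor 2 adds the distance from x to the rational centre and that from the centre to another
   point of the cube. *)
have [k ke] : exists k : nat, 2 * k.+1%:R^-1 < e.
  exists (Num.truncn (2 / e)); rewrite -ltr_pdivlMl// invf_plt ?posrE ?mulr_gt0 ?invr_gt0//.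
  rewrite invfM invrK.
  by have /andP[_] := truncn_itv (divr_ge0 (ler0n R 2) (ltW e0)).
have qx (j : 'I_n) : exists q : rat, `|x ord0 j - ratr q| < k.+1%:R^-1.
  have [|q] := @rat_in_itvoo R (x ord0 j - k.+1%:R^-1) (x ord0 j + k.+1%:R^-1).
    by rewrite ltrBlDr -addrA ltrDl addr_gt0// invr_gt0.
  rewrite in_itv/= => qj; exists q.
  by rewrite distrC ltr_distl.
have [q qP] := choice qx.
exists (\row_j q j, k) => /=.
  move=> y yB; apply: eA; split => // i j; rewrite (ord1 i) /ball/=.
  have := yB j; rewrite /= in_itv/= mxE -ltr_distl => yq.
  rewrite (le_lt_trans (ler_distD (ratr (q j)) _ _))//.
  by rewrite (lt_trans _ ke)// mulr2n mulrDl !mul1r ltrD// distrC.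
move=> i; rewrite /= in_itv/= mxE -ltr_distl; exact: qP.
Qed.

Lemma continuous_measurable_rV n (f : 'rV[R]_n -> R) : continuous f ->
  measurable_fun [set: 'rV[R]_n] f.
Proof.
move=> /continuousP cf; apply: (measurability _ (RGenOpens.measurableE R)).
move=> _ [_ [a [b ->] <-]]; rewrite setTI; apply: open_measurable_rV.
exact/cf/interval_open.
Qed.

End translation_rV.

(** * Bump functions and the fundamental lemma *)

Section flat_function.
Variable R : realType.

(* The family [flat m], m : nat, is closed under differentiation up to linear
   combinations, all of whose members vanish to infinite order at 0+. *)
Definition flat (m : nat) (x : R) : R :=
  if 0 < x then x^-1 ^+ m * expR (- x^-1) else 0.

Lemma flat_ge0 m x : 0 <= flat m x.
Proof.
rewrite /flat; case: ifP => // x0.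
by rewrite mulr_ge0 ?expR_ge0// exprn_ge0// invr_ge0 ltW.
Qed.

(** Comparison of exp(1/x) with the term of order m + 2 of its series. Two orders beyond m leave the
    factor x^2, so the difference quotient at 0 is at most (m+2)! x and tends to 0. *)
Lemma flat_le m x : 0 < x -> flat m x <= (m.+2)`!%:R * x ^+ 2.
Proof.
move=> x0; rewrite /flat x0.
have y0 : 0 < x^-1 by rewrite invr_gt0.
have : x^-1 ^+ m.+2 / (m.+2)`!%:R <= expR x^-1.
  by apply: le_trans (expR_ge1Dxn m.+1 (ltW y0)); rewrite lerDr.
rewrite ler_pdivrMr ?ltr0n ?fact_gt0// => h.
rewrite expRN ler_pdivrMr ?expR_gt0//.
rewrite -(ler_pM2r (exprn_gt0 2 y0)) -exprD addn2 (le_trans h)//.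
rewrite [leRHS](_ : _ = expR x^-1 * (m.+2)`!%:R)//.
by move: (expR _) => e; field; rewrite gt_eqF.
Qed.

Lemma is_derive_flat m (x : R) :
  is_derive x 1 (flat m) (flat m.+2 x - m%:R * flat m.+1 x).
Proof.
have [x0|x0|->] := ltgtP x 0.
- have fE k : flat k x = 0 by rewrite /flat ltNge (ltW x0).
  rewrite !fE mulr0 subr0.
  apply: (@near_eq_is_derive R R R (cst 0)).
  near=> y; rewrite /flat ltNge ifF//; apply/negbTE; rewrite negbK.
  by apply/ltW; near: y; exact: lt_nbhsl.
- have fE k : flat k x = x^-1 ^+ k * expR (- x^-1) by rewrite /flat x0.
  rewrite !fE.
  apply: (@near_eq_is_derive R R R (fun x => x^-1 ^+ m * expR (- x^-1))).
    by near=> y; rewrite /flat ifT//; near: y; exact: lt_nbhsr.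
  have xV := @is_deriveV R id x 1 1 (lt0r_neq0 x0) (is_derive_id x 1).
  have dN : is_derive x 1 (fun x => - x^-1) (x ^- 2).
    by have := is_deriveN xV; rewrite /GRing.scale/= mulr1 opprK.
  have dE := @is_derive1_comp R expR (fun x => - x^-1) x _ _ (is_derive_expR _) dN.
  have := is_deriveM (is_deriveX m xV) dE.
  rewrite exprfctE mulrfctE => H; apply: (is_derive_eq H).
  rewrite /GRing.scale/= mulr1; case: m {fE H} => [|m].
    move: (expR _) => e.
    rewrite !mul0r !mulr0 addr0 subr0 !expr0 !exprS expr0; field.
    by rewrite gt_eqF.
  move: (expR _) => e; rewrite !exprS; move: (_ ^+ m) => f; field.
  by rewrite gt_eqF.
- have fE k : flat k 0 = 0 by rewrite /flat ltxx.
  rewrite !fE mulr0 subr0.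
  have H : (fun h : R => h^-1 *: ((flat m \o shift 0) (h *: 1) - flat m 0)) @ 0^' --> (0 : R).
    apply/cvgrPdist_le => e e0.
    have d0 : 0 < e / (m.+2)`!%:R by rewrite divr_gt0// ltr0n fact_gt0.
    near=> h; rewrite /= sub0r normrN fE subr0 addr0 /GRing.scale/= mulr1.
    have [h0|h0] := ltP 0 h; last first.
      by rewrite /flat ltNge h0/= mulr0 normr0 ltW.
    rewrite ger0_norm ?mulr_ge0 ?flat_ge0 ?invr_ge0 ?(ltW h0)//.
    rewrite mulrC ler_pdivrMr// (le_trans (flat_le m h0))//.
    rewrite expr2 mulrA ler_wpM2r ?(ltW h0)// mulrC.
    rewrite -ler_pdivlMr ?ltr0n ?fact_gt0// (le_trans (ler_norm h))//.
    by near: h; exact: dnbhs0_le.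
  by split; [apply/cvg_ex; exists 0|apply/cvg_lim].
Unshelve. all: by end_near. Qed.

Lemma continuous_flat m : continuous (flat m).
Proof.
move=> x; apply/differentiable_continuous/derivable1_diffP.
exact: (@ex_derive _ _ _ _ _ _ _ (is_derive_flat m x)).
Qed.

End flat_function.

Section flat_algebra.
Variables (R : realType) (n : nat).
Implicit Types f g phi : 'rV[R]_n -> R.

(** An inductive predicate, so that closure under partial derivatives is an induction and smoothness
    of the bumps follows without computing any iterated derivative. *)
Inductive flat_algebra : ('rV[R]_n -> R) -> Prop :=
| flat_algebra_gen m c a j : flat_algebra (fun x => flat m (c * (x ord0 j - a)))
| flat_algebra_cst c : flat_algebra (fun=> c)
| flat_algebraD f g : flat_algebra f -> flat_algebra g ->
    flat_algebra (fun x => f x + g x)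
| flat_algebraM f g : flat_algebra f -> flat_algebra g ->
    flat_algebra (fun x => f x * g x).

Lemma flat_algebra_shift v f : flat_algebra f -> flat_algebra (fun x => f (x + v)).
Proof.
elim=> {f} [m c a j|c|f g _ fS _ gS|f g _ fS _ gS].
- rewrite (_ : (fun x => _) = fun x : 'rV[R]_n => flat m (c * (x ord0 j - (a - v ord0 j)))).
    exact: flat_algebra_gen.
  by apply/funext => x; rewrite mxE opprB addrA addrAC.
- exact: flat_algebra_cst.
- exact: flat_algebraD.
- exact: flat_algebraM.
Qed.

Lemma flat_algebra_continuous f : flat_algebra f -> continuous f.
Proof.
elim=> {f} [m c a j|c|f g _ cf _ cg|f g _ cf _ cg] x.
- apply: (@continuous_comp _ _ _ (fun x : 'rV[R]_n => c * (x ord0 j - a)) (flat m)).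
    exact: (cvgM (cvg_cst c)
      (cvgB (@coord_continuous _ _ _ ord0 j x) (cvg_cst a))).
  exact: continuous_flat.
- exact: cst_continuous.
- exact: cvgD (cf x) (cg x).
- exact: cvgM (cf x) (cg x).
Qed.

Lemma is_derive_coord (F : R -> R) (i j : 'I_n) (x : 'rV[R]_n) dF :
  is_derive (x ord0 j) 1 F dF ->
  is_derive x (canonical_vector i) (fun x => F (x ord0 j)) ((i == j)%:R * dF).
Proof.
move=> [Fd <-].
have E : (fun h : R => h^-1 *: (((fun x : 'rV[R]_n => F (x ord0 j)) \o shift x)
      (h *: canonical_vector i) - F (x ord0 j))) =
    (fun h => (i == j)%:R * (h^-1 *: ((F \o shift (x ord0 j)) (h *: (1 : R)) - F (x ord0 j)))).
  apply/funext => h /=; rewrite !mxE eqxx/= [j == i]eq_sym.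
  case: (i == j) => /=; first by rewrite mul1r.
  by rewrite mulr0 add0r subrr scaler0 mul0r.
have H : (fun h : R => h^-1 *: (((fun x : 'rV[R]_n => F (x ord0 j)) \o shift x)
      (h *: canonical_vector i) - F (x ord0 j))) @ 0^' --> (i == j)%:R * 'D_1 F (x ord0 j).
  by rewrite E; apply: cvgM; [exact: cvg_cst|exact: Fd].
by split; [apply/cvg_ex; eexists; exact: H|exact/cvg_lim].
Qed.

Lemma flat_algebra_derive i f : flat_algebra f ->
  exists2 df, flat_algebra df &
    forall x, is_derive x (canonical_vector i) f (df x).
Proof.
elim=> {f} [m c a j|c|f g fA [df dfA fE] gA [dg dgA gE]
  |f g fA [df dfA fE] gA [dg dgA gE]].
- exists (fun x => (i == j)%:R * (c * (flat m.+2 (c * (x ord0 j - a)) +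
    - m%:R * flat m.+1 (c * (x ord0 j - a))))).
    do !(apply: flat_algebraM || apply: flat_algebraD ||
         apply: flat_algebra_gen || apply: flat_algebra_cst).
  move=> x; apply: (@is_derive_coord (fun t => flat m (c * (t - a)))).
  have dA : is_derive (x ord0 j) 1 (fun t : R => c * (t - a)) c.
    have := is_deriveZ c (is_deriveB (is_derive_id (x ord0 j) (1 : R))
      (is_derive_cst a (x ord0 j) (1 : R))).
    by rewrite subr0 /GRing.scale/= mulr1.
  have := @is_derive1_comp R (flat m) (fun t => c * (t - a)) _ _ _ (is_derive_flat m _) dA.
  by move=> H; apply: (is_derive_eq H); rewrite mulrC mulNr.
- exists (fun=> 0) => [|x]; first exact: flat_algebra_cst.
  exact: is_derive_cst.
- exists (fun x => df x + dg x) => [|x]; first exact: flat_algebraD.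
  exact: is_deriveD (fE x) (gE x).
- exists (fun x => f x * dg x + g x * df x) => [|x].
    by apply: flat_algebraD; exact: flat_algebraM.
  exact: is_deriveM (fE x) (gE x).
Qed.

Lemma flat_algebra_smooth f : flat_algebra f -> smooth f.
Proof.
move=> fA s.
have {fA} sA : flat_algebra (iter_partial s f).
  elim: s => //= i s IH; have [g gA gE] := flat_algebra_derive i IH.
  rewrite (_ : partial i _ = g)//.
  by apply/funext => x; exact: (@derive_val _ _ _ _ _ _ _ (gE x)).
split; first exact: flat_algebra_continuous.
move=> i x; have [g gA gE] := flat_algebra_derive i sA.
exact: (@ex_derive _ _ _ _ _ _ _ (gE x)).
Qed.

(** Each factor is exp(-1/(m y)) for y > 0 and m > 0, which tends to 1 as m grows. These smooth
    functions therefore approximate the indicator of the open box from within it. *)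
Definition box_bump (m : nat) (a b : 'I_n -> R) (x : 'rV[R]_n) : R :=
  \prod_j (flat 0 (m%:R * (x ord0 j - a j)) * flat 0 (m%:R * (b j - x ord0 j))).

Lemma flat_algebra_box_bump m a b : flat_algebra (box_bump m a b).
Proof.
rewrite /box_bump.
elim: (index_enum _) => [|j l IH].
  rewrite (_ : (fun x => _) = fun=> 1); first exact: flat_algebra_cst.
  by apply/funext => x; rewrite big_nil.
rewrite [X in flat_algebra X](_ : _ = (fun x : 'rV[R]_n => flat 0 (m%:R * (x ord0 j - a j)) *
  flat 0 (- m%:R * (x ord0 j - b j)) * \prod_(j <- l)
  (flat 0 (m%:R * (x ord0 j - a j)) * flat 0 (m%:R * (b j - x ord0 j))))).
  apply: flat_algebraM => //; apply: flat_algebraM; exact: flat_algebra_gen.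
by apply/funext => x; rewrite big_cons mulNr -mulrN opprB.
Qed.

Definition open_box (a b : 'I_n -> R) : set 'rV[R]_n :=
  [set x | forall j, `]a j, b j[%classic (x ord0 j)].

Lemma box_bump_ge0 m a b x : 0 <= box_bump m a b x.
Proof. by apply: prodr_ge0 => j _; rewrite mulr_ge0// flat_ge0. Qed.

Lemma flat0_le1 (x : R) : flat 0 x <= 1.
Proof.
rewrite /flat; case: ifP => // x0.
by rewrite expr0 mul1r expR_le1 oppr_le0 invr_ge0 ltW.
Qed.

Lemma box_bump_le1 m a b x : box_bump m a b x <= 1.
Proof.
apply: prodr_ile1 => j _; rewrite mulr_ge0 ?flat_ge0//=.
by rewrite mulr_ile1 ?flat_ge0 ?flat0_le1.
Qed.

Lemma box_bump_neq0 m a b x : box_bump m a b x != 0 -> open_box a b x.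
Proof.
move=> /prodf_neq0 /= H j; have := H j isT.
rewrite mulf_eq0 negb_or /flat /= in_itv/= => /andP[].
case: ifPn => [+ _|]; last by rewrite eqxx.
case: ifPn => [+ + _|]; last by rewrite eqxx.
have [->|m0] := eqVneq m 0%N; first by rewrite mul0r ltxx.
by rewrite !pmulr_rgt0 ?ltr0n ?lt0n// !subr_gt0 => -> ->.
Qed.

Lemma cvg_box_bump a b x : box_bump m a b x @[m --> \oo] --> (\1_(open_box a b) x : R).
Proof.
have [xab|xab] := pselect (open_box a b x); last first.
  rewrite indicE memNset//.
  rewrite (_ : (fun m => _) = fun=> 0); first exact: cvg_cst.
  by apply/funext => m; apply/eqP; apply: contra_notT xab; exact: box_bump_neq0.
rewrite indicE mem_set//=.
have flat1 y : 0 < y -> flat 0 (m%:R * y) @[m --> \oo] --> (1 : R).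
  move=> y0; rewrite -cvg_shiftS.
  rewrite (_ : (fun m => _) = fun m : nat => expR (- (m.+1%:R^-1 * y^-1))).
    have H : - (m.+1%:R^-1 * y^-1) @[m --> \oo] --> (- (0 * y^-1) : R).
      by apply: cvgN; apply: cvgMl; exact: cvg_harmonic.
    have := cvg_comp _ _ H (@continuous_expR R _).
    by rewrite mul0r oppr0 expR0.
  by apply/funext => m; rewrite /flat pmulr_rgt0// y0 expr0 mul1r invfM.
suff : box_bump m a b x @[m --> \oo] --> \prod_(j < n) (1 * 1 : R).
  by rewrite big1// => j _; rewrite mulr1.
apply: cvg_big => [|j _]; first exact: mul_continuous.
have := xab j; rewrite /= in_itv/= => /andP[aj bj].
by apply: cvgM; apply: flat1; rewrite subr_gt0.
Qed.

Lemma box_bump_compact m a b : compactly_supported (box_bump m a b).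
Proof.
pose K := [set x : 'rV[R]_n | forall j, `[a j, b j]%classic (x ord0 j)].
have cK : compact K
    by apply: (@rV_compact R n (fun j => `[a j, b j]%classic)) => j; exact: segment_compact.
apply: (subclosed_compact _ cK); first exact: closed_closure.
have /closure_id -> : closed K by apply: compact_closed cK; exact: norm_hausdorff.
apply: closure_subset => x /box_bump_neq0 xab j.
by apply: subset_itv_oo_cc; exact: xab.
Qed.

(** Translates are included because the weak derivative will be tested against a bump carried along
    the flow. *)
Lemma test_function_box_bump m a b v :
  test_function (fun x => box_bump m a b (x + v)).
Proof.
split.
  by apply/flat_algebra_smooth/flat_algebra_shift/flat_algebra_box_bump.
rewrite (_ : (fun x => _) = box_bump m (fun j => a j - v ord0 j) (fun j => b j - v ord0 j)).
  exact: box_bump_compact.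
apply/funext => x; apply: eq_bigr => j _; rewrite mxE opprB.
by rewrite opprD !addrA [b j - _ - _]addrAC.
Qed.

End flat_algebra.

(** * The fundamental lemma of the calculus of variations *)

Section fundamental_lemma.
Variables (R : realType) (n : nat).
Local Notation mu := (lebesgue_rV R n).

Lemma measurable_open_box (a b : 'I_n -> R) : measurable (open_box a b).
Proof.
by apply: (@measurable_rV_box R n (fun j => `]a j, b j[%classic)) => j;
  exact: measurable_itv.
Qed.

Lemma open_box_sub_cube (a b : 'I_n -> R) :
  exists k, open_box a b `<=` @rV_cube R n k.
Proof.
exists (\sum_j ((Num.truncn `|a j|).+1 + (Num.truncn `|b j|).+1))%N => x xab.
apply/rV_cubeP => j; have := xab j; rewrite /= in_itv/= => /andP[aj bj].
have /andP[_ /ltW taj] := truncn_itv (normr_ge0 (a j)).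
have /andP[_ /ltW tbj] := truncn_itv (normr_ge0 (b j)).
rewrite (bigD1 j)//= natrD natrD.
set s : R := (\sum_(_ < _ | _) _)%:R.
have s0 : 0 <= s by rewrite /s ler0n.
have [x0|x0] := leP 0 (x ord0 j).
- rewrite ger0_norm// (le_trans (ltW bj))// (le_trans (ler_norm _))//.
  by rewrite (le_trans tbj)// -addrA addrCA ler_wpDr// addr_ge0// ler0n.
- rewrite ltr0_norm// (@le_trans _ _ (- a j)) ?lerN2 ?(ltW aj)//.
  rewrite (le_trans (ler_norm _))// normrN (le_trans taj)// -addrA.
  by rewrite ler_wpDr// addr_ge0// ler0n.
Qed.

Lemma open_boxI (a b a' b' : 'I_n -> R) :
  open_box a b `&` open_box a' b' =
  open_box (fun j => Num.max (a j) (a' j)) (fun j => Num.min (b j) (b' j)).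
Proof.
apply/seteqP; split => x /=.
  move=> [xab xab'] j; have := xab j; have := xab' j.
  by rewrite /= !in_itv/= gt_max lt_min => /andP[-> ->] /andP[-> ->].
by move=> xab; split => j; have := xab j;
  rewrite /= !in_itv/= gt_max lt_min => /andP[/andP[? ?] /andP[? ?]]; apply/andP.
Qed.

Definition open_boxes : set (set 'rV[R]_n) :=
  [set open_box ab.1 ab.2 | ab in [set: ('I_n -> R) * ('I_n -> R)]].

(** It suffices that coordinates are measurable for the generated sigma-algebra: the preimage of an
    interval is a countable union of boxes, wide in the other directions. *)
Lemma measurable_sub_open_boxes : (@measurable _ 'rV[R]_n) `<=` <<s open_boxes >>.
Proof.
pose S := g_sigma_algebraType open_boxes.
have mcoord i : measurable_fun [set: S] (fun x : S => (x : 'rV[R]_n) ord0 i).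
  apply: (measurability _ (RGenOpens.measurableE R)).
  move=> _ [_ [c [d ->] <-]]; rewrite setTI.
  rewrite [X in measurable X](_ : _ = \bigcup_k
     (open_box (fun j => if j == i then c else - k%:R)
        (fun j => if j == i then d else k%:R) : set S)).
    apply: bigcupT_measurable => k; apply: sub_sigma_algebra.
    by exists ((fun j => if j == i then c else - k%:R),
      (fun j => if j == i then d else k%:R)).
  apply/seteqP; split => x /=; last first.
    by move=> [k _ /(_ i)]; rewrite eqxx.
  move=> xcd.
  have : (\bigcup_k (@rV_cube R n k)) x by rewrite rV_cube_cover.
  move=> [k _ /rV_cubeP xk]; exists k.+1 => // j /=; case: eqP => [->//|_].
  by rewrite in_itv/= -ltr_norml (le_lt_trans (xk j))// ltr_nat.
apply: smallest_sub; first exact: smallest_sigma_algebra.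
rewrite -bigcup_seq => B [i _ [C mC <-]].
exact: mcoord.
Qed.

(** Dynkin's theorem: measurable sets with vanishing integral form a Dynkin system, closed under
    complements because the total integral is 0, and boxes are stable under intersection. *)
Lemma integral_open_boxes_eq0 (f : 'rV[R]_n -> \bar R) :
  mu.-integrable setT f -> (\int[mu]_x f x = 0)%E ->
  (forall a b, \int[mu]_(x in open_box a b) f x = 0)%E ->
  {ae mu, forall x, f x = 0%E}.
Proof.
move=> fi fT fbox.
pose H := [set A | measurable A /\ (\int[mu]_(x in A) f x = 0)%E].
have dH : dynkin H.
  split.
  - by split.
  - move=> A [mA A0]; split; first exact: measurableC.
    have : (\int[mu]_x f x = \int[mu]_(x in A) f x + \int[mu]_(x in ~` A) f x)%E.
      rewrite -(setUv A).
      exact: (chargeU (induced_charge fi) mA (measurableC mA) (setICr A)).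
    by rewrite fT A0 add0e => <-.
  - move=> F tF FH; have mF k : measurable (F k) by case: (FH k).
    split; first exact: bigcupT_measurable.
    have := @charge_semi_sigma_additive _ _ _ (induced_charge fi) F mF tF
      (bigcupT_measurable F mF).
    rewrite [X in X @ _ --> _](_ : _ = fun=> 0%E); last first.
      apply/funext => k; apply: big1 => i _.
      by have [_] := FH i.
    move=> /(cvg_lim (@ereal_hausdorff R)) h.
    by transitivity (induced_charge fi (\bigcup_k F k)) => //; rewrite -h lim_cst.
have measH : measurable `<=` H.
  apply: (subset_trans measurable_sub_open_boxes).
  rewrite -setI_closed_g_dynkin_g_sigma_algebra.
    apply: smallest_sub => // _ [[a b] _ <-]; split => //=.
    exact: measurable_open_box.
  move=> _ _ [[a b] _ <-] [[a' b'] _ <-]; rewrite open_boxI.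
  by exists (fun j => Num.max (a j) (a' j), fun j => Num.min (b j) (b' j)).
have := @integral_ae_eq _ _ _ mu setT measurableT (cst 0%E) f fi (measurable_cst _).
move=> /(_ _)/= h.
have : ae_eq mu setT f (cst 0%E).
  by apply: h => E _ mE; rewrite integral0; have [] := measH _ mE.
by apply: filterS => x; apply.
Qed.

(** As m grows the bumps become indicators of boxes, with |W| on a bounded cube as dominating
    function; so W has integral 0 over every box. *)
Lemma du_bois_reymond (W : 'rV[R]_n -> R) : measurable_fun setT W ->
  (forall k, mu.-integrable (rV_cube k) (EFin \o W)) ->
  (forall m a b, \int[mu]_x (W x * box_bump m a b x)%:E = 0)%E ->
  {ae mu, forall x, W x = 0}.
Proof.
move=> mW Wi Wbump.
have Wbox a b : (\int[mu]_(x in open_box a b) (W x)%:E = 0)%E.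
  have [k abk] := open_box_sub_cube a b.
  pose f_ m x := (W x * box_bump m a b x)%:E.
  pose f x := (W x * \1_(open_box a b) x)%:E.
  pose g x := (`|(EFin \o W) \_ (rV_cube k) x|)%E.
  have mbump m : measurable_fun setT (box_bump m a b).
    apply: continuous_measurable_rV; apply: flat_algebra_continuous.
    exact: flat_algebra_box_bump.
  have [] := @dominated_convergence _ _ _ mu setT measurableT f_ f g.
  - by move=> m; apply/measurable_EFinP; exact: measurable_funM.
  - apply/measurable_EFinP; apply: measurable_funM => //.
    by apply/measurable_indicP; exact: measurable_open_box.
  - apply: aeW => x _; apply: cvg_EFin; first exact: nearW.
    by apply: cvgMr; exact: cvg_box_bump.
  - apply: integrable_abse.
    exact: (integrable_mkcond _ (@measurable_rV_cube R n k)).1 (Wi k).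
  - apply: aeW => x m _; rewrite /f_ /g /patch.
    have [->|bx] := eqVneq (box_bump m a b x) 0; first by rewrite mulr0 abse0 abse_ge0.
    rewrite mem_set; last exact/abk/(box_bump_neq0 bx).
    rewrite /= lee_fin normrM ler_piMr// ger0_norm ?box_bump_ge0//.
    exact: box_bump_le1.
  move=> _ _; rewrite (_ : (fun m => _) = fun=> 0%E); last first.
    by apply/funext => m; exact: Wbump.
  move=> /cvg_lim => /(_ (@ereal_hausdorff R)); rewrite lim_cst//.
  move=> h; transitivity (\int[mu]_x f x)%E; last exact: esym.
  rewrite integral_mkcond; apply: eq_integral => x _.
  rewrite /f patchE indicE; case: ifPn => xab; first by rewrite mulr1.
  by rewrite mulr0.
(* [W] is only locally integrable, so the argument runs on its restriction to each open cube;
   intersecting a box with the cube again gives a box. *)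
pose Q (k : nat) := open_box (fun=> - k%:R) (fun=> k%:R) : set 'rV[R]_n.
have mQ k : measurable (Q k) by exact: measurable_open_box.
have Wk k : {ae mu, forall x, ((EFin \o W) \_ (Q k)) x = 0%E}.
  apply: integral_open_boxes_eq0.
  - apply: (integrable_mkcond _ (mQ k)).1.
    apply: integrableS (@measurable_rV_cube R n k) (mQ k) _ (Wi k).
    by move=> x xk j; apply: subset_itv_oo_cc; exact: xk.
  - by rewrite -integral_mkcond; exact: Wbox.
  - by move=> a b; rewrite -integral_mkcondr /Q open_boxI; exact: Wbox.
have : mu.-negligible (\bigcup_k ~` [set x | ((EFin \o W) \_ (Q k)) x = 0%E]).
  by apply: negligible_bigcup => k; exact: Wk.
apply: negligibleS => x /= Wx0.
have : (\bigcup_k (@rV_cube R n k)) x by rewrite rV_cube_cover.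
move=> [k _ /rV_cubeP xk]; exists k.+1 => //=.
rewrite patchE mem_set/=; first by move=> [].
by move=> j /=; rewrite in_itv/= -ltr_norml (le_lt_trans (xk j))// ltr_nat.
Qed.

End fundamental_lemma.

(** * Distributional derivatives and difference quotients *)

Section flow_primitive.
Context d (T : measurableType d) (R : realType).
Variables (mu : {sigma_finite_measure set T -> \bar R}) (tau : R -> T -> T).
Hypothesis flow_tau : measure_flow mu tau.
Variable p : R.
Hypothesis p1 : 1 < p.
Local Notation leb := (@lebesgue_measure R).
Local Notation Lp := (Lfun mu p%:E).

Let p1' : 1 <= p. Proof. exact: ltW. Qed.
Let p0 : 0 < p. Proof. exact: lt_trans p1. Qed.

Definition flow_primitive (h : R) (g : T -> R) (x : T) : R :=
  \int[leb]_(t in `[0, h]) g (tau t x).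

Let leb_itv_fin h : leb `[0, h]%classic \is a fin_num.
Proof.
rewrite lebesgue_measure_itv/=; by case: ifP.
Qed.

Lemma integrable_set_Lfun (S : set T) (g : T -> R) : measurable S ->
  (mu S < +oo)%E -> g \in Lp -> mu.-integrable S (EFin \o g).
Proof.
move=> mS muS gL; have mg := Lfun_measurable p1' gL.
apply/integrableP; split; first by apply/measurable_EFinP; exact: measurable_funTS.
apply: (@le_lt_trans _ _ (\int[mu]_(x in S) (1 + (`|g x| `^ p)%:E))%E).
  apply: ge0_le_integral => //.
  - by apply/measurable_EFinP/measurableT_comp => //; exact: measurable_funTS.
  - apply: emeasurable_funD => //.
    by apply: measurable_funTS; exact: measurable_normr_powR.
  - by move=> x _; rewrite /= -EFinD lee_fin norm_le1_powR.
rewrite ge0_integralD//; last first.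
  by apply: measurable_funTS; exact: measurable_normr_powR.
rewrite integral_cst// mul1e lte_add_pinfty//.
apply: (@le_lt_trans _ _ (\int[mu]_x (`|g x| `^ p)%:E)%E); last first.
  by rewrite (integral_pnorm p1')// ltry.
by apply: ge0_subset_integral => //; exact: measurable_normr_powR.
Qed.

Section fubini.
Variables (h : R) (S : set T) (g : T -> R).
Hypotheses (mS : measurable S) (muS : (mu S < +oo)%E) (gL : g \in Lp).

Let mg : measurable_fun [set: T] g. Proof. exact: Lfun_measurable gL. Qed.

Let mgtau : measurable_fun [set: T * R] (fun z : T * R => g (tau z.2 z.1)).
Proof. exact: (measurable_flow_comp flow_tau). Qed.

Let m1S : measurable_fun [set: T] (\1_S : T -> R).
Proof. by apply/measurable_indicP. Qed.

Let m1I : measurable_fun [set: R] (\1_(`[0, h] : set R) : R -> R).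
Proof. by apply/measurable_indicP; exact: measurable_itv. Qed.

(** For each t the integral over S of |g o tau_t| is at most mu S + ||g||^p, by |y| <= 1 + |y|^p and
    invariance; this bound does not depend on t. *)
Lemma integrable_flow : (mu \x leb)%E.-integrable [set: T * R]
  (fun z => (\1_S z.1 * \1_(`[0, h] : set R) z.2 * g (tau z.2 z.1))%:E).
Proof.
have mK : measurable_fun [set: T * R] (fun z : T * R =>
    \1_S z.1 * \1_(`[0, h] : set R) z.2 * g (tau z.2 z.1)).
  apply: measurable_funM => //; apply: measurable_funM.
    exact: (measurableT_comp m1S measurable_fst).
  exact: (measurableT_comp m1I measurable_snd).
apply/integrable21ltyP; first exact/measurable_EFinP.
pose C : \bar R := (mu S + (pnorm mu p g `^ p)%:E)%E.
have C0 : (0 <= C)%E by rewrite adde_ge0// lee_fin powR_ge0.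
have mI : measurable (`[0, h] : set R) by exact: measurable_itv.
apply: (@le_lt_trans _ _
    (\int[leb]_t ((\1_(`[0, h] : set R) t)%:E * C))%E); last first.
  rewrite ge0_integralZr//; last exact/measurable_EFinP.
  rewrite integral_indic// setIT lte_mul_pinfty ?ge0_fin_numE//.
    by rewrite -ge0_fin_numE// leb_itv_fin.
  by rewrite lte_add_pinfty ?ltry.
apply: ge0_le_integral => //.
- by move=> t _; exact: integral_ge0.
- have := @measurable_fun_fubini_tonelli_G _ _ _ _ R mu
    (fun z => `|(\1_S z.1 * \1_(`[0, h] : set R) z.2 * g (tau z.2 z.1))%:E|)%E.
  by apply => //; apply: measurableT_comp => //; exact/measurable_EFinP.
- by apply: emeasurable_funM => //; exact/measurable_EFinP.
move=> t _ /=.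
have mgt : measurable_fun [set: T] (fun x => (`|g (tau t x)| `^ p)%:E).
  apply: measurable_normr_powR => //.
  exact: (measurableT_comp mg (measurable_flow flow_tau t)).
rewrite (_ : C = \int[mu]_x ((\1_S x)%:E + (`|g (tau t x)| `^ p)%:E))%E; last first.
  rewrite ge0_integralD//; last exact/measurable_EFinP.
  rewrite integral_indic// setIT /C.
  rewrite (ge0_integral_flow flow_tau t (f := fun x => (`|g x| `^ p)%:E))//.
    by rewrite (integral_pnorm p1').
  exact: measurable_normr_powR.
have msum : measurable_fun [set: T]
    (fun x => (\1_S x)%:E + (`|g (tau t x)| `^ p)%:E)%E.
  by apply: emeasurable_funD => //; exact/measurable_EFinP.
have sum0 x : (0 <= (\1_S x)%:E + (`|g (tau t x)| `^ p)%:E)%E.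
  by rewrite adde_ge0// lee_fin.
rewrite -ge0_integralZl//.
apply: ge0_le_integral => //.
- apply/measurable_EFinP/measurableT_comp => //.
  exact: (measurableT_comp mK (pair2_measurable t)).
- exact: emeasurable_funM.
move=> x _; rewrite -EFinD -EFinM lee_fin [X in X * _]mulrC -mulrA normrM.
rewrite ger0_norm// ler_wpM2l// indicE; case: (x \in S).
  by rewrite mul1r norm_le1_powR.
by rewrite mul0r normr0 add0r powR_ge0.
Qed.

Lemma ae_integrable_flow : {ae mu, forall x, S x ->
  leb.-integrable `[0, h] (fun t => (g (tau t x))%:E)}.
Proof.
apply: filterS (ae_integrable1 integrable_flow) => x xi Sx.
apply/integrable_mkcond; first exact: measurable_itv.
apply: eq_integrable xi => // t _; rewrite /= !indicE mem_set// mul1r patchE.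
by case: (t \in _); rewrite ?mul1r ?mul0r.
Qed.

Lemma measurable_flow_primitive : measurable_fun [set: T] (flow_primitive h g).
Proof.
apply: measurableT_comp => //.
(* Splitting into positive and negative parts gives measurability at all x, including those where
   the orbit integral is undefined. *)
rewrite (_ : (fun x => _) = (fun x =>
    \int[leb]_(t in `[0%R, h]) (EFin \o (fun z : T * R => g (tau z.2 z.1)))^\+ (x, t) -
    \int[leb]_(t in `[0%R, h]) (EFin \o (fun z : T * R => g (tau z.2 z.1)))^\- (x, t))%E); last first.
  apply/funext => x; rewrite integralE.
  by congr (_ - _)%E; apply: eq_integral => t _; rewrite ?funeposE ?funenegE.
apply: emeasurable_funB.
- apply: (measurable_ge0_fubini_restrict leb); first exact: measurable_itv.
    by apply: measurable_funepos; exact/measurable_EFinP.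
  by move=> z; exact: funepos_ge0.
- apply: (measurable_ge0_fubini_restrict leb); first exact: measurable_itv.
    by apply: measurable_funeneg; exact/measurable_EFinP.
  by move=> z; exact: funeneg_ge0.
Qed.

Lemma fubini_flow_primitive (f : T -> R) (M : R) : measurable_fun [set: T] f ->
  (forall x, `|f x| <= M * \1_S x) ->
  mu.-integrable [set: T] (fun x => (f x * flow_primitive h g x)%:E) /\
  (\int[mu]_x (f x * flow_primitive h g x)%:E =
   \int[leb]_(t in `[0%R, h]) \int[mu]_x (f x * g (tau t x))%:E)%E.
Proof.
move=> mf fM.
pose K (z : T * R) := (f z.1 * \1_(`[0, h] : set R) z.2 * g (tau z.2 z.1))%:E.
have mK : measurable_fun [set: T * R] K.
  apply/measurable_EFinP; apply: measurable_funM => //; apply: measurable_funM.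
    exact: (measurableT_comp mf measurable_fst).
  exact: (measurableT_comp m1I measurable_snd).
have iK : (mu \x leb)%E.-integrable [set: T * R] K.
  apply: le_integrable (integrableZl _ M integrable_flow) => //.
  move=> z _; rewrite /K -EFinM lee_fin !normrM mulrA ler_wpM2r//.
  rewrite mulrA ler_wpM2r// (le_trans (fM z.1))//.
  by rewrite -normrM ler_norm.
have mfG : measurable_fun [set: T] (fun x => (f x * flow_primitive h g x)%:E).
  by apply/measurable_EFinP/measurable_funM => //; exact: measurable_flow_primitive.
(* Only almost everywhere: the real-valued primitive agrees with the extended integral where the
   orbit is integrable, which is known for almost all x in S; outside S both sides vanish with f. *)
have KE : ae_eq mu [set: T] (fun x => \int[leb]_t K (x, t))%E
    (fun x => (f x * flow_primitive h g x)%:E).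
  apply: filterS ae_integrable_flow => x xi _.
  transitivity (\int[leb]_(t in `[0%R, h]) ((f x)%:E * (g (tau t x))%:E))%E.
    rewrite [RHS]integral_mkcond; apply: eq_integral => t _.
    rewrite /K/= patchE indicE.
    by case: (t \in _); rewrite ?mulr1 ?mulr0 ?mul0r.
  have [fx0|fx0] := eqVneq (f x) 0.
    by rewrite fx0 mul0r; apply: integral0_eq => t _; rewrite mul0e.
  have Sx : S x.
    apply: contrapT => Sx; move: (fM x); rewrite indicE memNset// mulr0.
    by rewrite normr_le0 (negbTE fx0).
  have mI : measurable (`[0, h] : set R) by exact: measurable_itv.
  rewrite integralZl//; last exact: xi.
  rewrite EFinM /flow_primitive /Rintegral fineK//.
  by apply: integrable_fin_num => //; exact: xi.
have iF := integrable_fubini_F iK.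
split.
  have /integrableP[mF Foo] := iF; apply/integrableP; split => //.
  rewrite (le_lt_trans _ Foo)// le_eqVlt; apply/orP; left; apply/eqP.
  apply: ge0_ae_eq_integral => //; [exact: measurableT_comp|exact: measurableT_comp|].
  by apply: filterS KE => x E _; congr (`|_|)%E; rewrite -(E Logic.I).
transitivity (\int[mu]_x \int[leb]_t K (x, t))%E.
  apply: ae_eq_integral => //; first by case/integrableP : iF.
  by apply: filterS KE => x E _ /=; rewrite -(E Logic.I).
rewrite (Fubini iK) [RHS]integral_mkcond; apply: eq_integral => t _.
rewrite patchE; case: ifPn => tI.
  by apply: eq_integral => x _; rewrite /K/= indicE tI mulr1.
by apply: integral0_eq => x _; rewrite /K/= indicE (negbTE tI) mulr0 mul0r.
Qed.

End fubini.

End flow_primitive.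

(** * Bounds and derivatives of test functions *)

Section test_function_theory.
Variables (R : realType) (n : nat).
Implicit Types (phi : 'rV[R]_n -> R).

Lemma continuous_compact_norm_le phi (K : set 'rV[R]_n) : compact K ->
  continuous phi -> exists2 M, 0 <= M & forall x, K x -> `|phi x| <= M.
Proof.
move=> cK cphi.
have : compact (phi @` K).
  by apply: continuous_compact => //; exact: continuous_subspaceT.
move=> /compact_bounded [M [_ HM]]; exists (`|M| + 1) => [|x Kx]; first by rewrite addr_ge0.
by apply: (HM (`|M| + 1)); [rewrite ltr_pwDr// ler_norm|exists x].
Qed.

Lemma compact_sub_rV_cube (K : set 'rV[R]_n) : compact K ->
  exists k, K `<=` rV_cube k.
Proof.
move=> cK.
have H (j : 'I_n) : exists M, forall x, K x -> `|x ord0 j| <= M.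
  have [||M _ HM] := @continuous_compact_norm_le (fun x => x ord0 j) K => //.
    exact: coord_continuous.
  by exists M.
have [M HM] := choice H.
exists (\sum_j (Num.truncn `|M j|).+1)%N => x Kx; apply/rV_cubeP => j.
have /andP[_ /ltW tM] := truncn_itv (normr_ge0 (M j)).
rewrite (le_trans (HM j x Kx))// (le_trans (ler_norm _))// (le_trans tM)//.
by rewrite ler_nat (bigD1 j)//= leq_addr.
Qed.

Lemma continuous_support_bound phi (K : set 'rV[R]_n) : compact K ->
  continuous phi -> (forall x, phi x != 0 -> K x) ->
  exists k M, forall x, `|phi x| <= M * \1_(rV_cube k) x.
Proof.
move=> cK cphi phiK.
have [k Kk] := compact_sub_rV_cube cK.
have [M M0 HM] := continuous_compact_norm_le cK cphi.
exists k, M => x; have [->|phix] := eqVneq (phi x) 0.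
  by rewrite normr0 mulr_ge0.
by rewrite indicE mem_set ?mulr1; [exact/HM/phiK|exact/Kk/phiK].
Qed.

(** Off the closed support the function is 0 in a whole neighbourhood, so its partial derivatives
    inherit the compact support. *)
Lemma partial_neq0 i phi x : partial i phi x != 0 -> closure [set x | phi x != 0] x.
Proof.
apply: contra_neqP => xK.
rewrite /partial (@near_eq_derive _ _ _ phi (cst 0)) ?derive_cst//.
have : open (~` closure [set x | phi x != 0]) by apply/closed_openC/closed_closure.
rewrite openE => /(_ _ xK); apply: filterS => y yK.
apply/eqP; apply: contrapT => /negP phiy; apply: yK.
exact: subset_closure.
Qed.

Lemma test_function_bound phi : test_function phi ->
  exists k M, forall x, `|phi x| <= M * \1_(rV_cube k) x.
Proof.
move=> [/(_ [::])[cphi _] sphi].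
by apply: (continuous_support_bound sphi cphi) => x phix; exact: subset_closure.
Qed.

Lemma test_function_partial_bound i phi : test_function phi ->
  exists k M, forall x, `|partial i phi x| <= M * \1_(rV_cube k) x.
Proof.
move=> [/(_ [:: i])[cphi _] sphi].
by apply: (continuous_support_bound sphi cphi) => x; exact: partial_neq0.
Qed.

Lemma test_function_measurable phi : test_function phi ->
  measurable_fun [set: 'rV[R]_n] phi.
Proof. by move=> [/(_ [::])[cphi _] _]; exact: continuous_measurable_rV. Qed.

Lemma test_function_partial_continuous i phi : test_function phi ->
  continuous (partial i phi).
Proof. by move=> [/(_ [:: i])[]]. Qed.

Lemma is_derive_line i phi (x : 'rV[R]_n) (t c : R) : test_function phi ->
  is_derive t (1 : R) (fun t => phi (x + (c * t) *: canonical_vector i))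
    (c * partial i phi (x + (c * t) *: canonical_vector i)).
Proof.
move=> [/(_ [::])[_ /(_ i) dphi] _].
set e := canonical_vector i; set y := x + (c * t) *: e.
have dG : is_derive (c * t) (1 : R) (fun s => phi (x + s *: e)) (partial i phi y).
  have E : (fun h : R => h^-1 *: (((fun s => phi (x + s *: e)) \o shift (c * t)) (h *: (1 : R)) -
      phi (x + (c * t) *: e))) =
    (fun h : R => h^-1 *: ((phi \o shift y) (h *: e) - phi y)).
    apply/funext => h /=; rewrite [h *: 1]mulr1 scalerDl /y.
    by rewrite addrCA.
  by split; [rewrite /derivable E; exact: (dphi y)|rewrite /derive E].
have dc : is_derive t (1 : R) (fun t => c * t) c.
  by have := is_deriveZ c (is_derive_id t (1 : R)); rewrite /GRing.scale/= mulr1.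
have := @is_derive1_comp R (fun s => phi (x + s *: e)) (fun t => c * t) t _ _ dG dc.
by rewrite mulrC.
Qed.

Lemma partial_shift i phi (v x : 'rV[R]_n) :
  partial i (fun y => phi (y + v)) x = partial i phi (x + v).
Proof.
rewrite /partial /derive.
rewrite [X in lim (X @ _) = _](_ : _ = (fun h : R => h^-1 *: ((phi \o shift (x + v))
  (h *: canonical_vector i) - phi (x + v))))//.
by apply/funext => h /=; rewrite addrA.
Qed.

End test_function_theory.

(** * From a weak derivative to increments along the flow *)

Section weak_derivative_flow.
Variables (R : realType) (n : nat) (p : R) (i : 'I_n).
Hypothesis p1 : 1 < p.
Local Notation mu := (sigma_finite_rV R n).
Local Notation leb := (@lebesgue_measure R).
Local Notation Lp := (Lfun mu p%:E).
Local Notation tau := (@rV_flow R n i).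
Let flow_tau := @measure_flow_rV R n i.
Let p1' : 1 <= p. Proof. exact: ltW. Qed.

Lemma integrableM_bounded_support (w f : 'rV[R]_n -> R) k M :
  w \in Lp -> measurable_fun setT f ->
  (forall x, `|f x| <= M * \1_(rV_cube k) x) ->
  mu.-integrable setT (fun x => (w x * f x)%:E).
Proof.
move=> wL mf fM; have mw := Lfun_measurable p1' wL.
have mk : measurable (@rV_cube R n k) by exact: measurable_rV_cube.
have muk : (mu (@rV_cube R n k) < +oo)%E by exact: lebesgue_rV_cube_lty.
have wi := integrable_set_Lfun p1 mk muk wL.
apply: le_integrable (integrableZl _ M ((integrable_mkcond _ mk).1 wi)) => //.
  by apply/measurable_EFinP; exact: measurable_funM.
move=> x _; rewrite patchE; have := fM x; rewrite indicE.
case: ifPn => xk /=; last first.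
  by rewrite mulr0 normr_le0 => /eqP ->; rewrite !mulr0 normr0.
rewrite mulr1 => fMx; rewrite lee_fin mulrC !normrM ler_wpM2r//.
by rewrite (le_trans fMx)// ler_norm.
Qed.

Lemma integralM_flow (w f : 'rV[R]_n -> R) k M (t : R) :
  w \in Lp -> measurable_fun setT f ->
  (forall x, `|f x| <= M * \1_(rV_cube k) x) ->
  mu.-integrable setT (fun x => (w x * f (tau (- t) x))%:E) /\
  (\int[mu]_x (w (tau t x) * f x)%:E = \int[mu]_x (w x * f (tau (- t) x))%:E)%E.
Proof.
move=> wL mf fM.
have wtL := (Lfun_flow flow_tau p1 t wL).1.
have [||+ +] := @integral_invariant _ _ _ mu (tau (- t))
    (fun x => (w (tau t x) * f x)%:E) (measurable_flow flow_tau (- t)).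
- by move=> A mA; exact: (flow_measure flow_tau).
- exact: integrableM_bounded_support fM.
rewrite (_ : _ \o _ = (fun x => (w x * f (tau (- t) x))%:E)); last first.
  by apply/funext => x /=; rewrite -(flowD flow_tau) subrr (flow0 flow_tau).
move=> h1 h2; split => //; rewrite -h2; apply: eq_integral => x _.
by rewrite -(flowD flow_tau) subrr (flow0 flow_tau).
Qed.

(** The bound on [f] is asked for t in [0, h] only, since the indicator of this interval is built
    into the kernel; |M| times |w| on the cube then dominates it. *)
Lemma fubini_bounded_support (w : 'rV[R]_n -> R) (f : 'rV[R]_n * R -> R) h k M :
  w \in Lp -> measurable_fun setT f ->
  (forall x t, 0 <= t <= h -> `|f (x, t)| <= M * \1_(rV_cube k) x) ->
  (\int[mu]_x (w x * \int[leb]_(t in `[0, h]) f (x, t))%:E =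
   \int[leb]_(t in `[0%R, h]) \int[mu]_x (w x * f (x, t))%:E)%E.
Proof.
move=> wL mf fM; have mw := Lfun_measurable p1' wL.
have mI : measurable (`[0, h] : set R) by exact: measurable_itv.
have m1I : measurable_fun [set: R] (\1_(`[0, h] : set R) : R -> R).
  by apply/measurable_indicP.
have mk : measurable (@rV_cube R n k) by exact: measurable_rV_cube.
have m1k : measurable_fun setT (\1_(@rV_cube R n k) : _ -> R).
  by apply/measurable_indicP.
pose K (z : 'rV[R]_n * R) := (w z.1 * f z * \1_(`[0, h] : set R) z.2)%:E.
have mK : measurable_fun setT K.
  apply/measurable_EFinP; apply: measurable_funM.
    by apply: measurable_funM => //; exact: (measurableT_comp mw measurable_fst).
  exact: (measurableT_comp m1I measurable_snd).
have w1i : mu.-integrable setT (fun x => (w x * \1_(rV_cube k) x)%:E).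
  apply: (@integrableM_bounded_support _ _ k 1) => // x.
  by rewrite mul1r ger0_norm.
have lebI : (leb (`[0%R, h] : set R) < +oo)%E.
  by rewrite lebesgue_measure_itv/=; case: ifP => //; rewrite ltry.
have iK : (mu \x leb)%E.-integrable setT K.
  apply/integrable12ltyP => //.
  apply: (@le_lt_trans _ _ 
    (\int[mu]_x (`|M|%:E * `|(w x * \1_(rV_cube k) x)%:E| *
                 leb (`[0%R, h] : set R)))%E).
    apply: ge0_le_integral => //.
    - by move=> x _; exact: integral_ge0.
    - apply: (@measurable_fun_fubini_tonelli_F _ _ _ _ R leb (abse \o K)) => [|z].
        exact: measurableT_comp.
      exact: abse_ge0.
    - apply: emeasurable_funM => //; apply: emeasurable_funM => //.
      by apply: measurableT_comp => //; case/integrableP : w1i.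
    move=> x _.
    rewrite -[leb _]mul1e -integral_cst// -ge0_integralZl//.
    rewrite [leRHS]integral_mkcond; apply: ge0_le_integral => //.
    - apply: measurableT_comp => //.
      exact: (measurableT_comp mK (pair1_measurable x)).
    - by apply/(measurable_restrictT _ mI).
    move=> t _; rewrite patchE /K/= indicE; case: ifPn => tI; last first.
      by rewrite mulr0 normr0.
    have := tI; rewrite inE/= in_itv/= => tI'.
    rewrite mulr1 mule1 -EFinM lee_fin !normrM [leRHS]mulrCA ler_wpM2l//.
    rewrite (le_trans (fM x t tI'))// [X in _ <= _ * X]ger0_norm//.
    by rewrite ler_wpM2r// ler_norm.
  have mabs : measurable_fun setT (fun x => `|(w x * \1_(rV_cube k) x)%:E|)%E.
    by apply: measurableT_comp => //; case/integrableP : w1i.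
  have mabs' : measurable_fun setT (fun x => `|M|%:E * `|(w x * \1_(rV_cube k) x)%:E|)%E.
    exact: emeasurable_funM.
  rewrite ge0_integralZr//.
  rewrite ge0_integralZl//.
  rewrite lte_mul_pinfty ?mule_ge0 ?integral_ge0//.
    rewrite fin_numM// ge0_fin_numE ?integral_ge0//.
    by case/integrableP : w1i.
transitivity (\int[mu]_x \int[leb]_t K (x, t))%E.
  apply: eq_integral => x _.
  transitivity (\int[leb]_(t in `[0%R, h]) ((w x)%:E * (f (x, t))%:E))%E; last first.
    rewrite integral_mkcond; apply: eq_integral => t _.
    rewrite /K/= patchE indicE.
    by case: (t \in _); rewrite ?mulr1 ?mulr0.
  have fi : leb.-integrable `[0, h] (fun t => (f (x, t))%:E).
    have mfx : measurable_fun [set: R] (fun t => f (x, t)).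
      exact: (measurableT_comp mf (pair1_measurable x)).
    apply: (@le_integrable _ _ _ leb _ mI _ (cst (M * \1_(rV_cube k) x)%:E)).
    - by apply/measurable_EFinP; exact: measurable_funTS.
    - move=> t; rewrite /= in_itv/= => tI; rewrite lee_fin (le_trans (fM x t tI))//.
      exact: ler_norm.
    - apply/integrableP; split => //.
      by rewrite integral_cst//= lte_mul_pinfty.
  rewrite integralZl// EFinM /Rintegral fineK//.
  exact: integrable_fin_num.
rewrite (Fubini iK) [RHS]integral_mkcond; apply: eq_integral => t _.
rewrite patchE; case: ifPn => tI.
  by apply: eq_integral => x _; rewrite /K/= indicE tI mulr1.
by apply: integral0_eq => x _; rewrite /K/= indicE (negbTE tI) mulr0.
Qed.

Lemma is_derive_flow_test phi x t : test_function phi ->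
  is_derive t (1 : R) (fun t => phi (tau (- t) x)) (- partial i phi (tau (- t) x)).
Proof.
move=> phiT; have := is_derive_line i x t (-1) phiT.
by rewrite /rV_flow; under [X in is_derive _ _ X _]eq_fun do rewrite mulN1r;
  rewrite !mulN1r.
Qed.

Lemma continuous_flow_test phi x : test_function phi ->
  continuous (fun t => phi (tau (- t) x)).
Proof.
move=> phiT t; apply/differentiable_continuous/derivable1_diffP.
exact: (@ex_derive _ _ _ _ _ _ _ (is_derive_flow_test x t phiT)).
Qed.

Lemma integral_partial_line phi x h : test_function phi -> 0 < h ->
  \int[leb]_(t in `[0, h]) (- partial i phi (tau (- t) x)) =
  phi (tau (- h) x) - phi x.
Proof.
move=> phiT h0.
have D t := is_derive_flow_test x t phiT.
have cF : continuous (fun t => phi (tau (- t) x)) by exact: continuous_flow_test.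
have cf : continuous (fun t => - partial i phi (tau (- t) x)).
  move=> t; apply: cvgN.
  apply: (@continuous_comp _ _ _ (fun t => tau (- t) x) (partial i phi)); last first.
    exact: test_function_partial_continuous.
  apply: cvgD; first exact: cvg_cst.
  by apply: cvgZr_tmp; apply: cvgN; exact: cvg_id.
rewrite /Rintegral (@continuous_FTC2 R _ (fun t => phi (tau (- t) x)))//.
- by rewrite oppr0 (flow0 flow_tau).
- exact: continuous_subspaceT.
- split.
  + by move=> t _; exact: (@ex_derive _ _ _ _ _ _ _ (D t)).
  + by apply: cvg_at_right_filter; exact: cF.
  + by apply: cvg_at_left_filter; exact: cF.
- move=> t _; rewrite derive1E; exact: (@derive_val _ _ _ _ _ _ _ (D t)).
Qed.

Lemma rV_cube_flow k t h (x : 'rV[R]_n) : 0 <= t <= h ->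
  rV_cube k (tau (- t) x) -> rV_cube (k + (Num.truncn h).+1) x.
Proof.
move=> /andP[t0 th] /rV_cubeP xk; apply/rV_cubeP => j.
have h0 := le_trans t0 th.
have /andP[_ /ltW hT] := truncn_itv h0.
have -> : x ord0 j = tau (- t) x ord0 j + t * (j == i)%:R.
  by rewrite /rV_flow !mxE eqxx/= mulNr subrK.
rewrite natrD (le_trans (ler_normD _ _))// lerD// normrM.
rewrite (le_trans _ (le_trans th hT))// ger0_norm// ler_piMr//.
by case: (_ == _); rewrite ?normr1 ?normr0.
Qed.

(** The fundamental theorem of calculus is applied to the bump phi instead of u: the integral of (u
    o tau_h - u) phi is that of u (phi o tau_(-h) - phi), where the increment of phi is the integral
    over t of -d_i phi o tau_(-t). The weak derivative exchanges u d_i phi for g phi, and shifting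
    back puts the flow on g. *)
Lemma distributional_partial_flow u g h : u \in Lp -> g \in Lp -> 0 < h ->
  distributional_partial i u g ->
  {ae mu, forall x, u (tau h x) - u x = flow_primitive tau h g x}.
Proof.
move=> uL gL h0 ug.
have mg := Lfun_measurable p1' gL.
have mu' := Lfun_measurable p1' uL.
have uhL := (Lfun_flow flow_tau p1 h uL).1.
have muh := Lfun_measurable p1' uhL.
have mG : measurable_fun setT (flow_primitive tau h g).
  exact: (measurable_flow_primitive flow_tau p1 h gL).
pose W x := u (tau h x) - u x - flow_primitive tau h g x.
have WE : {ae mu, forall x, W x = 0}.
  have muk k : (mu (@rV_cube R n k) < +oo)%E by exact: lebesgue_rV_cube_lty.
  have mk k : measurable (@rV_cube R n k) by exact: measurable_rV_cube.
  apply: du_bois_reymond.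
  - by apply: measurable_funB => //; exact: measurable_funB.
  - move=> k.
    have h1 : mu.-integrable (rV_cube k) (EFin \o (fun x => u (tau h x) - u x)).
      apply: (@integrable_set_Lfun _ _ _ mu p p1 _ _ (mk k) (muk k)).
      exact: (LfunB p1').
    have h2 : mu.-integrable (rV_cube k) (EFin \o flow_primitive tau h g).
      have [||+ _] := @fubini_flow_primitive _ _ _ mu tau flow_tau p p1 h
        (rV_cube k) g (mk k) (muk k) gL (\1_(rV_cube k)) 1.
      - by apply/measurable_indicP.
      - by move=> x; rewrite mul1r ger0_norm.
      move=> H; apply/(integrable_mkcond _ (mk k)).
      apply: eq_integrable H => // x _; rewrite patchE indicE /=.
      by case: (x \in _); rewrite ?mul1r ?mul0r.
    have := integrableB (mk k) h1 h2.
    by apply: eq_integrable => // x _; rewrite /W /= EFinB.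
  - move=> m a b.
    pose phi := box_bump m a b.
    have phiS v : test_function (fun x => phi (x + v)) by exact: test_function_box_bump.
    have phiT : test_function phi.
      by have := phiS 0; under eq_fun do rewrite addr0.
    have [k [M phiM]] := test_function_bound phiT.
    have mphi := test_function_measurable phiT.
    have uphi := integrableM_bounded_support uL mphi phiM.
    have uhphi := integrableM_bounded_support uhL mphi phiM.
    have [Gphi GphiE] := @fubini_flow_primitive _ _ _ mu tau flow_tau p p1 h
      (rV_cube k) g (mk k) (muk k) gL phi M mphi phiM.
    have [uphih uphihE] := integralM_flow h uL mphi phiM.
    have key : (\int[mu]_x (phi x * flow_primitive tau h g x)%:E =
        \int[mu]_x (u x * (phi (tau (- h) x) - phi x))%:E)%E.
      have [k' [M' dphiM]] := test_function_partial_bound i phiT.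
      have cdphi : continuous (partial i phi) by exact: test_function_partial_continuous.
      have mdphi := continuous_measurable_rV cdphi.
      pose f (z : 'rV[R]_n * R) := - partial i phi (tau (- z.2) z.1).
      have mf : measurable_fun setT f.
        apply: measurableT_comp => //.
        have := measurable_flow_comp flow_tau mdphi.
        have m2 : measurable_fun setT (fun z : 'rV[R]_n * R => (z.1, - z.2)).
          by apply: measurable_fun_pair; [exact: measurable_fst|apply: measurableT_comp].
        by move=> H; exact: (measurableT_comp H m2).
      have fM x t : 0 <= t <= h ->
          `|f (x, t)| <= `|M'| * \1_(rV_cube (k' + (Num.truncn h).+1)) x.
        move=> th; rewrite /f normrN (le_trans (dphiM _))// indicE.
        have [xk|_] := boolP (_ \in _); last by rewrite mulr0 mulr_ge0.
        rewrite indicE mem_set ?mulr1 ?ler_norm//.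
        move: xk; rewrite inE; exact: rV_cube_flow.
      rewrite GphiE; under [RHS]eq_integral do rewrite -(integral_partial_line _ phiT h0).
      rewrite (fubini_bounded_support (f := f) uL mf fM).
      apply: eq_integral => t _; rewrite /f/=.
      have [_ gphiE] := integralM_flow t gL mphi phiM.
      under eq_integral do rewrite mulrC.
      rewrite gphiE.
      have [udphi _] := integralM_flow t uL mdphi dphiM.
      under [RHS]eq_integral do rewrite mulrN EFinN.
      rewrite integralN; last exact: integrable_add_def.
      (* The weak derivative is used for every time t, against the bump translated by -t along
         e_i. *)
      have h1 := ug _ (phiS (- t *: canonical_vector i)).
      set B := (\int[_]_x _)%E in h1.
      have BE : B = (\int[mu]_x (u x * partial i phi (tau (- t) x))%:E)%E.
        by apply: eq_integral => x _; rewrite partial_shift.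
      apply/esym; transitivity (- B)%E; first by rewrite BE.
      by rewrite h1 oppeK; apply: eq_integral => x _; rewrite /rV_flow.
    have E : (\int[mu]_x (W x * phi x)%:E =
       (\int[mu]_x (u (tau h x) * phi x)%:E - \int[mu]_x (u x * phi x)%:E)
       - \int[mu]_x (phi x * flow_primitive tau h g x)%:E)%E.
      rewrite -(integralB measurableT uhphi uphi).
      rewrite -(integralB measurableT (integrableB measurableT uhphi uphi) Gphi).
      by apply: eq_integral => x _; rewrite -!EFinB /W !mulrBl [phi x * _]mulrC.
    rewrite [LHS]E key.
    have -> : (\int[mu]_x (u x * (phi (tau (- h) x) - phi x))%:E =
      \int[mu]_x (u x * phi (tau (- h) x))%:E - \int[mu]_x (u x * phi x)%:E)%E.
      rewrite -(integralB measurableT uphih uphi).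
      by apply: eq_integral => x _; rewrite -EFinB mulrBr.
    rewrite uphihE subee// fin_numB.
    by rewrite (integrable_fin_num measurableT uphih) (integrable_fin_num measurableT uphi).
by apply: filterS WE => x /eqP; rewrite subr_eq0 => /eqP.
Qed.

End weak_derivative_flow.

(** * From convergent quotients to a weak derivative *)

Section limit_of_quotients.
Variables (R : realType) (n : nat) (p : R) (i : 'I_n).
Hypothesis p1 : 1 < p.
Local Notation mu := (sigma_finite_rV R n).
Local Notation leb := (@lebesgue_measure R).
Local Notation Lp := (Lfun mu p%:E).
Local Notation tau := (@rV_flow R n i).
Let flow_tau := @measure_flow_rV R n i.
Let p1' : 1 <= p. Proof. exact: ltW. Qed.
Let p0 : 0 < p. Proof. exact: lt_trans p1. Qed.

(** Holder with the conjugate exponent q = p/(p-1): pairing with a fixed bounded function supported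
    in a cube is continuous on L^p. *)
Lemma integralM_le_pnorm (f : 'rV[R]_n -> R) k M : measurable_fun setT f ->
  (forall x, `|f x| <= M * \1_(rV_cube k) x) ->
  exists C, forall w, w \in Lp ->
    (`|\int[mu]_x (w x * f x)%:E| <= (C * pnorm mu p w)%:E)%E.
Proof.
move=> mf fM.
have pB0 : 0 < p - 1 by rewrite subr_gt0.
pose q := p / (p - 1).
have q0 : 0 < q by rewrite divr_gt0.
have q1 : 1 <= q by rewrite ler_pdivlMr// mul1r gerBl.
have pq : p^-1 + q^-1 = 1.
  by rewrite /q invf_div -{1}(div1r p) -mulrDl subrKC mulfV// gt_eqF.
have mk : measurable (@rV_cube R n k) by exact: measurable_rV_cube.
have fL : f \in Lfun mu q%:E.
  apply/(LfunEP mu q1); split => //.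
  apply: (@le_lt_trans _ _ (\int[mu]_(x in rV_cube k) (`|M| `^ q)%:E)%E).
    rewrite [leRHS]integral_mkcond; apply: ge0_le_integral => //.
    - exact: measurable_normr_powR.
    - by apply/(measurable_restrictT _ mk).
    - move=> x _; rewrite patchE; have := fM x; rewrite indicE.
      case: ifPn => xk /=.
        rewrite mulr1 => fMx; rewrite lee_fin ge0_ler_powR ?nnegrE ?(ltW q0)//.
        by rewrite (le_trans fMx)// ler_norm.
      by rewrite mulr0 normr_le0 => /eqP ->; rewrite normr0 powR0 ?gt_eqF.
  rewrite integral_cst// lte_mul_pinfty ?lee_fin ?powR_ge0//.
  exact: lebesgue_rV_cube_lty.
exists (pnorm mu q f) => w wL; have mw := Lfun_measurable p1' wL.
have := @hoelder _ _ _ mu _ _ p q mw mf p0 q0 pq.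
rewrite Lnorm1 -(pnormE wL) -(pnormE fL) -EFinM mulrC; apply: le_trans.
apply: (le_trans (le_abse_integral _ _ _)) => //.
by apply/measurable_EFinP; exact: measurable_funM.
Qed.

(** Mean value theorem along the line. The bound does not depend on h, since for h <= 1 the support
    leaves the enlarged cube for no shift; this serves dominated convergence. *)
Lemma test_function_quotient_bound phi k M h x : test_function phi ->
  (forall x, `|partial i phi x| <= M * \1_(rV_cube k) x) -> 0 < h <= 1 ->
  `|h^-1 * (phi (tau (- h) x) - phi x)| <=
    `|M| * \1_(rV_cube (k + (Num.truncn (1 : R)).+1)) x.
Proof.
move=> phiT dphiM /andP[h0 h1].
have [||c] := @MVT_segment R (fun t => phi (tau (- t) x))
    (fun t => - partial i phi (tau (- t) x)) 0 h (ltW h0).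
- move=> t _; exact: is_derive_flow_test.
- by apply: continuous_subspaceT => t; exact: continuous_flow_test.
rewrite in_itv/= => /andP[c0 ch].
rewrite subr0 oppr0 (flow0 flow_tau) => ->.
rewrite mulrC mulfK ?gt_eqF// normrN (le_trans (dphiM _))// indicE.
have [xk|_] := boolP (_ \in _); last by rewrite mulr0 mulr_ge0.
rewrite indicE mem_set ?mulr1 ?ler_norm//.
by move: xk; rewrite inE; apply: rV_cube_flow; rewrite c0 (le_trans ch).
Qed.

(** Discrete integration by parts. The pairing [A m] of the quotient with phi tends to that of g by
    L^p continuity; moving the quotient onto phi, it also tends to minus the pairing of u with d_i
    phi. Uniqueness of limits identifies the two. *)
Lemma cvg_quotient_distributional u g (h : R^nat) : u \in Lp -> g \in Lp ->
  (forall m, 0 < h m <= 1) -> h @ \oo --> (0 : R) ->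
  pnorm mu p (fun x => quotient tau (h m) u x - g x) @[m --> \oo] --> 0 ->
  distributional_partial i u g.
Proof.
move=> uL gL h01 hcvg ugcvg phi phiT.
have h0 m : 0 < h m by have /andP[] := h01 m.
have [k [M phiM]] := test_function_bound phiT.
have [k' [M' dphiM]] := test_function_partial_bound i phiT.
have mphi := test_function_measurable phiT.
have mu_ := Lfun_measurable p1' uL.
have mdphi : measurable_fun setT (partial i phi).
  by apply: continuous_measurable_rV; exact: test_function_partial_continuous.
have qL m : quotient tau (h m) u \in Lp by exact: (Lfun_quotient flow_tau p1).
have uphi := integrableM_bounded_support p1 uL mphi phiM.
have gphi := integrableM_bounded_support p1 gL mphi phiM.
have udphi := integrableM_bounded_support p1 uL mdphi dphiM.
have qphi m := integrableM_bounded_support p1 (qL m) mphi phiM.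
pose A m := (\int[mu]_x (quotient tau (h m) u x * phi x)%:E)%E.
have Ag : A @ \oo --> (\int[mu]_x (g x * phi x)%:E)%E.
  have [C CP] := integralM_le_pnorm mphi phiM.
  have gfin := integrable_fin_num measurableT gphi.
  have Afin m : A m \is a fin_num := integrable_fin_num measurableT (qphi m).
  rewrite -(fineK gfin); apply/fine_cvgP; split; first by apply: nearW => m; exact: Afin.
  apply: (@squeeze_cvgr _ _ _ _
    (fun m => fine (\int[mu]_x (g x * phi x)%:E)%E -
      C * pnorm mu p (fun x => quotient tau (h m) u x - g x))
    (fun m => fine (\int[mu]_x (g x * phi x)%:E)%E +
      C * pnorm mu p (fun x => quotient tau (h m) u x - g x))).
  - apply: nearW => m /=; rewrite -ler_distl -lee_fin.
    have := CP _ (LfunB p1' (qL m) gL); apply: le_trans.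
    rewrite (_ : (\int[mu]_x _ = A m - \int[mu]_x (g x * phi x)%:E)%E).
      by rewrite -(fineK (Afin m)) -(fineK gfin) -EFinB.
    rewrite /A -(integralB measurableT (qphi m) gphi).
    by apply: eq_integral => x _; rewrite mulrBl EFinB.
  - rewrite -[X in _ --> X]subr0 -[X in _ - X](mulr0 C).
    by apply: cvgB; [exact: cvg_cst|apply: cvgMr].
  - rewrite -[X in _ --> X]addr0 -[X in _ + X](mulr0 C).
    by apply: cvgD; [exact: cvg_cst|apply: cvgMr].
pose f_ m x := (u x * ((h m)^-1 * (phi (tau (- h m) x) - phi x)))%:E.
pose f x := (u x * - partial i phi x)%:E.
have Au : A @ \oo --> (\int[mu]_x f x)%E.
  have AE m : A m = (\int[mu]_x f_ m x)%E.
    have uhL := (Lfun_flow flow_tau p1 (h m) uL).1.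
    have uhphi := integrableM_bounded_support p1 uhL mphi phiM.
    have [uphih uphihE] := integralM_flow i p1 (h m) uL mphi phiM.
    transitivity ((h m)^-1%:E * (\int[mu]_x (u (tau (h m) x) * phi x)%:E -
        \int[mu]_x (u x * phi x)%:E))%E.
      rewrite -(integralB measurableT uhphi uphi).
      rewrite -(integralZl measurableT (integrableB measurableT uhphi uphi)).
      apply: eq_integral => x _; rewrite -EFinB -EFinM /quotient.
      by rewrite -mulrBl mulrA.
    rewrite uphihE -(integralB measurableT uphih uphi).
    rewrite -(integralZl measurableT (integrableB measurableT uphih uphi)).
    apply: eq_integral => x _; rewrite -EFinB -EFinM /f_.
    by rewrite -mulrBr mulrCA.
  rewrite (funext AE).
  pose k2 := (k' + (Num.truncn (1 : R)).+1)%N.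
  have u1 : mu.-integrable setT (fun x => (u x * (`|M'| * \1_(rV_cube k2) x))%:E).
    apply: (integrableM_bounded_support p1 (k := k2) (M := `|M'|) uL).
      apply: measurable_funM => //; apply/measurable_indicP.
      exact: measurable_rV_cube.
    by move=> x; rewrite normrM normr_id [X in _ * X]ger0_norm.
  have [] := @dominated_convergence _ _ _ mu setT measurableT f_ f
      (fun x => `|(u x * (`|M'| * \1_(rV_cube k2) x))%:E|)%E.
  - move=> m; apply/measurable_EFinP; apply: measurable_funM => //.
    apply: measurable_funM => //; apply: measurable_funB => //.
    exact: (measurableT_comp mphi (measurable_flow flow_tau _)).
  - by apply/measurable_EFinP; apply: measurable_funM => //; exact: measurableT_comp.
  - apply: aeW => x _; apply: cvg_EFin; first exact: nearW.
    apply: cvgMr => /=.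
    have [dphi D] := @is_derive_flow_test R n i phi x 0 phiT.
    have H : (fun t : R => t^-1 *: (((fun t => phi (tau (- t) x)) \o shift 0) (t *: (1 : R)) -
        phi (tau (- 0) x))) @ 0^' --> - partial i phi x.
      by move: D; rewrite [in RHS]oppr0 (flow0 flow_tau) => <-; exact: dphi.
    have hP : (forall m, h m != 0) /\ h @ \oo --> (0 : R).
      by split => // m; rewrite gt_eqF.
    have := (cvgr_dnbhsP _ _ _).1 H h hP.
    apply: cvg_trans; apply: near_eq_cvg; apply: nearW => m /=.
    by rewrite addr0 oppr0 (flow0 flow_tau) [h m *: 1]mulr1.
  - exact: integrable_abse.
  - apply: aeW => x m _; rewrite /f_ /= lee_fin [leLHS]normrM [leRHS]normrM ler_wpM2l//.
    rewrite (le_trans (test_function_quotient_bound x phiT dphiM (h01 m)))//.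
    exact: ler_norm.
  by [].
have E : (\int[mu]_x (g x * phi x)%:E = \int[mu]_x f x)%E.
  exact: (cvg_unique (@ereal_hausdorff R) Ag Au).
have fE : (\int[mu]_x f x = - \int[mu]_x (u x * partial i phi x)%:E)%E.
  under eq_integral do rewrite /f mulrN EFinN.
  by rewrite integralN//; exact: integrable_add_def.
apply/esym; transitivity (- \int[mu]_x f x)%E; first by rewrite -E.
by rewrite fE oppeK.
Qed.

End limit_of_quotients.

(** * The limit *)

Theorem theorem3p6 (R : realType) (N : nat) (p s : R) (i : 'I_N)
    (u : 'rV[R]_N -> R) (p_gt1 : 1 < p) (s_gt0 : 0 < s) (s_lt1 : s < 1)
    (uLp : u \in Lfun (lebesgue_rV R N) p%:E) :
  (forall g : 'rV[R]_N -> R, g \in Lfun (lebesgue_rV R N) p%:E ->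
    distributional_partial i u g ->
    ((delta `^ (p * (1 - s)))^-1%:E * directional_energy s p delta i u)%E
      @[delta --> 0^'+] -->
    ((2 / (p * (1 - s)))%:E *
      'N[lebesgue_rV R N]_p%:E[EFin \o g] `^ p)%E) /\
  ((~ exists2 g : 'rV[R]_N -> R, g \in Lfun (lebesgue_rV R N) p%:E &
      distributional_partial i u g) ->
    ((delta `^ (p * (1 - s)))^-1%:E * directional_energy s p delta i u)%E
      @[delta --> 0^'+] --> +oo%E).
Proof.
pose mu := sigma_finite_rV R N.
pose tau := @rV_flow R N i.
have flow_tau : measure_flow mu tau := @measure_flow_rV R N i.
have p1' := ltW p_gt1.
have LfunE (f : 'rV[R]_N -> R) :
    f \in Lfun mu p%:E <-> f \in Lfun (lebesgue_rV R N) p%:E.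
  by split => /LfunEP => /(_ p1') fL; apply/LfunEP.
have uL : u \in Lfun mu p%:E by exact/LfunE.
have energyE delta : directional_energy s p delta i u = flow_energy mu tau p s delta u by [].
under eq_fun do rewrite energyE.
split=> [g gLp ug|no_weak].
  have gL : g \in Lfun mu p%:E by exact/LfunE.
  have -> : ((2 / (p * (1 - s)))%:E *
      'N[lebesgue_rV R N]_p%:E[EFin \o g] `^ p)%E = (2 / (p * (1 - s)) * pnorm mu p g `^ p)%:E.
    rewrite -(pnormE gLp) poweR_EFin -EFinM; congr ((_ * _)%:E).
    by apply: EFin_inj; rewrite -(integral_pnorm p1' gLp) -(integral_pnorm p1' gL).
  apply: (cvg_flow_energy flow_tau) => //; last exact: pnorm_ge0.
  apply/cvgrPdist_le => e e0.
  have /cvgrPdist_le/(_ _ e0)[b /= b0 bP] := cvg_pnorm_flow flow_tau p_gt1 gL.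
  near=> h.
  have h0 : 0 < h by near: h; exact: nbhs_right_gt.
  have hb : h < b by near: h; exact: nbhs_right_lt.
  rewrite distrC (le_trans (pnorm_lerB p1' _ gL))//.
    exact: (Lfun_quotient flow_tau p_gt1).
  apply: (pnorm_quotient_sub flow_tau p_gt1 uL gL h0 (ltW e0)).
    exact: (distributional_partial_flow p_gt1 uL gL h0 ug).
  move=> t /andP[t0 th].
  (* The limit from the right says nothing about t = 0, where the increment is 0 anyway. *)
  have [->|tN0] := eqVneq t 0.
    by rewrite (pnorm_flow_diff0 flow_tau p_gt1 gL) ltW.
  have := bP t; rewrite /ball_/= sub0r normrN sub0r normrN ger0_norm// (le_lt_trans th hb).
  move=> /(_ isT); rewrite lt_neqAle eq_sym tN0 t0 => /(_ isT).
  exact: le_trans (ler_norm _).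
apply: (cvgy_flow_energy flow_tau) => //.
(* If the norms of the quotients do not tend to infinity, some M bounds them at arbitrarily small h;
   that is enough to construct the excluded derivative. *)
apply: contrapT => /existsNP[M HM]; apply: no_weak.
have small e : 0 < e -> exists2 h, 0 < h < e &
    pnorm mu p (fun x => u (tau h x) - u x) <= M * h.
  move=> e0; apply: contrapT => no_h; apply: HM; exists e => // h /andP[h0 he].
  rewrite leNgt; apply/negP => hM; apply: no_h; exists h; first by rewrite h0.
  move: hM; rewrite (pnorm_quotient flow_tau p_gt1)// gtr0_norm ?invr_gt0//.
  by rewrite mulrC ltr_pdivrMr// => /ltW.
have lin := pnorm_flow_diff_linear flow_tau p_gt1 uL small.
have [g gL gcvg] := cvg_dyadic_quotient flow_tau p_gt1 uL lin.
exists g; first exact/LfunE.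
apply: (cvg_quotient_distributional p_gt1 uL gL _ _ gcvg) => [m|].
  by rewrite exprn_gt0 ?invr_gt0//= exprn_ile1 ?invr_ge0// invf_le1 ?ler1n.
apply: cvg_expr; rewrite ger0_norm ?invr_ge0// invf_lt1 ?ltr1n//.
Unshelve. all: by end_near. Qed.
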